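(* Assume the network assumption, the stochastic gradient assumption, the unbiased compressor assumption (with parameter $C>0$) and the smoothness assumption (with constant $L$) stated in the context. Run CEDAS with constant stepsize $\eta_k=\eta>0$ and parameters $\alpha,\gamma>0$ satisfying $$\eta\le\frac{\gamma(1-\lambda_2)}{32L},\qquad \gamma\le\min\left\{\frac12,\frac{\alpha^2(1-\lambda_2)}{15872\,C},\frac{\alpha}{2}\right\},\qquad \alpha\le\frac{1}{4(C+1)}.$$ Then for every integer $K\ge1$, $$\frac1K\sum_{k=-1}^{K-2}\mathbb{E}\left[\|\nabla f(\bar x_k)\|^2\right]\le\frac{4\left(f(\bar x_{-1})-f^{\inf}\right)}{\eta K}+\frac{256\gamma CL^2\,\mathbb{E}[\|\mathbf{y}_0-H_0\|^2]}{n\alpha(1-\tilde\lambda_2)K}+\frac{6L\eta\sigma^2}{n}+\frac{168\eta^2L^2\sigma^2}{1-\tilde\lambda_2}+\frac{4L^2\|\mathbf{x}_{-1}-\mathbf{1}\bar x_{-1}^\top\|^2}{nK}+\frac{32L^2\,\mathbb{E}[\|\check h_0\|^2]}{n(1-\tilde\lambda_2)K}.$$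
   Context: Notation. There are $n\ge2$ agents; $f_i:\mathbb{R}^p\to\mathbb{R}$ is differentiable, $f=\frac1n\sum_{i=1}^nf_i$, and $f^{\inf}=\inf_{x\in\mathbb{R}^p}f(x)$ (finite). For $\mathbf{x}\in\mathbb{R}^{n\times p}$ with $i$-th row $x_i^\top$, $\bar x=\frac1n\sum_ix_i$, and $\nabla F(\mathbf{x})\in\mathbb{R}^{n\times p}$ has $i$-th row $\nabla f_i(x_i)^\top$. $\mathbf{1}\in\mathbb{R}^n$ is the all-ones vector. $\|\cdot\|$ is the Euclidean norm of vectors and the Frobenius norm of matrices; $\|\cdot\|_2$ is the spectral norm. Network assumption. The communication graph on the agents is undirected and connected; $W=(w_{ij})\in\mathbb{R}^{n\times n}$ is symmetric, entrywise nonnegative, positive semidefinite, $W\mathbf{1}=\mathbf{1}$, and for $i\ne j$ one has $w_{ij}=w_{ji}>0$ if $i,j$ are linked and $w_{ij}=w_{ji}=0$ otherwise. Its eigenvalues are $1=\lambda_1>\lambda_2\ge\cdots\ge\lambda_n\ge0$. CEDAS. Given stepsizes $\eta_k>0$ ($k\ge-1$), parameters $\alpha,\gamma>0$, a (possibly random) compression operator $\mathcal{C}:\mathbb{R}^p\to\mathbb{R}^p$ applied row by row, and deterministic $\mathbf{x}_{-1},H_0\in\mathbb{R}^{n\times p}$, set $D_0=0$, $\mathbf{x}_0=\mathbf{x}_{-1}-\eta_{-1}G_{-1}$, and for $k\ge0$: $\mathbf{y}_k=\mathbf{x}_k-\eta_kG_k-D_k$; $Q_k=\mathcal{C}(\mathbf{y}_k-H_k)$;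 $D_{k+1}=D_k+\frac\gamma2(I-W)(H_k+Q_k)$; $H_{k+1}=H_k+\alpha Q_k$; $\mathbf{x}_{k+1}=\mathbf{x}_k-\eta_kG_k-D_{k+1}$. Here $G_k$ has rows $g_{i,k}^\top$ with $g_{i,k}=\nabla f_i(x_{i,k};\xi_{i,k})$ the stochastic gradient, and $x_{i,k}^\top$ is the $i$-th row of $\mathbf{x}_k$. Stochastic gradient assumption. For all $k\ge-1$, conditionally on all randomness generated before the samples $\xi_{1,k},\dots,\xi_{n,k}$ are drawn, these samples are independent across $i$, $g_{i,k}$ has mean $\nabla f_i(x_{i,k})$, and $\|g_{i,k}-\nabla f_i(x_{i,k})\|^2$ has expectation at most $\sigma^2$ ($\sigma>0$). Unbiased compressor assumption. $\mathbb{E}[\mathcal{C}(x)\mid x]=x$ and $\mathbb{E}[\|\mathcal{C}(x)-x\|^2\mid x]\le C\|x\|^2$ for all $x\in\mathbb{R}^p$, with $C>0$; at each use these hold conditionally on all randomness preceding the compression. Smoothness assumption. Each $\nabla f_i$ is $L$-Lipschitz. Derived quantities. $\tilde W=I-\frac\gamma2(I-W)$ has eigenvalues $\tilde\lambda_i=1-\frac\gamma2(1-\lambda_i)$; $\tilde\Lambda_1=\mathrm{diag}(\tilde\lambda_2,\dots,\tilde\lambda_n)$; $Q_1\in\mathbb{R}^{n\times(n-1)}$ has orthonormal columns with $W=\frac{\mathbf{1}\mathbf{1}^\top}{n}+Q_1\,\mathrm{diag}(\lambda_2,\dots,\lambda_n)Q_1^\top$. Let $B=\begin{pmatrix}\tilde\Lambda_1&-\tilde\Lambda_1\sqrt{I-\tilde\Lambda_1}\\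 \sqrt{I-\tilde\Lambda_1}&\tilde\Lambda_1\end{pmatrix}$ and fix a decomposition $B=JP_1J^{-1}$ with $\|J\|_2\le\sqrt2$, $\|J^{-1}\|_2\le1/\sqrt{2\tilde\lambda_n}$, $\|P_1\|_2^2\le\tilde\lambda_2$, $\|P_1-I\|_2^2=\gamma(1-\lambda_n)/2$ (such a decomposition exists); write $J^{-1}=(J_{L,l}\;\;J_{L,r})$ with $J_{L,l},J_{L,r}\in\mathbb{R}^{2(n-1)\times(n-1)}$. Put $\hat{\mathbf{r}}_k=D_k+\eta_k\nabla F(\mathbf{1}\bar x_k^\top)$ and $\check h_k=J_{L,l}Q_1^\top\mathbf{x}_k+J_{L,r}(I-\tilde\Lambda_1)^{-1/2}Q_1^\top\hat{\mathbf{r}}_k$.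
   Formalization: The columns of Q_1 are additionally required to be orthogonal to the all-ones vector (the intended eigendecomposition of W); when λ_n = 0 the displayed identity for W does not force this, and the bound can fail without it. *)

(* Defs.v *)
From HB Require Import structures.
From mathcomp Require Export all_boot all_order all_algebra.
From mathcomp Require Export all_classical all_reals all_analysis.

Set Implicit Arguments.
Unset Strict Implicit.
Unset Printing Implicit Defensive.

Export Order.TTheory GRing.Theory Num.Theory.
Export numFieldNormedType.Exports.

Local Open Scope classical_set_scope.
Local Open Scope ring_scope.

Section Euclidean.
Context {R : realType}.

(* Vectors of R^p are rows 'rV_p.  The library norm on matrices is the sup norm,
   so the Euclidean/Frobenius norm and the induced spectral norm are defined
   here. *)
Definition enorm {m n : nat} (A : 'M[R]_(m, n)) : R :=
  Num.sqrt (\sum_i \sum_j A i j ^+ 2).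

Definition specnorm {m n : nat} (A : 'M[R]_(m, n)) : R :=
  sup [set enorm (A *m v) | v in [set v : 'cV[R]_n | enorm v <= 1]].

Definition grad {p : nat} (f : 'rV[R]_p -> R) (x : 'rV[R]_p) : 'rV[R]_p :=
  \row_j 'D_(delta_mx 0 j) f x.

Definition smooth {p : nat} (L : R) (f : 'rV[R]_p -> R) : Prop :=
  forall x y, enorm (grad f x - grad f y) <= L * enorm (x - y).

Definition mean_row {n p : nat} (x : 'M[R]_(n, p)) : 'rV[R]_p :=
  n%:R^-1 *: \sum_i row i x.

(* 1 v^T, every row equal to v *)
Definition consensus {n p : nat} (v : 'rV[R]_p) : 'M[R]_(n, p) :=
  const_mx 1 *m v.

Definition avg_fun {n p : nat} (f : 'I_n -> 'rV[R]_p -> R) (x : 'rV[R]_p) : R :=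
  n%:R^-1 * \sum_i f i x.

Definition gradF {n p : nat} (f : 'I_n -> 'rV[R]_p -> R) (x : 'M[R]_(n, p)) :
    'M[R]_(n, p) :=
  \matrix_(i < n) grad (f i) (row i x).

End Euclidean.

Section Network.
Context {R : realType} {n : nat}.

Record network (e : rel 'I_n) (W : 'M[R]_n) : Prop := Network {
  graph_sym : symmetric e;
  graph_irrefl : irreflexive e;
  graph_connected : forall i j, connect e i j;
  mix_sym : W^T = W;
  mix_ge0 : forall i j, 0 <= W i j;
  mix_psd : forall v : 'cV[R]_n, 0 <= (v^T *m W *m v) 0 0;
  mix_one : W *m (const_mx 1 : 'cV[R]_n) = const_mx 1;
  mix_linked : forall i j, i != j -> e i j -> 0 < W i j;
  mix_unlinked : forall i j, i != j -> ~~ e i j -> W i j = 0 }.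

(* The eigenvalues with multiplicity, in nonincreasing order; being 0-based,
   lam`_0 is lambda_1 and lam`_(n.-1) is lambda_n. *)
Definition spectrum (W : 'M[R]_n) (lam : n.-tuple R) : Prop :=
  char_poly W = \prod_(l <- lam) ('X - l%:P) /\ sorted >=%R lam.

Definition lam_tilde (gamma l : R) : R := 1 - gamma / 2 * (1 - l).

Definition Lam1 (lam : n.-tuple R) : 'M[R]_n.-1 :=
  diag_mx (\row_(j < n.-1) lam`_j.+1).

Definition Lam1_tilde (gamma : R) (lam : n.-tuple R) : 'M[R]_n.-1 :=
  diag_mx (\row_(j < n.-1) lam_tilde gamma lam`_j.+1).

Definition sqrt_ILam1 (gamma : R) (lam : n.-tuple R) : 'M[R]_n.-1 :=
  diag_mx (\row_(j < n.-1) Num.sqrt (1 - lam_tilde gamma lam`_j.+1)).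

(* Last condition: (1/sqrt n, Q1) is orthogonal.  It follows from the others
   only when W is nonsingular. *)
Definition eigenbasis (W : 'M[R]_n) (lam : n.-tuple R) (Q1 : 'M[R]_(n, n.-1)) :
    Prop :=
  [/\ Q1^T *m Q1 = 1%:M,
      W = n%:R^-1 *: const_mx 1 + Q1 *m Lam1 lam *m Q1^T &
      Q1^T *m (const_mx 1 : 'cV[R]_n) = 0].

Definition Bmx (gamma : R) (lam : n.-tuple R) : 'M[R]_(n.-1 + n.-1) :=
  block_mx (Lam1_tilde gamma lam)
           (- (Lam1_tilde gamma lam *m sqrt_ILam1 gamma lam))
           (sqrt_ILam1 gamma lam)
           (Lam1_tilde gamma lam).

Record decomposition (gamma : R) (lam : n.-tuple R)
    (J P1 : 'M[R]_(n.-1 + n.-1)) : Prop := Decomposition {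
  J_unit : J \in unitmx;
  B_JPJ : Bmx gamma lam = J *m P1 *m invmx J;
  J_norm : specnorm J <= Num.sqrt 2;
  Jinv_norm :
    specnorm (invmx J) <= (Num.sqrt (2 * lam_tilde gamma lam`_n.-1))^-1;
  P1_norm : specnorm P1 ^+ 2 <= lam_tilde gamma lam`_1;
  P1_sub1_norm : specnorm (P1 - 1%:M) ^+ 2 = gamma * (1 - lam`_n.-1) / 2 }.

(* J_{L,l} Q1^T x + J_{L,r} (I - Lam1_tilde)^{-1/2} Q1^T r *)
Definition check_h {p : nat} (gamma : R) (lam : n.-tuple R)
    (Q1 : 'M[R]_(n, n.-1)) (J : 'M[R]_(n.-1 + n.-1)) (x r : 'M[R]_(n, p)) :
    'M[R]_(n.-1 + n.-1, p) :=
  lsubmx (invmx J) *m (Q1^T *m x) +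
  rsubmx (invmx J) *m (invmx (sqrt_ILam1 gamma lam) *m (Q1^T *m r)).

End Network.

Section Conditioning.
Context {R : realType} {d : measure_display} {Omega : measurableType d}.
Variable P : probability Omega R.

Definition sub_sigma_algebra_of (F : set_system Omega) : Prop :=
  sigma_algebra setT F /\ F `<=` measurable.

Definition measurable_wrt (F : set_system Omega) {d' : measure_display}
    {T : measurableType d'} (X : Omega -> T) : Prop :=
  forall B : set T, measurable B -> F (X @^-1` B).

(* Y is a version of E[X | F] *)
Definition is_condexp (F : set_system Omega) (X Y : Omega -> R) : Prop :=
  [/\ P.-integrable setT (EFin \o X), P.-integrable setT (EFin \o Y),
      measurable_wrt F Y &
      forall A, F A ->
        (\int[P]_(w in A) (Y w)%:E = \int[P]_(w in A) (X w)%:E)%E].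

Definition is_condexp_vec (F : set_system Omega) {p : nat}
    (X Y : Omega -> 'rV[R]_p) : Prop :=
  forall j, is_condexp F (fun w => X w 0 j) (fun w => Y w 0 j).

(* E[X | F] <= Z almost surely *)
Definition condexp_le (F : set_system Omega) (X Z : Omega -> R) : Prop :=
  exists2 Y, is_condexp F X Y & {ae P, forall w, Y w <= Z w}.

(* Conditional independence given F.  Subfamilies are covered by taking some
   of the A i to be the whole space. *)
Definition cond_independent (F : set_system Omega) {n : nat}
    {d' : measure_display} {T : 'I_n -> measurableType d'}
    (xi : forall i, Omega -> T i) : Prop :=
  forall A : (forall i, set (T i)), (forall i, measurable (A i)) ->
  exists q : 'I_n -> Omega -> R,
    (forall i, is_condexp F (\1_(xi i @^-1` A i)) (q i)) /\
    is_condexp F (\1_(\bigcap_i (xi i @^-1` A i))) (fun w => \prod_i q i w).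

End Conditioning.

(* Joint measurability of (x, z) |-> h x z; R^p carries the product
   sigma-algebra of p.-tuple R. *)
Definition jointly_measurable {R : realType} {p : nat} {d : measure_display}
    {Z : measurableType d} (h : 'rV[R]_p -> Z -> 'rV[R]_p) : Prop :=
  forall j, measurable_fun setT
    (fun u : p.-tuple R * Z => h (\row_l tnth u.1 l) u.2 0 j).

Section Algorithm.
Context {R : realType} {n p : nat}.
Context {d : measure_display} {Omega : measurableType d}.
Context {dX : measure_display} {Xi : 'I_n -> measurableType dX}.
Context {dZ : measure_display} {Z : measurableType dZ}.

(* g i x z is the stochastic gradient of f_i at x computed from the sample z,
   and Cop x z is the compression of x computed with the random seed z.
   xi k i is the sample of agent i at time k >= -1, and zeta k i is the seed
   used at time k >= 0 to compress the i-th row. *)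
Variable g : forall i : 'I_n, 'rV[R]_p -> Xi i -> 'rV[R]_p.
Variable Cop : 'rV[R]_p -> Z -> 'rV[R]_p.
Variable xi : int -> forall i : 'I_n, Omega -> Xi i.
Variable zeta : nat -> 'I_n -> Omega -> Z.

Definition stoch_grad (x : int -> Omega -> 'M[R]_(n, p)) (k : int) (w : Omega) :
    'M[R]_(n, p) :=
  \matrix_(i < n) g (row i (x k w)) (xi k i w).

Definition compress (k : nat) (w : Omega) (y : 'M[R]_(n, p)) : 'M[R]_(n, p) :=
  \matrix_(i < n) Cop (row i y) (zeta k i w).

(* x and eta are indexed by k >= -1; their values below -1 are irrelevant. *)
Record cedas (W : 'M[R]_n) (eta : int -> R) (alpha gamma : R)
    (x_m1 H_0 : 'M[R]_(n, p)) (x : int -> Omega -> 'M[R]_(n, p))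
    (y D H Q : nat -> Omega -> 'M[R]_(n, p)) : Prop := Cedas {
  cedas_xm1 : forall w, x (-1) w = x_m1;
  cedas_H0 : forall w, H 0%N w = H_0;
  cedas_D0 : forall w, D 0%N w = 0;
  cedas_x0 : forall w, x 0 w = x (-1) w - eta (-1) *: stoch_grad x (-1) w;
  cedas_y : forall (k : nat) w,
    y k w = x k w - eta k *: stoch_grad x k w - D k w;
  cedas_Q : forall k w, Q k w = compress k w (y k w - H k w);
  cedas_D : forall k w,
    D k.+1 w = D k w + (gamma / 2) *: ((1%:M - W) *m (H k w + Q k w));
  cedas_H : forall k w, H k.+1 w = H k w + alpha *: Q k w;
  cedas_x : forall (k : nat) w,
    x k.+1 w = x k w - eta k *: stoch_grad x k w - D k.+1 w }.

(* FS k contains all randomness generated before the samples xi k are drawn,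
   FC k all randomness preceding the compression at time k. *)
Record history (FS : int -> set_system Omega) (FC : nat -> set_system Omega) :
    Prop := History {
  FS_sub : forall k : int, -1 <= k -> sub_sigma_algebra_of (FS k);
  FC_sub : forall k : nat, sub_sigma_algebra_of (FC k);
  FS_m1 : FS (-1) `<=` FS 0;
  FS_FC : forall k : nat, FS k `<=` FC k;
  FC_FS : forall k : nat, FC k `<=` FS k.+1;
  xi_m1_meas : forall i, measurable_wrt (FS 0) (xi (-1) i);
  xi_meas : forall (k : nat) i, measurable_wrt (FC k) (xi k i);
  zeta_meas : forall (k : nat) i, measurable_wrt (FS k.+1) (zeta k i) }.

Definition stoch_grad_assumption (P : probability Omega R)
    (f : 'I_n -> 'rV[R]_p -> R) (sigma : R) (FS : int -> set_system Omega)
    (x : int -> Omega -> 'M[R]_(n, p)) : Prop :=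
  forall k : int, -1 <= k ->
  cond_independent P (FS k) (xi k) /\
  forall i : 'I_n,
    let gik w := row i (stoch_grad x k w) in
    let dik w := grad (f i) (row i (x k w)) in
    is_condexp_vec P (FS k) gik dik /\
    condexp_le P (FS k) (fun w => enorm (gik w - dik w) ^+ 2)
      (cst (sigma ^+ 2)).

Definition unbiased_at (P : probability Omega R) (C : R) (F : set_system Omega)
    (X : Omega -> 'rV[R]_p) (z : Omega -> Z) : Prop :=
  is_condexp_vec P F (fun w => Cop (X w) (z w)) X /\
  condexp_le P F (fun w => enorm (Cop (X w) (z w) - X w) ^+ 2)
    (fun w => C * enorm (X w) ^+ 2).

(* Unbiasedness and relative variance at most C, given the past, for every fixed
   vector and for the random vectors actually compressed. *)
Definition compressor_assumption (P : probability Omega R) (C : R)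
    (FC : nat -> set_system Omega) (y H : nat -> Omega -> 'M[R]_(n, p)) : Prop :=
  forall (k : nat) (i : 'I_n),
  (forall v : 'rV[R]_p, unbiased_at P C (FC k) (cst v) (zeta k i)) /\
  unbiased_at P C (FC k) (fun w => row i (y k w - H k w)) (zeta k i).

End Algorithm.

(* Main.v *)
Require Import Defs.
From mathcomp Require Import measurable_realfun.
From mathcomp Require Import ring lra.

Set Implicit Arguments.
Unset Strict Implicit.
Unset Printing Implicit Defensive.

Import HBNNSimple.

Local Open Scope classical_set_scope.
Local Open Scope ring_scope.

(** The averages of the iterates follow inexact stochastic gradient descent: the
    column sums of [D] vanish ([D_step]), so the average moves by [- eta] times the
    averaged stochastic gradient ([mean_step]), whatever the network and the
    compressor do. The descent lemma then bounds the sum of the squared gradients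
    by the initial gap, by the variance [sigma ^+ 2 / n] of the averaged noise, and
    by the consensus error, multiplied by [L ^+ 2 / n] ([descent_step]).

    The consensus error is controlled by the vector [check_h]. Let [S] be the square
    root of [I] minus the transformed eigenvalues. In the eigenbasis [Q1] of the
    network, the disagreement of [x] and the tracking variable, rescaled by the
    inverse of [S], evolve by the matrix [Bmx] up to perturbations; in the
    coordinates given by [J] the linear part becomes [P1], whose squared norm is at
    most [1 - rho] with [rho = gamma / 2 * (1 - lambda_2)] ([check_h_step]). There
    are four perturbations. The gradient error due to disagreement is absorbed by
    the contraction because [eta * L <= rho / 16]. The gradient noise is orthogonal
    to the past, and adds [n * eta ^+ 2 * sigma ^+ 2]. The displacement of the
    average, amplified by [rho ^- 2], is small for the same reason as the first. The
    compression error is orthogonal to everything before it, and carries a factor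
    [gamma] coming from [S] ([hstate_moment_step], [state_recursion]).

    The compression error is proportional to the residual [y - H]. One update of [H]
    contracts this residual by [1 - alpha] up to the displacement of [y], which is
    governed by [check_h] with a factor [gamma], by the noise and by the gradient at
    the average ([residual_moment_step], [residual_recursion]). With weight
    [2 * gamma * C / alpha] on the residual, the coupling terms close because
    [gamma ^+ 2 * C / alpha ^+ 2] is a small multiple of [rho]
    ([lyapunov_step]). Summing this recursion and the descent inequality, and
    absorbing the gradient terms, gives the rate with room in every constant
    ([sum_bound], [run_bound]).

    The probabilistic input is that a variable whose conditional expectation given a
    sub-sigma-algebra vanishes is orthogonal to the square-integrable variables
    measurable for it ([centered_mul]). This yields every orthogonality above, once
    the iterates are known to be square integrable and measurable for the past
    ([good_states]). The variance of the averaged noise also needs the noises of two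
    agents to be orthogonal: conditional independence of the samples is transported
    to the sigma-algebras that they generate together with the past
    ([centered_mul_indep]). *)

(** * Expectations and centred variables *)

Section Expectation.
Context {R : realType} {d : measure_display} {Omega : measurableType d}.
Variable P : probability Omega R.
Implicit Types X Y : Omega -> R.

Definition is_L1 X := P.-integrable setT (EFin \o X).
Definition expect X : R := \int[P]_w X w.

Lemma L1_meas X : is_L1 X -> measurable_fun setT X.
Proof. by move=> /integrableP[/measurable_EFinP]. Qed.

Lemma L1D X Y : is_L1 X -> is_L1 Y -> is_L1 (fun w => X w + Y w).
Proof. by move=> hX hY; exact: (integrableD measurableT hX hY). Qed.

Lemma L1Z c X : is_L1 X -> is_L1 (fun w => c * X w).
Proof. by move=> hX; exact: (integrableZl measurableT c hX). Qed.

Lemma L1B X Y : is_L1 X -> is_L1 Y -> is_L1 (fun w => X w - Y w).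
Proof. by move=> hX hY; exact: (integrableB measurableT hX hY). Qed.

Lemma L1_cst c : is_L1 (fun=> c).
Proof. exact: finite_measure_integrable_cst. Qed.

Lemma L1_sum (I : Type) (s : seq I) (F : I -> Omega -> R) :
  (forall i, is_L1 (F i)) -> is_L1 (fun w => \sum_(i <- s) F i w).
Proof.
move=> hF; elim: s => [|i s IH].
  by rewrite (_ : (fun=> _) = fun=> 0); [exact: L1_cst|apply/funext => w; rewrite big_nil].
rewrite (_ : (fun=> _) = fun w => F i w + \sum_(j <- s) F j w).
  exact: L1D.
by apply/funext => w; rewrite big_cons.
Qed.

Lemma L1_le X Y : measurable_fun setT X -> is_L1 Y ->
  (forall w, `|X w| <= Y w) -> is_L1 X.
Proof.
move=> mX hY XY; apply: le_integrable hY => //.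
  exact/measurable_EFinP.
by move=> w _ /=; rewrite lee_fin (le_trans (XY w))// ler_norm.
Qed.

Lemma L1_abs X : is_L1 X -> is_L1 (fun w => `|X w|).
Proof. by move=> hX; exact: (integrable_abse hX). Qed.

Lemma ExD X Y : is_L1 X -> is_L1 Y -> expect (fun w => X w + Y w) = expect X + expect Y.
Proof. by move=> hX hY; exact: RintegralD. Qed.

Lemma ExB X Y : is_L1 X -> is_L1 Y -> expect (fun w => X w - Y w) = expect X - expect Y.
Proof. by move=> hX hY; exact: RintegralB. Qed.

Lemma ExZ c X : is_L1 X -> expect (fun w => c * X w) = c * expect X.
Proof. by move=> hX; exact: RintegralZl. Qed.

Lemma Ex_cst c : expect (fun=> c) = c.
Proof.
have : expect (fun=> c) = c * fine (P setT) := Rintegral_cst P measurableT c.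
by rewrite probability_setT mulr1.
Qed.

Lemma Ex_sum (I : Type) (s : seq I) (F : I -> Omega -> R) :
  (forall i, is_L1 (F i)) ->
  expect (fun w => \sum_(i <- s) F i w) = \sum_(i <- s) expect (F i).
Proof.
move=> hF; elim: s => [|i s IH].
  by rewrite big_nil -[RHS]Ex_cst; congr expect; apply/funext => w; rewrite big_nil.
rewrite big_cons -IH -ExD//; last exact: L1_sum.
by congr expect; apply/funext => w; rewrite big_cons.
Qed.

Lemma Ex_le X Y : is_L1 X -> is_L1 Y -> (forall w, X w <= Y w) -> expect X <= expect Y.
Proof. by move=> hX hY XY; apply: le_Rintegral => // w _; exact: XY. Qed.

Lemma Ex_ge0 X : (forall w, 0 <= X w) -> 0 <= expect X.
Proof. by move=> hX; apply: Rintegral_ge0 => w _; exact: hX. Qed.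

Lemma EFin_Ex X : is_L1 X -> (\int[P]_w (X w)%:E = (expect X)%:E)%E.
Proof. by move=> hX; rewrite fineK//; exact: integrable_fin_num. Qed.

Lemma Ex_dct (F : nat -> Omega -> R) X Y : (forall m, is_L1 (F m)) ->
  measurable_fun setT X -> is_L1 Y ->
  (forall w, F ^~ w @ \oo --> X w) -> (forall m w, `|F m w| <= Y w) ->
  (fun m => expect (F m)) @ \oo --> expect X.
Proof.
move=> hF mX hY cF dF.
have [|||||iX _ h] := @dominated_convergence _ _ _ P setT measurableT
  (fun m => EFin \o F m) (EFin \o X) (EFin \o Y).
- by move=> m; case/integrableP: (hF m).
- exact/measurable_EFinP.
- by apply: aeW => w _; apply: cvg_EFin; [exact: nearW|exact: cF].
- exact: hY.
- by apply: aeW => w m _; rewrite /= lee_fin.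
- apply: fine_cvg; rewrite fineK//; exact: integrable_fin_num.
Qed.

Lemma L1_indic X S : is_L1 X -> measurable S -> is_L1 (fun w => X w * \1_S w).
Proof.
move=> hX mS; apply: (@L1_le _ (fun w => `|X w|)).
- by apply: measurable_funM; [exact: L1_meas|exact: measurable_indic].
- exact: (integrable_abse hX).
- move=> w; rewrite normrM ler_piMr// indicE.
  by case: (_ \in _); rewrite ?normr1// normr0.
Qed.

Lemma Rint_indic X S : \int[P]_(w in S) X w = expect (fun w => X w * \1_S w).
Proof.
rewrite Rintegral_mkcond; congr (Rintegral _ _ _); apply/funext => w.
by rewrite patchE indicE; case: ifP => _; rewrite ?mulr1 ?mulr0.
Qed.

(** Zero conditional expectation given [F], tested on the events of [F]. *)
Definition is_centered (F : set_system Omega) (X : Omega -> R) : Prop :=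
  is_L1 X /\ forall S, F S -> expect (fun w => X w * \1_S w) = 0.

Lemma condexp_centered F X Y : sub_sigma_algebra_of F -> is_condexp P F X Y ->
  is_centered F (fun w => X w - Y w).
Proof.
move=> [_ Fm] [hX hY _ XY]; split; first exact: L1B.
move=> S FS; have mS := Fm _ FS.
under [X in expect X]eq_fun do rewrite mulrBl.
rewrite ExB; [|exact: L1_indic..].
by rewrite -!Rint_indic /Rintegral XY// subrr.
Qed.

Section Sub.
Variable F : set_system Omega.
Hypothesis subF : sub_sigma_algebra_of F.

Lemma sub_measE : (measurable : set (set (g_sigma_algebraType F))) = F.
Proof. by apply: sigma_algebra_id; case: subF. Qed.

Lemma measurable_wrtP d' (T : measurableType d') (X : Omega -> T) :
  measurable_wrt F X <->
  measurable_fun [set: g_sigma_algebraType F] (X : g_sigma_algebraType F -> T).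
Proof.
split=> [h _ B mB|h B mB]; first by rewrite setTI sub_measE; exact: h.
by have := h measurableT B mB; rewrite setTI sub_measE.
Qed.

Lemma measurable_wrt_meas d' (T : measurableType d') (X : Omega -> T) :
  measurable_wrt F X -> measurable_fun setT X.
Proof. by move=> h _ B mB; rewrite setTI; case: subF => _; apply; exact: h. Qed.

(** The defining identity extends from events to simple functions by linearity,
    and to a nonnegative multiplier by dominated convergence along an increasing
    sequence of simple functions measurable for the sub-sigma-algebra. *)
Lemma centered_mul_ge0 X Y : measurable_wrt F X -> (forall w, 0 <= X w) ->
  is_centered F Y -> is_L1 (fun w => X w * Y w) -> expect (fun w => X w * Y w) = 0.
Proof.
move=> mX X0 [hY cY] hXY.
have mX' := proj1 (measurable_wrtP _) mX.
pose TF := g_sigma_algebraType F.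
pose B : nat -> {nnsfun TF >-> R} := nnsfun_approx (@measurableT _ TF)
  (proj2 (measurable_EFinP _ _) mX').
pose A m : TF -> R := B m.
have AX w : (fun m => A m w) @ \oo --> X w.
  have := @cvg_nnsfun_approx _ _ _ _ (@measurableT _ TF) _
    (proj2 (measurable_EFinP _ _) mX') (fun x _ => X0 x) w I.
  by move=> /fine_cvgP[].
have AleX m w : `|A m w| <= X w.
  rewrite ger0_norm//.
  have ndA : nondecreasing_seq (fun m => A m w).
    by move=> a b ab; exact/lefP/nd_nnsfun_approx.
  rewrite -(cvg_lim (@Rhausdorff R) (AX w)).
  by apply: nondecreasing_cvgn_le => //; apply/cvg_ex; exists (X w).
have AE m w : A m w * Y w = \sum_(y <- finmap.enum_fset (fset_set (range (A m))))
    y * (Y w * \1_(A m @^-1` [set y]) w).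
  rewrite {1}/A (fimfunE (B m)) fsbig_finite; last exact: fimfunP.
  rewrite /= big_distrl/=; apply: eq_bigr => y _.
  by rewrite -mulrA; congr (_ * _); rewrite mulrC.
have mS m y : F (A m @^-1` [set y]).
  have : measurable (A m @^-1` [set y]) by exact: measurable_sfunP.
  by rewrite sub_measE.
have hA m : is_L1 (fun w => A m w * Y w).
  under eq_fun do rewrite AE.
  apply: L1_sum => y; apply: L1Z; apply: L1_indic => //.
  by case: subF => _; apply.
have EA m : expect (fun w => A m w * Y w) = 0.
  under [X in expect X]eq_fun do rewrite AE.
  rewrite Ex_sum => [|y]; last first.
    by apply: L1Z; apply: L1_indic => //; case: subF => _; apply.
  rewrite big1// => y _; rewrite ExZ ?cY ?mulr0//.
  by apply: L1_indic => //; case: subF => _; apply.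
have : (fun m => expect (fun w => A m w * Y w)) @ \oo --> expect (fun w => X w * Y w).
  apply: (@Ex_dct _ _ (fun w => `|X w * Y w|)) => //.
  - exact: L1_meas.
  - exact: (integrable_abse hXY).
  - by move=> w; apply: cvgMl; exact: AX.
  - by move=> m w; rewrite !normrM ler_wpM2r// (le_trans (AleX m w))// ler_norm.
under eq_fun do rewrite EA.
by move=> /(cvg_lim (@Rhausdorff R)) <-; rewrite lim_cst.
Qed.

(** Taking out what is known. *)
Lemma centered_mul X Y : measurable_wrt F X -> is_centered F Y ->
  is_L1 (fun w => X w * Y w) -> expect (fun w => X w * Y w) = 0.
Proof.
move=> mX cY hXY.
have mX' := proj1 (measurable_wrtP _) mX.
have mp : measurable_wrt F (fun w => Num.max (X w) 0).
  by apply/measurable_wrtP; exact: measurable_maxr.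
have mn : measurable_wrt F (fun w => Num.max (- X w) 0).
  apply/measurable_wrtP; apply: measurable_maxr => //.
  exact: measurableT_comp.
have hd (Z : Omega -> R) : measurable_wrt F Z -> (forall w, `|Z w| <= `|X w|) ->
    is_L1 (fun w => Z w * Y w).
  move=> mZ ZX; apply: (@L1_le _ (fun w => `|X w * Y w|)).
  - apply: measurable_funM; first exact: measurable_wrt_meas.
    by apply: L1_meas; case: cY.
  - exact: (integrable_abse hXY).
  - by move=> w; rewrite !normrM ler_wpM2r.
have hp : is_L1 (fun w => Num.max (X w) 0 * Y w).
  apply: hd => // w; case: (leP (X w) 0) => h; rewrite ?normr0//.
have hn : is_L1 (fun w => Num.max (- X w) 0 * Y w).
  apply: hd => // w; case: (leP (- X w) 0) => h; rewrite ?normr0 ?normrN//.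
rewrite (_ : (fun w => _) =
  fun w => Num.max (X w) 0 * Y w - Num.max (- X w) 0 * Y w); last first.
  apply/funext => w; rewrite -mulrBl; congr (_ * _).
  case: (leP (X w) 0); case: (leP (- X w) 0); lra.
rewrite ExB// !centered_mul_ge0 ?subr0// => w; by rewrite le_max lexx orbT.
Qed.

End Sub.

(** Dynkin's lemma: it suffices to test on a pi-system. *)
Lemma centered_pi (G : set_system Omega) X :
  setI_closed G -> G setT -> G `<=` measurable ->
  is_centered G X -> is_centered <<s G >> X.
Proof.
move=> GI GT Gm [hX cX]; split=> //.
pose D := [set S | measurable S /\ expect (fun w => X w * \1_S w) = 0].
suff : <<s G >> `<=` D by move=> h S /h[].
rewrite -(setI_closed_g_dynkin_g_sigma_algebra GI).
apply: smallest_sub; last by move=> S GS; split; [exact: Gm|exact: cX].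
have XT : expect X = 0.
  rewrite -(cX _ GT); congr expect; apply/funext => w.
  by rewrite indicE in_setT mulr1.
split; first by split=> //; exact: cX.
- move=> S [mS XS]; split; first exact: measurableC.
  rewrite -[RHS](subrr 0) -{1}XT -XS -ExB//; last exact: L1_indic.
  congr expect; apply/funext => w; rewrite !indicE in_setC.
  by case: (_ \in _); rewrite /= ?mulr1 ?mulr0 ?subr0 ?subrr.
- move=> S tS DS; have mS n : measurable (S n) by case: (DS n).
  split; first exact: bigcupT_measurable.
  rewrite -Rint_indic /Rintegral integral_bigcup//; last first.
    apply: integrableS hX => //; exact: bigcupT_measurable.
  rewrite eseries0// => n _ _.
  rewrite -[LHS]fineK; last first.
    by apply: integrable_fin_num => //; apply: integrableS hX.
  by have [_] := DS n; rewrite -Rint_indic /Rintegral => ->.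
Qed.

End Expectation.

(** * Conditionally independent samples *)

Section CondIndep.
Context {R : realType} {d : measure_display} {Omega : measurableType d}.
Variable P : probability Omega R.
Implicit Types X Y : Omega -> R.
Notation L1 := (is_L1 P).
Notation Ex := (expect P).
Notation centered := (is_centered P).

Lemma Ex_ae X Y : measurable_fun setT X -> measurable_fun setT Y ->
  {ae P, forall w, X w = Y w} -> Ex X = Ex Y.
Proof.
move=> mX mY XY; rewrite /expect /Rintegral; congr fine.
apply: ae_eq_integral => //; [exact/measurable_EFinP..|].
by apply: filterS XY => w /= -> _.
Qed.


Lemma L1_bnd X : measurable_fun setT X -> (forall w, `|X w| <= 1) -> L1 X.
Proof. by move=> mX X1; apply: (L1_le mX (L1_cst P 1)). Qed.

Section Fixed.
Variable F : set_system Omega.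
Hypothesis subF : sub_sigma_algebra_of F.

Lemma measurable_wrtM X Y : measurable_wrt F X -> measurable_wrt F Y ->
  measurable_wrt F (fun w => X w * Y w).
Proof.
move=> /(measurable_wrtP subF) mX /(measurable_wrtP subF) mY.
by apply/(measurable_wrtP subF); exact: measurable_funM.
Qed.

Lemma measurable_wrtB X Y : measurable_wrt F X -> measurable_wrt F Y ->
  measurable_wrt F (fun w => X w - Y w).
Proof.
move=> /(measurable_wrtP subF) mX /(measurable_wrtP subF) mY.
by apply/(measurable_wrtP subF); exact: measurable_funB.
Qed.

Lemma measurable_wrt_indic S : F S -> measurable_wrt F (\1_S : Omega -> R).
Proof.
move=> FS; apply/(measurable_wrtP subF).
by apply: (@measurable_indic _ (g_sigma_algebraType F)); rewrite sub_measE.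
Qed.

Lemma centered_mul_bnd X Y : measurable_wrt F X -> (forall w, `|X w| <= 1) ->
  centered F Y -> centered F (fun w => X w * Y w).
Proof.
move=> mX X1 cY; have [hY _] := cY.
have hl (Z : Omega -> R) : measurable_wrt F Z -> (forall w, `|Z w| <= 1) ->
    L1 (fun w => Z w * Y w).
  move=> mZ Z1; apply: (@L1_le _ _ _ P _ (fun w => `|Y w|)).
  - by apply: measurable_funM; [exact: measurable_wrt_meas mZ|exact: L1_meas hY].
  - exact: (integrable_abse hY).
  - by move=> w; rewrite normrM ler_piMl.
split; first exact: hl.
move=> S FS; under [X in Ex X]eq_fun do rewrite mulrAC.
have mXS := measurable_wrtM mX (measurable_wrt_indic FS).
apply: (centered_mul subF) => //; apply: hl => // w.
by rewrite normrM indicE; case: (_ \in _); rewrite ?normr1 ?normr0 ?mulr1 ?mulr0.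
Qed.

Lemma centeredB X Y : centered F X -> centered F Y -> centered F (fun w => X w - Y w).
Proof.
move=> [hX cX] [hY cY]; split; first exact: L1B.
move=> S FS; have mS : measurable S by case: subF => _; apply.
under [X in Ex X]eq_fun do rewrite mulrBl.
by rewrite ExB ?cX ?cY ?subrr//; exact: L1_indic.
Qed.

(** Test on the event where [X] is negative. *)
Lemma ae_ge0 X : L1 X -> measurable_wrt F X ->
  (forall S, F S -> 0 <= Ex (fun w => X w * \1_S w)) ->
  {ae P, forall w, 0 <= X w}.
Proof.
move=> hX mX X0.
pose S := X @^-1` `]-oo, 0[%classic.
have FS : F S by exact: mX.
have mS : measurable S by case: subF => _; apply.
have hXS := L1_indic hX mS.
have : (\int[P]_(w in setT) `|(X w * \1_S w)%:E| = 0)%E.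
  under eq_integral => w _.
    rewrite (_ : `|_|%E = (- (X w * \1_S w))%:E); last first.
      rewrite /= ler0_norm// /S indicE; case: (boolP (_ \in _)); rewrite ?mulr0//.
      by rewrite in_setE /= in_itv/= mulr1 => /ltW.
    over.
  have hN : L1 (fun w => - (X w * \1_S w)).
    by under eq_fun do rewrite -mulN1r; exact: L1Z.
  rewrite EFin_Ex//; congr EFin; apply/eqP; rewrite eq_le; apply/andP; split.
    under [Z in Ex Z]eq_fun do rewrite -mulN1r.
    by rewrite ExZ// mulN1r oppr_le0 X0.
  apply: Ex_ge0 => w; rewrite oppr_ge0 /S indicE.
  case: (boolP (_ \in _)); rewrite ?mulr0//.
  by rewrite in_setE /= in_itv/= mulr1 => /ltW.
move=> /(ae_eq_integral_abs P measurableT (proj2 (measurable_EFinP _ _) (L1_meas hXS))).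
apply: filterS => w /= /(_ I)[]; rewrite /S indicE.
case: (boolP (_ \in _)); last by rewrite notin_setE /= in_itv/= => /negP; rewrite -leNgt.
by rewrite in_setE /= in_itv/= mulr1 => + ->; rewrite lexx.
Qed.

(** Versions of conditional probabilities are only almost surely in [0, 1];
    truncation gives a version that is so everywhere, hence a bounded multiplier. *)
Lemma condexp_indic_01 A q : measurable A -> is_condexp P F (\1_A : Omega -> R) q ->
  exists q' : Omega -> R, [/\ measurable_wrt F q', forall w, 0 <= q' w <= 1 &
    {ae P, forall w, q w = q' w}].
Proof.
move=> mA cA; have [_ hq mq _] := cA; have [_ cq] := condexp_centered subF cA.
have h1A : L1 (\1_A) by case: cA.
have Fm S : F S -> measurable S by case: subF => _; apply.
have h1 : {ae P, forall w, 0 <= q w}.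
  apply: ae_ge0 => // S FS.
  have := cq _ FS; under [X in Ex X]eq_fun do rewrite mulrBl.
  rewrite ExB; [|by apply: L1_indic => //; exact: Fm..].
  move=> /eqP; rewrite subr_eq0 => /eqP <-.
  by apply: Ex_ge0 => w; rewrite !indicE mulr_ge0.
have h2 : {ae P, forall w, 0 <= 1 - q w}.
  apply: ae_ge0; first by apply: L1B => //; exact: L1_cst.
    apply: measurable_wrtB => //; apply/(measurable_wrtP subF).
    exact: measurable_cst.
  move=> S FS.
  have := cq _ FS; under [X in Ex X]eq_fun do rewrite mulrBl.
  rewrite ExB; [|by apply: L1_indic => //; exact: Fm..].
  under [X in _ -> 0 <= Ex X]eq_fun do rewrite mulrBl mul1r.
  rewrite ExB; [|by apply: (L1_bnd); [exact: measurable_indic (Fm _ FS)|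
     move=> w; rewrite indicE; case: (_ \in _); rewrite ?normr1 ?normr0]|
     by apply: L1_indic => //; exact: Fm].
  move=> /eqP; rewrite subr_eq0 => /eqP <-.
  rewrite subr_ge0; apply: Ex_le.
  - by apply: L1_indic => //; exact: Fm.
  - apply: L1_bnd; first exact: measurable_indic (Fm _ FS).
    by move=> w; rewrite indicE; case: (_ \in _); rewrite ?normr1 ?normr0.
  - move=> w; rewrite !indicE; case: (_ \in A); case: (_ \in S);
     by rewrite ?mulr1 ?mulr0 ?mul0r.
exists (fun w => Num.min (Num.max (q w) 0) 1); split.
- apply/(measurable_wrtP subF); apply: measurable_minr => //.
  by apply: measurable_maxr => //; exact/(measurable_wrtP subF).
- by move=> w; rewrite le_min le_max lexx orbT ler01 /= ge_min lexx orbT.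
- apply: filterS2 h1 h2 => w q0; rewrite subr_ge0 => q1.
  by rewrite (max_idPl q0) (min_idPl q1).
Qed.

Variables (n : nat) (d' : measure_display) (T : 'I_n -> measurableType d').
Variable (xi : forall i, Omega -> T i).
Hypothesis xi_meas : forall i, measurable_fun setT (xi i).
Hypothesis indep : cond_independent P F xi.

(** The samples other than [i] and [j] are tested on the whole space; their
    conditional probabilities are then almost surely 1 and drop out of the product. *)
Lemma cond_indep_pair (i j : 'I_n) (A : set (T i)) (B : set (T j)) : i != j ->
  measurable A -> measurable B ->
  exists q q' : Omega -> R, [/\ measurable_wrt F q /\ measurable_wrt F q',
   (forall w, 0 <= q w <= 1) /\ (forall w, 0 <= q' w <= 1),
   centered F (fun w => \1_(xi i @^-1` A) w - q w),
   centered F (fun w => \1_(xi j @^-1` B) w - q' w) &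
   centered F (fun w => \1_(xi i @^-1` A) w * \1_(xi j @^-1` B) w - q w * q' w)].
Proof.
move=> ij mA mB.
pose E : forall k, set (T k) := dfwith (dfwith (fun k => [set: T k]) i A) j B.
have Ei : E i = A by rewrite /E dfwithout 1?eq_sym// dfwithin.
have Ej : E j = B by rewrite /E dfwithin.
have Ek k : k != i -> k != j -> E k = setT.
  by move=> ki kj; rewrite /E !dfwithout// eq_sym.
have mE k : measurable (E k).
  have [<-|jk] := eqVneq j k; first by rewrite Ej.
  have [<-|ik] := eqVneq i k; first by rewrite Ei.
  by rewrite Ek// eq_sym.
have [q [cq cqq]] := indep mE.
have mxi k : measurable (xi k @^-1` E k).
  by rewrite -[X in measurable X]setTI; apply: xi_meas => //; exact: mE.
have /choice[q' hq'] : forall k, exists q' : Omega -> R,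
    [/\ measurable_wrt F q', forall w, 0 <= q' w <= 1 &
    {ae P, forall w, q k w = q' w}] by move=> k; apply: condexp_indic_01 (cq k).
have mm (Z : Omega -> R) : measurable_wrt F Z -> measurable_fun setT Z.
  exact: measurable_wrt_meas.
have h01 (Z : Omega -> R) : measurable_fun setT Z -> (forall w, 0 <= Z w <= 1) -> L1 Z.
  by move=> mZ Z01; apply: L1_bnd => // w; have /andP[? ?] := Z01 w; rewrite ger0_norm.
have cae X Y Y' : measurable_fun setT X -> (forall w, 0 <= X w <= 1) ->
    centered F (fun w => X w - Y w) -> measurable_fun setT Y ->
    measurable_wrt F Y' -> (forall w, 0 <= Y' w <= 1) -> {ae P, forall w, Y w = Y' w} ->
    centered F (fun w => X w - Y' w).
  move=> mX X01 [hXY cXY] mY mY' Y'01 YY'; have hX := h01 _ mX X01.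
  split; first by apply: L1B => //; apply: h01 => //; exact: mm.
  move=> S FS; have mS : measurable S by case: subF => _; apply.
  rewrite -(cXY _ FS); apply: Ex_ae.
  - by apply: measurable_funM; [apply: measurable_funB => //; exact: mm|exact: measurable_indic].
  - by apply: measurable_funM; [apply: measurable_funB => //; exact: mm|exact: measurable_indic].
  - by apply: filterS YY' => w ->.
have i01 (S : set Omega) w : 0 <= (\1_S w : R) <= 1.
  by rewrite indicE; case: (_ \in _); rewrite ?lexx ?ler01.
have cq' k : centered F (fun w => \1_(xi k @^-1` E k) w - q' k w).
  have [m1 b1 e1] := hq' k; apply: (cae _ (q k)) => //.
  - exact: condexp_centered subF (cq k).
  - by apply: mm; case: (cq k).
have q'1 k : k != i -> k != j -> {ae P, forall w, q k w = 1}.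
  move=> ki kj; have [m1 b1 e1] := hq' k; have [h c] := cq' k.
  have L1q : L1 (fun w => q' k w - 1).
    by apply: L1B; [apply: h01 => //; exact: mm|exact: L1_cst].
  have H : {ae P, forall w, 0 <= q' k w - 1}.
    apply: ae_ge0 => //.
      apply: measurable_wrtB => //; apply/(measurable_wrtP subF).
      exact: measurable_cst.
    move=> S FS; have mS : measurable S by case: subF => _; apply.
    have : Ex (fun w => -1 * ((q' k w - 1) * \1_S w)) = 0.
      rewrite -[RHS](c _ FS); congr expect; apply/funext => w.
      rewrite Ek// preimage_setT [\1_setT w]indicE in_setT/=; ring.
    by rewrite ExZ ?mulN1r; [lra|exact: L1_indic].
  apply: filterS2 H e1 => w + ->; have /andP[_ le1] := b1 w.
    by rewrite subr_ge0 => ge1; apply/eqP; rewrite eq_le le1 ge1.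
have [mi bi ei] := hq' i; have [mj bj ej] := hq' j.
exists (q' i), (q' j); split=> //.
- by have := cq' i; rewrite Ei.
- by have := cq' j; rewrite Ej.
- apply: (cae _ (fun w => \prod_k q k w)).
  + by apply: measurable_funM; apply: measurable_indic; rewrite -?Ei -?Ej.
  + move=> w; have /andP[a1 a2] := i01 (xi i @^-1` A) w.
    have /andP[b1 b2] := i01 (xi j @^-1` B) w.
    by rewrite mulr_ge0//= mulr_ile1.
  + have := condexp_centered subF cqq.
    congr (centered F _); apply/funext => w; congr (_ - _).
    rewrite -[RHS]/((\1_(xi i @^-1` A) \* \1_(xi j @^-1` B)) w) -indicI.
    congr (\1_(_) _ : R); apply/seteqP; split=> [v h|v [hi hj] k _ /=].
      by split; [rewrite -Ei|rewrite -Ej]; exact: h.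
    have [<-|jk] := eqVneq j k; first by rewrite Ej.
    have [<-|ik] := eqVneq i k; first by rewrite Ei.
    by rewrite Ek// eq_sym.
  + by apply: mm; case: cqq.
  + exact: measurable_wrtM.
  + move=> w; have /andP[a1 a2] := bi w; have /andP[b1 b2] := bj w.
    by rewrite mulr_ge0//= mulr_ile1.
  + have H : {ae P, forall w, forall k, k != i -> k != j -> q k w = 1}.
      apply: filter_forall => k.
      have [->|ki] := eqVneq k i; first by apply: aeW.
      have [->|kj] := eqVneq k j; first by apply: aeW.
      by apply: filterS (q'1 _ ki kj) => w ->.
    apply: filterS3 ei ej H => w ei ej H.
    rewrite (bigD1 i)//= (bigD1 j)/= 1?eq_sym// ei ej big1 ?mulr1// => k /andP[ki kj].
    exact: H.
Qed.

(** The pi-system of events [B /\ {xi i \in A}], which generates the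
    sigma-algebra of [F] together with [xi i]. *)
Definition rectangles (i : 'I_n) : set_system Omega :=
  [set S | exists B (A : set (T i)),
     [/\ F B, measurable A & S = B `&` xi i @^-1` A]].

Lemma rectanglesI i : setI_closed (rectangles i).
Proof.
move=> _ _ [B [A [FB mA ->]]] [B' [A' [FB' mA' ->]]].
exists (B `&` B'), (A `&` A'); split.
- rewrite -(sub_measE subF); apply: measurableI; by rewrite (sub_measE subF).
- exact: measurableI.
- by rewrite preimage_setI setIACA.
Qed.

Lemma FsetT : F setT.
Proof. by rewrite -(sub_measE subF); exact: measurableT. Qed.

Lemma rectanglesT i : rectangles i setT.
Proof. by exists setT, setT; split; [exact: FsetT| |rewrite preimage_setT setTI]. Qed.

Lemma rectangles_meas i : rectangles i `<=` measurable.
Proof.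
move=> _ [B [A [FB mA ->]]]; apply: measurableI.
  by case: subF => _; apply.
by rewrite -[X in measurable X]setTI; exact: xi_meas.
Qed.

Definition with_sample i : set_system Omega := <<s rectangles i >>.

Lemma with_sample_sub i : sub_sigma_algebra_of (with_sample i).
Proof.
split; first exact: smallest_sigma_algebra.
apply: smallest_sub; [exact: sigma_algebra_measurable|exact: rectangles_meas].
Qed.

Lemma sub_with_sample i : F `<=` with_sample i.
Proof.
move=> B FB; apply: sub_sigma_algebra; exists B, setT.
by split=> //; rewrite preimage_setT setIT.
Qed.

Lemma with_sample_meas i : measurable_wrt (with_sample i) (xi i).
Proof.
move=> A mA; apply: sub_sigma_algebra; exists setT, A.
by split=> //; [exact: FsetT|rewrite setTI].
Qed.

(** Conditional independence of the samples passes to the sigma-algebras they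
    generate together with the past. Two uses of Dynkin's lemma, one for each
    sample, reduce the claim to rectangles, where it is the product rule for
    conditional probabilities. *)
Lemma centered_mul_indep (i j : 'I_n) (U V : Omega -> R) : i != j ->
  measurable_wrt (with_sample i) U -> measurable_wrt (with_sample j) V ->
  centered F V -> L1 (fun w => U w * V w) -> Ex (fun w => U w * V w) = 0.
Proof.
move=> ij mU mV cV hUV; have [hV _] := cV.
apply: (centered_mul (with_sample_sub i)) => //.
apply: centered_pi; [exact: rectanglesI|exact: rectanglesT|exact: rectangles_meas|].
split=> // _ [B [A [FB mA ->]]].
have [q [_ [[mq _] [q01 _] cq _ _]]] := cond_indep_pair ij mA (@measurableT _ (T j)).
have mB : measurable B by case: subF => _; apply.
have mXA : measurable (xi i @^-1` A).
  by rewrite -[X in measurable X]setTI; exact: xi_meas.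
have mq' := measurable_wrt_meas subF mq.
have i1 (S : set Omega) w : `|\1_S w : R| <= 1.
  by rewrite indicE; case: (_ \in _); rewrite ?normr1 ?normr0.
have q1 w : `|q w| <= 1 by have /andP[? ?] := q01 w; rewrite ger0_norm.
(* [Y] is the indicator of the rectangle minus its conditional expectation;
   it is centred even when the other sample is known *)
pose Y w := \1_B w * (\1_(xi i @^-1` A) w - q w).
have cYF : centered F Y.
  by apply: centered_mul_bnd => //; exact: measurable_wrt_indic.
have Y1 w : `|Y w| <= 1.
  rewrite normrM mulr_ile1// indicE; have /andP[a b] := q01 w.
  by rewrite ler_norml; case: (_ \in _) => /=; lra.
have cY : centered (with_sample j) Y.
  apply: centered_pi; [exact: rectanglesI|exact: rectanglesT|exact: rectangles_meas|].
  have [hY _] := cYF; split=> // _ [B' [A' [FB' mA' ->]]].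
  have [r [r' [[mr mr'] [r01 r'01] cr cr' crr]]] := cond_indep_pair ij mA mA'.
  have mB' : measurable B' by case: subF => _; apply.
  have mXA' : measurable (xi j @^-1` A').
    by rewrite -[X in measurable X]setTI; exact: xi_meas.
  have r1 w : `|r' w| <= 1 by have /andP[? ?] := r'01 w; rewrite ger0_norm.
  (* 1_A 1_A' - q 1_A' = (1_A 1_A' - r r') - q (1_A' - r') - r' (q - r) *)
  have c1 : centered F (fun w => q w * (\1_(xi j @^-1` A') w - r' w)).
    exact: centered_mul_bnd.
  have c2 : centered F (fun w => r' w *
      ((\1_(xi i @^-1` A) w - r w) - (\1_(xi i @^-1` A) w - q w))).
    by apply: centered_mul_bnd => //; exact: centeredB.
  have c3 : centered F (fun w => \1_B w *
      ((\1_(xi i @^-1` A) w * \1_(xi j @^-1` A') w - r w * r' w) -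
       q w * (\1_(xi j @^-1` A') w - r' w) -
       r' w * ((\1_(xi i @^-1` A) w - r w) - (\1_(xi i @^-1` A) w - q w)))).
    apply: centered_mul_bnd => //; first exact: measurable_wrt_indic.
    by apply: centeredB => //; exact: centeredB.
  have [_ /(_ _ FB') <-] := c3; congr expect; apply/funext => w.
  rewrite /Y indicI /=; ring.
have hVS : L1 (fun w => V w * \1_(B `&` xi i @^-1` A) w).
  by apply: L1_indic => //; exact: measurableI.
have mY : measurable_fun setT Y.
  apply: measurable_funM; first exact: measurable_indic.
  by apply: measurable_funB => //; exact: measurable_indic.
have hVY : L1 (fun w => V w * Y w).
  apply: (@L1_le _ _ _ P _ (fun w => `|V w|)).
  - by apply: measurable_funM; [exact: L1_meas hV|exact: mY].
  - exact: (integrable_abse hV).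
  - by move=> w; rewrite normrM ler_piMr.
have [hVq EVq] : centered F (fun w => (\1_B w * q w) * V w).
  apply: centered_mul_bnd => //.
    by apply: measurable_wrtM => //; exact: measurable_wrt_indic.
  by move=> w; rewrite normrM mulr_ile1.
have := EVq _ FsetT.
under [X in expect _ X = _]eq_fun do rewrite [\1_[set: _] _]indicE in_setT mulr1.
have := centered_mul (with_sample_sub j) mV cY hVY => E1 E2.
rewrite -[RHS]addr0 -{1}E1 -{1}E2 -ExD//.
congr expect; apply/funext => w; rewrite /Y indicI/=; ring.
Qed.

End Fixed.
End CondIndep.

(** * Frobenius inner product and spectral norm *)

Section Frobenius.
Context {R : realType}.

Definition dotm {m n} (A B : 'M[R]_(m, n)) : R := \sum_i \sum_j A i j * B i j.
Definition nrm2 {m n} (A : 'M[R]_(m, n)) : R := dotm A A.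

Lemma nrm2E m n (A : 'M[R]_(m, n)) : enorm A ^+ 2 = nrm2 A.
Proof.
rewrite sqr_sqrtr; last by do 2 apply: sumr_ge0 => ? _; rewrite sqr_ge0.
by do 2 apply: eq_bigr => ? _; rewrite expr2.
Qed.

Lemma enormE m n (A : 'M[R]_(m, n)) : enorm A = Num.sqrt (nrm2 A).
Proof. by congr Num.sqrt; do 2 apply: eq_bigr => ? _; rewrite expr2. Qed.

Lemma enorm_ge0 m n (A : 'M[R]_(m, n)) : 0 <= enorm A.
Proof. exact: sqrtr_ge0. Qed.

Lemma nrm2_ge0 m n (A : 'M[R]_(m, n)) : 0 <= nrm2 A.
Proof. by rewrite -nrm2E sqr_ge0. Qed.

Lemma nrm2_eq0 m n (A : 'M[R]_(m, n)) : nrm2 A = 0 -> A = 0.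
Proof.
have g i j : 0 <= A i j * A i j by rewrite -expr2 sqr_ge0.
move=> /eqP; rewrite psumr_eq0 => [/allP h|i _]; last exact: sumr_ge0.
apply/matrixP => i j; rewrite mxE.
have := h i (mem_index_enum _); rewrite psumr_eq0// => /allP /(_ j (mem_index_enum _)).
by rewrite mulf_eq0 orbb => /eqP.
Qed.

Lemma dotmC m n (A B : 'M[R]_(m, n)) : dotm A B = dotm B A.
Proof. by do 2 apply: eq_bigr => ? _; rewrite mulrC. Qed.

Lemma dotmDl m n (A B C : 'M[R]_(m, n)) : dotm (A + B) C = dotm A C + dotm B C.
Proof.
rewrite -big_split; apply: eq_bigr => i _; rewrite -big_split.
by apply: eq_bigr => j _; rewrite !mxE mulrDl.
Qed.

Lemma dotmZl m n c (A B : 'M[R]_(m, n)) : dotm (c *: A) B = c * dotm A B.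
Proof.
rewrite mulr_sumr; apply: eq_bigr => i _; rewrite mulr_sumr.
by apply: eq_bigr => j _; rewrite !mxE mulrA.
Qed.

Lemma dotmNl m n (A B : 'M[R]_(m, n)) : dotm (- A) B = - dotm A B.
Proof. by rewrite -scaleN1r dotmZl mulN1r. Qed.

Lemma dotmDr m n (A B C : 'M[R]_(m, n)) : dotm A (B + C) = dotm A B + dotm A C.
Proof. by rewrite dotmC dotmDl !(dotmC A). Qed.

Lemma dotmZr m n c (A B : 'M[R]_(m, n)) : dotm A (c *: B) = c * dotm A B.
Proof. by rewrite dotmC dotmZl dotmC. Qed.

Lemma dotmNr m n (A B : 'M[R]_(m, n)) : dotm A (- B) = - dotm A B.
Proof. by rewrite dotmC dotmNl dotmC. Qed.

Lemma nrm2D m n (A B : 'M[R]_(m, n)) : nrm2 (A + B) = nrm2 A + 2 * dotm A B + nrm2 B.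
Proof. rewrite /nrm2 !dotmDl !dotmDr (dotmC B A); ring. Qed.

Lemma nrm2N m n (A : 'M[R]_(m, n)) : nrm2 (- A) = nrm2 A.
Proof. by rewrite /nrm2 dotmNl dotmNr opprK. Qed.

Lemma nrm2Z m n c (A : 'M[R]_(m, n)) : nrm2 (c *: A) = c ^+ 2 * nrm2 A.
Proof. by rewrite /nrm2 dotmZl dotmZr mulrA expr2. Qed.

Lemma nrm20 m n : nrm2 (0 : 'M[R]_(m, n)) = 0.
Proof. by rewrite -(scale0r 0) nrm2Z expr0n mul0r. Qed.

Lemma nrm2B m n (A B : 'M[R]_(m, n)) : nrm2 (A - B) = nrm2 A - 2 * dotm A B + nrm2 B.
Proof. by rewrite nrm2D dotmNr nrm2N mulrN. Qed.

(** Young's inequality. *)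
Lemma nrm2D_le m n (t : R) (A B : 'M[R]_(m, n)) : 0 < t ->
  nrm2 (A + B) <= (1 + t) * nrm2 A + (1 + t^-1) * nrm2 B.
Proof.
move=> t0; have := nrm2_ge0 (t *: A - B).
rewrite nrm2B nrm2Z dotmZl nrm2D => h.
have : 0 <= t^-1 * (t ^+ 2 * nrm2 A - 2 * (t * dotm A B) + nrm2 B).
  by rewrite mulr_ge0// invr_ge0 ltW.
have -> : t^-1 * (t ^+ 2 * nrm2 A - 2 * (t * dotm A B) + nrm2 B) =
  t * nrm2 A - 2 * dotm A B + t^-1 * nrm2 B by field; rewrite gt_eqF.
lra.
Qed.

Lemma nrm2D_le2 m n (A B : 'M[R]_(m, n)) : nrm2 (A + B) <= 2 * nrm2 A + 2 * nrm2 B.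
Proof. by have := nrm2D_le A B (@ltr01 R); rewrite invr1. Qed.

Lemma nrm2Z_split m n c (A B0 B1 : 'M[R]_(m, n)) : nrm2 (c *: (A - B0)) <=
  2 * (c ^+ 2 * nrm2 (A - B1)) + 2 * (c ^+ 2 * nrm2 (B1 - B0)).
Proof.
have -> : A - B0 = (A - B1) + (B1 - B0) by rewrite addrA subrK.
rewrite nrm2Z; have := ler_wpM2l (sqr_ge0 c) (nrm2D_le2 (A - B1) (B1 - B0)); lra.
Qed.

(** Expansion of a perturbed state, keeping the cross term with the noise [N]. *)
Lemma nrm2_three m n (t : R) (U N B : 'M[R]_(m, n)) : 0 < t ->
  nrm2 (U - N + B) <=
  (1 + t) * nrm2 U + (2 + t^-1) * nrm2 B + 2 * nrm2 N - 2 * dotm U N.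
Proof.
move=> t0; have := nrm2D_le U B t0; have := nrm2D_le2 B (- N).
rewrite -addrA [- N + B]addrC !nrm2D !dotmDr !dotmNr !nrm2N; lra.
Qed.

Lemma nrm2_col m1 m2 n (A : 'M[R]_(m1, n)) (B : 'M[R]_(m2, n)) :
  nrm2 (col_mx A B) = nrm2 A + nrm2 B.
Proof.
rewrite /nrm2 /dotm big_split_ord/=; congr (_ + _).
  by apply: eq_bigr => i _; apply: eq_bigr => j _; rewrite col_mxEu.
by apply: eq_bigr => i _; apply: eq_bigr => j _; rewrite col_mxEd.
Qed.

Lemma dotmE m n (A B : 'M[R]_(m, n)) : dotm A B = \tr (A^T *m B).
Proof.
rewrite /dotm exchange_big/=; apply: eq_bigr => j _; rewrite mxE.
by apply: eq_bigr => i _; rewrite mxE.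
Qed.

Lemma dotm_adj m n p (M : 'M[R]_(m, n)) (A : 'M[R]_(n, p)) (B : 'M[R]_(m, p)) :
  dotm (M *m A) B = dotm A (M^T *m B).
Proof. by rewrite !dotmE trmx_mul mulmxA. Qed.

Lemma nrm2_isometry m n p (M : 'M[R]_(m, n)) (A : 'M[R]_(n, p)) :
  M^T *m M = 1%:M -> nrm2 (M *m A) = nrm2 A.
Proof. by move=> MM; rewrite /nrm2 dotm_adj mulmxA MM mul1mx. Qed.

(** [M *m M^T] is an orthogonal projection. *)
Lemma nrm2_coisometry m n p (M : 'M[R]_(m, n)) (A : 'M[R]_(m, p)) :
  M^T *m M = 1%:M -> nrm2 (M^T *m A) <= nrm2 A.
Proof.
move=> MM; have := nrm2_ge0 (A - M *m (M^T *m A)).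
rewrite nrm2B nrm2_isometry// dotmC dotm_adj /nrm2; lra.
Qed.

Lemma nrm2_trmx m n (A : 'M[R]_(m, n)) : nrm2 A^T = nrm2 A.
Proof.
rewrite /nrm2 /dotm exchange_big/=.
by do 2 apply: eq_bigr => ? _; rewrite !mxE.
Qed.

Lemma nrm2_cols m n (A : 'M[R]_(m, n)) : nrm2 A = \sum_j nrm2 (col j A).
Proof.
rewrite /nrm2 /dotm exchange_big/=; apply: eq_bigr => j _.
by apply: eq_bigr => i _; rewrite big_ord1 !mxE.
Qed.

Lemma nrm2_rows m n (A : 'M[R]_(m, n)) : nrm2 A = \sum_i nrm2 (row i A).
Proof.
rewrite /nrm2 /dotm; apply: eq_bigr => i _; rewrite big_ord1.
by apply: eq_bigr => j _; rewrite !mxE.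
Qed.

Lemma dotm_CS m n (A B : 'M[R]_(m, n)) : dotm A B ^+ 2 <= nrm2 A * nrm2 B.
Proof.
have [/eqP /nrm2_eq0->|B0] := boolP (nrm2 B == 0).
  by rewrite -(scale0r 0) dotmZr nrm2Z mul0r expr0n mul0r mulr0.
have Bp : 0 < nrm2 B by rewrite lt0r B0 nrm2_ge0.
have := nrm2_ge0 (nrm2 B *: A - dotm A B *: B).
rewrite nrm2B !nrm2Z dotmZl dotmZr => h.
rewrite -subr_ge0 -(pmulr_rge0 _ Bp); move: h; congr (0 <= _).
rewrite /nrm2; ring.
Qed.

Lemma nrm2_mulmx m n p (M : 'M[R]_(m, n)) (A : 'M[R]_(n, p)) :
  nrm2 (M *m A) <= nrm2 M * nrm2 A.
Proof.
rewrite (nrm2_cols A) mulr_sumr (nrm2_cols (M *m A)); apply: ler_sum => j _.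
rewrite (nrm2_rows M) mulr_suml [leLHS]/nrm2 /dotm; apply: ler_sum => i _.
rewrite big_ord1 !mxE -expr2.
have -> : \sum_k M i k * A k j = dotm (row i M)^T (col j A).
  by apply: eq_bigr => k _; rewrite big_ord1 !mxE.
by rewrite -(nrm2_trmx (row i M)); exact: dotm_CS.
Qed.

Lemma specnorm_ub m n (M : 'M[R]_(m, n)) (v : 'cV[R]_n) :
  enorm v <= 1 -> enorm (M *m v) <= specnorm M.
Proof.
move=> v1; apply: ub_le_sup; last by exists v.
exists (Num.sqrt (nrm2 M)) => _ [u /= u1 <-].
rewrite enormE ler_wsqrtr// (le_trans (nrm2_mulmx _ _))//.
by rewrite ler_piMr ?nrm2_ge0// -nrm2E expr_le1// enorm_ge0.
Qed.

Lemma specnorm_ge0 m n (M : 'M[R]_(m, n)) : 0 <= specnorm M.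
Proof.
apply: le_trans (enorm_ge0 (M *m (0 : 'cV_n))) _; apply: specnorm_ub.
by rewrite enormE nrm20 sqrtr0 ler01.
Qed.

(** The spectral norm is defined on columns; a matrix is treated column by
    column. *)
Lemma nrm2_spec m n p (M : 'M[R]_(m, n)) (A : 'M[R]_(n, p)) :
  nrm2 (M *m A) <= specnorm M ^+ 2 * nrm2 A.
Proof.
rewrite (nrm2_cols A) mulr_sumr (nrm2_cols (M *m A)); apply: ler_sum => j _.
have -> : col j (M *m A) = M *m col j A.
  by apply/matrixP => i k; rewrite !mxE; apply: eq_bigr => l _; rewrite !mxE.
move: (col j A) => v.
have [/eqP /nrm2_eq0->|v0] := boolP (nrm2 v == 0).
  by rewrite mulmx0 !nrm20 mulr0.
have vp : 0 < enorm v by rewrite enormE sqrtr_gt0 lt0r v0 nrm2_ge0.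
have := @specnorm_ub _ _ M ((enorm v)^-1 *: v).
rewrite [enorm (_ *: v)]enormE nrm2Z exprVn nrm2E mulVf// sqrtr1 lexx => /(_ isT).
rewrite -scalemxAr enormE nrm2Z exprVn nrm2E => h.
have : (nrm2 v)^-1 * nrm2 (M *m v) <= specnorm M ^+ 2.
  rewrite -[leLHS]sqr_sqrtr; last by rewrite mulr_ge0 ?invr_ge0 ?nrm2_ge0.
  by rewrite ler_pXn2r// nnegrE ?sqrtr_ge0 ?specnorm_ge0.
by rewrite mulrC ler_pdivrMr// lt0r v0 nrm2_ge0.
Qed.

Lemma nrm2_diag2 m p (d e : 'rV[R]_m) (A : 'M[R]_(m, p)) c :
  (forall j, d 0 j ^+ 2 + e 0 j ^+ 2 <= c) ->
  nrm2 (diag_mx d *m A) + nrm2 (diag_mx e *m A) <= c * nrm2 A.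
Proof.
move=> h; rewrite /nrm2 /dotm mulr_sumr -big_split; apply: ler_sum => i _ /=.
rewrite mulr_sumr -big_split; apply: ler_sum => j _ /=.
rewrite !mul_diag_mx !mxE.
have -> : d 0 i * A i j * (d 0 i * A i j) + e 0 i * A i j * (e 0 i * A i j) =
  (d 0 i ^+ 2 + e 0 i ^+ 2) * (A i j * A i j) by ring.
by rewrite ler_wpM2r// -expr2 sqr_ge0.
Qed.

Lemma nrm2_diag m p (d : 'rV[R]_m) (A : 'M[R]_(m, p)) c :
  (forall j, d 0 j ^+ 2 <= c) -> nrm2 (diag_mx d *m A) <= c * nrm2 A.
Proof.
move=> h; have := @nrm2_diag2 _ _ d 0 A c.
rewrite -[diag_mx 0]/(diag_mx 0) linear0 mul0mx nrm20 addr0; apply => j.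
by rewrite mxE expr0n addr0.
Qed.

(** Induction with Young's inequality, the parameter being the number of
    remaining terms. *)
Lemma nrm2_sum I (s : seq I) m n (A : I -> 'M[R]_(m, n)) :
  nrm2 (\sum_(i <- s) A i) <= (size s)%:R * \sum_(i <- s) nrm2 (A i).
Proof.
elim: s => [|i s IH]; first by rewrite !big_nil nrm20 mulr0.
rewrite !big_cons /=.
case: s IH => [|k s] IH; first by rewrite !big_nil !addr0 mul1r.
set N : R := (size (k :: s))%:R in IH *.
have N0 : 0 < N by rewrite ltr0n.
apply: le_trans (nrm2D_le _ _ N0) _.
rewrite -natr1 -/N mulrDr lerD//; first by rewrite addrC.
apply: le_trans (ler_wpM2l _ IH) _; first by rewrite addr_ge0// invr_ge0 ltW.
by rewrite mulrA le_eqVlt; apply/orP; left; apply/eqP; congr (_ * _); field; rewrite gt_eqF.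
Qed.

End Frobenius.

(** * One step in the eigenbasis of the network *)

Lemma mean_rowE {R : realType} n p (A : 'M[R]_(n, p)) :
  mean_row A = (n%:R^-1 *: const_mx 1 : 'rV[R]_n) *m A.
Proof.
apply/matrixP => i j; rewrite !mxE summxE mulr_sumr.
by apply: eq_bigr => k _; rewrite !mxE mulr1.
Qed.

Lemma row_consensus {R : realType} n p (v : 'rV[R]_p) (i : 'I_n) :
  row i (consensus v) = v.
Proof.
by apply/matrixP => a j; rewrite !mxE big_ord1 !mxE mul1r [a]ord1.
Qed.

Lemma nrm2_consensus {R : realType} n p (v : 'rV[R]_p) :
  nrm2 (consensus v : 'M[R]_(n, p)) = n%:R * nrm2 v.
Proof.
rewrite nrm2_rows (eq_bigr (fun=> nrm2 v)) ?sumr_const ?card_ord ?mulr_natl// => i _.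
by rewrite row_consensus.
Qed.

Lemma consensusE {R : realType} n p (x : 'M[R]_(n, p)) :
  consensus (mean_row x) = (n%:R^-1 *: const_mx 1 : 'M[R]_n) *m x.
Proof.
apply/matrixP => i j; rewrite !mxE big_ord1 !mxE mul1r summxE mulr_sumr.
by apply: eq_bigr => k _; rewrite !mxE mulr1.
Qed.

Section Network.
Context {R : realType} {n : nat} (hn : (2 <= n)%N).
Variables (e : rel 'I_n) (W : 'M[R]_n) (W_network : network e W).
Variables (lam : n.-tuple R) (W_spectrum : spectrum W lam).
Variables (Q1 : 'M[R]_(n, n.-1)) (W_eigenbasis : eigenbasis W lam Q1).
Variables (gamma : R) (gamma_gt0 : 0 < gamma) (gamma_le2 : gamma <= 1 / 2).
Hypothesis lam2_lt1 : lam`_1 < 1.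

Let QQ : Q1^T *m Q1 = 1%:M. Proof. by case: W_eigenbasis. Qed.

(** The normalised all-ones vector and the columns of [Q1] form an orthonormal
    basis: a square matrix with orthonormal columns has orthonormal rows. *)
Lemma proj_consensus : 1%:M - n%:R^-1 *: const_mx 1 = Q1 *m Q1^T.
Proof.
have [_ _ Q11] := W_eigenbasis.
case: n Q1 QQ Q11 hn => [//|n'] /= Q QQ' Q11 _.
pose c : R := Num.sqrt n'.+1%:R^-1.
have c2 : c * c = n'.+1%:R^-1 by rewrite -expr2 sqr_sqrtr// invr_ge0 ler0n.
pose u : 'cV[R]_n'.+1 := c *: const_mx 1.
pose M : 'M[R]_(n'.+1, 1 + n') := row_mx u Q.
have Qu : Q^T *m u = 0 by rewrite /u -scalemxAr Q11 scaler0.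
have uu : u^T *m u = 1%:M.
  apply/matrixP => i j; rewrite !ord1 !mxE.
  rewrite (eq_bigr (fun=> n'.+1%:R^-1)) => [|k _]; last by rewrite !mxE mulr1 c2.
  by rewrite sumr_const card_ord -[LHS]mulr_natl mulfV ?eqxx// pnatr_eq0.
have MM : M^T *m M = 1%:M.
  rewrite /M tr_row_mx mul_col_row QQ' uu Qu.
  by rewrite -[u^T *m Q]trmxK trmx_mul trmxK Qu trmx0 -scalar_mx_block.
have /mulmx1C := MM; rewrite /M tr_row_mx mul_row_col => <-.
rewrite [_ + Q *m _]addrC -addrA -[RHS]addr0; congr (_ + _); apply/eqP.
rewrite subr_eq0; apply/eqP/matrixP => i j.
by rewrite !mxE big_ord1 !mxE !mulr1.
Qed.

Lemma nrm2_consensus_error p (x : 'M[R]_(n, p)) :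
  nrm2 (x - consensus (mean_row x)) = nrm2 (Q1^T *m x).
Proof.
rewrite consensusE -{1}(mul1mx x) -mulmxBl proj_consensus -mulmxA.
exact: nrm2_isometry.
Qed.

Definition lamt (j : 'I_n.-1) : R := lam_tilde gamma lam`_j.+1.
Definition spectral_gap : R := 1 - lam_tilde gamma lam`_1.
Notation rho := spectral_gap.

Lemma gapE : rho = gamma / 2 * (1 - lam`_1).
Proof. rewrite /spectral_gap /lam_tilde; ring. Qed.

Lemma gap_gt0 : 0 < rho.
Proof. by rewrite gapE mulr_gt0 ?divr_gt0// subr_gt0. Qed.

(** Evaluate the quadratic form of [W] at the eigenvector in column [j]. *)
Lemma lam_ge0 (j : 'I_n.-1) : 0 <= lam`_j.+1.
Proof.
have [_ WE Q11] := W_eigenbasis.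
have := mix_psd W_network (Q1 *m delta_mx j 0); rewrite trmx_mul.
have -> : (delta_mx j 0 : 'cV_n.-1)^T *m Q1^T *m W *m (Q1 *m delta_mx j 0) =
  (delta_mx j 0 : 'cV_n.-1)^T *m Lam1 lam *m (delta_mx j 0 : 'cV_n.-1).
  rewrite -!mulmxA; congr (_ *m _); rewrite !mulmxA; congr (_ *m _).
  have Q1J : Q1^T *m (const_mx 1 : 'M[R]_n) = 0.
    have -> : (const_mx 1 : 'M[R]_n) = (const_mx 1 : 'cV[R]_n) *m (const_mx 1 : 'rV[R]_n).
      by apply/matrixP => a b; rewrite !mxE big_ord1 !mxE mulr1.
    by rewrite mulmxA Q11 mul0mx.
  rewrite {1}WE mulmxDr -scalemxAr Q1J scaler0 add0r.
  by rewrite !mulmxA QQ mul1mx -mulmxA QQ mulmx1.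
rewrite trmx_delta -rowE mxE (bigD1 j)//= !mxE !eqxx mulr1 mulr1n big1 ?addr0//.
by move=> k /negPf kj; rewrite !mxE eq_sym kj mulr0.
Qed.

Lemma lam_le (j : 'I_n.-1) : lam`_j.+1 <= lam`_1.
Proof.
have [_ sl] := W_spectrum.
have tr : transitive (>=%R : rel R) by move=> a b c ab bc; exact: le_trans bc ab.
apply: (sorted_leq_nth tr _ 0 sl) => //; rewrite ?inE ?size_tuple//.
- exact: lexx.
- by rewrite -ltn_predRL.
Qed.

Lemma lamt_le (j : 'I_n.-1) : lamt j <= 1 - rho.
Proof.
rewrite gapE /lamt /lam_tilde lerD2l lerN2 ler_wpM2l//; first by rewrite divr_ge0// ltW.
by rewrite lerD2l lerN2 lam_le.
Qed.

Lemma lamt_ge (j : 'I_n.-1) : 1 - gamma / 2 <= lamt j.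
Proof.
by rewrite /lamt /lam_tilde; have := lam_ge0 j; move: gamma_gt0; nra.
Qed.

Lemma lamt_bounds j : 3 / 4 <= lamt j /\ lamt j < 1.
Proof.
have h1 := lamt_le j; have h2 := lamt_ge j; have h3 := gap_gt0.
by split; [move: gamma_le2|]; lra.
Qed.

Lemma gap_le : rho <= gamma / 2.
Proof.
have j : 'I_n.-1 by case: (n) hn => [|[|k]] //= _; exact: ord0.
by have := lamt_le j; have := lamt_ge j; lra.
Qed.

Notation Lt := (Lam1_tilde gamma lam).
Notation S := (sqrt_ILam1 gamma lam).

Lemma S_gt0 j : 0 < Num.sqrt (1 - lamt j).
Proof. by rewrite sqrtr_gt0 subr_gt0; case: (lamt_bounds j). Qed.

Lemma S_sqr j : Num.sqrt (1 - lamt j) ^+ 2 = 1 - lamt j.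
Proof. by rewrite sqr_sqrtr// subr_ge0 ltW//; case: (lamt_bounds j). Qed.

Lemma SS : S *m S = 1%:M - Lt.
Proof.
rewrite mulmx_diag; apply/matrixP => i j; rewrite !mxE -expr2 (S_sqr i).
by case: (i == j); rewrite ?mulr1n// !mulr0n subrr.
Qed.

Definition Sinv : 'M[R]_n.-1 := diag_mx (\row_j (Num.sqrt (1 - lamt j))^-1).

Lemma SSi : S *m Sinv = 1%:M.
Proof.
rewrite mulmx_diag; apply/matrixP => i j; rewrite !mxE.
by have [_|_] := eqVneq i j; rewrite ?mulr0n // !mulr1n divff// gt_eqF// (S_gt0 i).
Qed.

Lemma invS : invmx S = Sinv.
Proof.
have [Su _] := mulmx1_unit SSi.
by rewrite -[LHS]mulmx1 -SSi mulKmx.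
Qed.

Lemma nrm2_S p (A : 'M[R]_(n.-1, p)) : nrm2 (S *m A) <= gamma / 2 * nrm2 A.
Proof.
by apply: nrm2_diag => j; rewrite mxE (S_sqr j); have := lamt_ge j; lra.
Qed.

Lemma nrm2_Si p (A : 'M[R]_(n.-1, p)) : nrm2 (Sinv *m A) <= rho^-1 * nrm2 A.
Proof.
apply: nrm2_diag => j; rewrite mxE exprVn (S_sqr j).
have := lamt_le j; have := gap_gt0 => r0 h.
by rewrite lef_pV2 ?posrE//; lra.
Qed.

Lemma nrm2_LtS p (A : 'M[R]_(n.-1, p)) : nrm2 (col_mx (Lt *m A) (S *m A)) <= nrm2 A.
Proof.
rewrite nrm2_col -[leRHS]mul1r; apply: nrm2_diag2 => j; rewrite !mxE (S_sqr j).
by rewrite -/(lamt j); have [] := lamt_bounds j; nra.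
Qed.

(** The compression error enters through [S], whose square is of order [gamma]:
    this factor is what makes the compression harmless for small [gamma]. *)
Lemma nrm2_SSS p (A : 'M[R]_(n.-1, p)) :
  nrm2 (col_mx (- (S *m (S *m A))) (S *m A)) <= gamma * nrm2 A.
Proof.
rewrite nrm2_col nrm2N; have := nrm2_S (S *m A); have := nrm2_S A.
move=> h1 h2; have := ler_wpM2l (ltW gamma_gt0) h1.
have := nrm2_ge0 A; have := nrm2_ge0 (S *m A); move: gamma_gt0 gamma_le2; nra.
Qed.

Variables (J P1 : 'M[R]_(n.-1 + n.-1)) (B_decomp : decomposition gamma lam J P1).

Lemma nrm2_J p (A : 'M[R]_(n.-1 + n.-1, p)) : nrm2 (J *m A) <= 2 * nrm2 A.
Proof.
apply: le_trans (nrm2_spec _ _) _; rewrite ler_wpM2r ?nrm2_ge0//.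
rewrite -[leRHS]sqr_sqrtr// ler_pXn2r// ?nnegrE ?sqrtr_ge0 ?specnorm_ge0//.
exact: J_norm B_decomp.
Qed.

Lemma nrm2_Ji p (A : 'M[R]_(n.-1 + n.-1, p)) : nrm2 (invmx J *m A) <= nrm2 A.
Proof.
apply: le_trans (nrm2_spec _ _) _; rewrite ler_piMl ?nrm2_ge0//.
rewrite expr_le1 ?specnorm_ge0//; apply: le_trans (Jinv_norm B_decomp) _.
have hj : (n.-2 < n.-1)%N by case: (n) hn => [|[|k]].
have := lamt_bounds (Ordinal hj); rewrite /lamt /= => -[h _].
have -> : n.-1 = n.-2.+1 by case: (n) hn => [|[|k]].
rewrite invf_le1; last by rewrite sqrtr_gt0; lra.
by rewrite -{1}sqrtr1 ler_wsqrtr//; lra.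
Qed.

Lemma nrm2_P1 p (A : 'M[R]_(n.-1 + n.-1, p)) : nrm2 (P1 *m A) <= (1 - rho) * nrm2 A.
Proof.
apply: le_trans (nrm2_spec _ _) _; rewrite ler_wpM2r ?nrm2_ge0//.
by rewrite (le_trans (P1_norm B_decomp))// /spectral_gap opprB addrCA subrr addr0.
Qed.

(** The diffusion step acts on the disagreement only, with weights [S *m S]. *)
Lemma mixE : (gamma / 2) *: (1%:M - W) = Q1 *m (S *m (S *m Q1^T)).
Proof.
have [_ WE _] := W_eigenbasis.
rewrite {1}WE opprD addrA proj_consensus -[X in _ - X]mulmxA -mulmxBr.
rewrite -{1}[Q1^T]mul1mx -mulmxBl scalemxAr scalemxAl; congr (_ *m _).
rewrite mulmxA SS; congr (_ *m _); apply/matrixP => i j; rewrite !mxE.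
case: (i == j); rewrite ?mulr1n ?mulr0n /lam_tilde ?subrr ?mulr0//; ring.
Qed.

Lemma check_hE p (x r : 'M[R]_(n, p)) : check_h gamma lam Q1 J x r =
  invmx J *m col_mx (Q1^T *m x) (Sinv *m (Q1^T *m r)).
Proof. by rewrite /check_h invS -mul_row_col hsubmxK. Qed.

(** [J] undoes the change of coordinates, at the cost of its squared norm 2. *)
Lemma check_h_bounds p (x r : 'M[R]_(n, p)) :
  nrm2 (Q1^T *m x) + nrm2 (Sinv *m (Q1^T *m r)) <= 2 * nrm2 (check_h gamma lam Q1 J x r).
Proof.
rewrite -nrm2_col; apply: le_trans (nrm2_J _).
by rewrite check_hE mulKVmx//; case: B_decomp.
Qed.

(** Weights of the gradient noise and of the compression error in one step. *)
Definition noise_mx (eta : R) : 'M[R]_(n.-1 + n.-1, n) :=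
  eta *: (invmx J *m (col_mx Lt S *m Q1^T)).
Definition comp_mx : 'M[R]_(n.-1 + n.-1, n) :=
  invmx J *m (col_mx (- (S *m S)) S *m Q1^T).

Lemma noise_mx_le q eta (A : 'M[R]_(n, q)) :
  nrm2 (noise_mx eta *m A) <= eta ^+ 2 * nrm2 A.
Proof.
rewrite /noise_mx -scalemxAl nrm2Z ler_wpM2l ?sqr_ge0// -!mulmxA mul_col_mx.
apply: le_trans (nrm2_Ji _) _; apply: le_trans (nrm2_LtS _) _.
exact: nrm2_coisometry.
Qed.

Lemma comp_mx_le q (A : 'M[R]_(n, q)) : nrm2 (comp_mx *m A) <= gamma * nrm2 A.
Proof.
rewrite /comp_mx -!mulmxA mul_col_mx mulNmx -!mulmxA.
apply: le_trans (nrm2_Ji _) _; apply: le_trans (nrm2_SSS _) _.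
by rewrite ler_wpM2l ?(ltW gamma_gt0)// nrm2_coisometry.
Qed.

Section Step.
Variables (p : nat) (eta : R) (x y D er G : 'M[R]_(n, p)).
Variables (x' D' gx gx' : 'M[R]_(n, p)).
Hypothesis yE : y = x - eta *: G - D.
Hypothesis D'E : D' = D + (gamma / 2) *: ((1%:M - W) *m (y + er)).
Hypothesis x'E : x' = x - eta *: G - D'.
Let h := check_h gamma lam Q1 J x (D + eta *: gx).
Let h' := check_h gamma lam Q1 J x' (D' + eta *: gx').
Let X := Q1^T *m x.
Let Rk := Sinv *m (Q1^T *m (D + eta *: gx)).
Let de := Q1^T *m (eta *: (G - gx)).
Let e1 := Q1^T *m er.

Lemma SRk : S *m Rk = Q1^T *m (D + eta *: gx).
Proof. by rewrite /Rk mulmxA SSi mul1mx. Qed.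

Lemma Q1y : Q1^T *m y = X - S *m Rk - de.
Proof.
rewrite SRk yE /de scalerBr /X !mulmxBr mulmxDr.
move: (Q1^T *m x) (Q1^T *m D) (Q1^T *m (eta *: G)) (Q1^T *m (eta *: gx)) => a b c d.
by apply/matrixP => i j; rewrite !mxE; ring.
Qed.

(** In the coordinates given by [J] the linear part of a step is [P1]; the gradient
    errors [de], the compression error [e1] and the change of the gradient at the
    average enter as perturbations. *)
Lemma check_h_step : h' = P1 *m h
  - invmx J *m col_mx (Lt *m de) (S *m de)
  + invmx J *m col_mx (- (S *m (S *m e1))) (S *m e1)
  + invmx J *m col_mx 0 (Sinv *m (Q1^T *m (eta *: (gx' - gx)))).
Proof.
have Ju : J \in unitmx by case: B_decomp.
have P1E : P1 *m invmx J = invmx J *m Bmx gamma lam.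
  by rewrite (B_JPJ B_decomp) !mulmxA mulVmx// mul1mx.
rewrite /h /h' !check_hE (mulmxA P1) P1E -(mulmxA (invmx J)) -mulmxBr -!mulmxDr; congr (_ *m _).
rewrite -/X -/Rk /Bmx mul_block_col opp_col_mx !add_col_mx.
have Lt_ (q : nat) (A : 'M[R]_(n.-1, q)) : Lt *m A = A - S *m (S *m A).
  by rewrite mulmxA SS mulmxBl mul1mx opprB addrCA subrr addr0.
have VE (A : 'M[R]_(n, p)) : Q1^T *m ((gamma / 2) *: ((1%:M - W) *m A)) =
    S *m (S *m (Q1^T *m A)).
  by rewrite scalemxAl mixE !mulmxA QQ mul1mx.
have SiS A : Sinv *m (S *m A) = A :> 'M[R]_(n.-1, p).
  by rewrite mulmxA (mulmx1C SSi) mul1mx.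
congr col_mx.
- rewrite x'E D'E opprD addrA -yE mulmxBr VE mulmxDr -/e1 Q1y mulNmx -mulmxA !Lt_ !mulmxDr !mulmxN.
  move: (S *m (S *m (S *m (S *m Rk)))) (S *m (S *m (S *m Rk))) => a4 a3.
  move: (S *m (S *m X)) (S *m (S *m de)) (S *m (S *m e1)) (S *m Rk) => b1 b2 b3 b4.
  by apply/matrixP => i j; rewrite !mxE; ring.
- have -> : Sinv *m (Q1^T *m (D' + eta *: gx')) = Rk + Sinv *m (Q1^T *m (D' - D)) +
      Sinv *m (Q1^T *m (eta *: (gx' - gx))).
    rewrite /Rk -!mulmxDr; congr (_ *m (_ *m _)).
    by apply/matrixP => i j; rewrite !mxE; ring.
  have -> : Sinv *m (Q1^T *m (D' - D)) = S *m (Q1^T *m y + e1).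
    by rewrite D'E addrAC subrr add0r VE SiS /e1 -mulmxDr.
  rewrite Q1y Lt_ !mulmxDr !mulmxN.
  set z := Sinv *m _; move: z => z.
  move: (S *m X) (S *m (S *m Rk)) (S *m de) (S *m e1) Rk => a b c d f.
  by apply/matrixP => i j; rewrite !mxE; ring.
Qed.

Variable gF : 'M[R]_(n, p).

(** The part of the next state determined by the past, and the part due to the
    displacement of the average. *)
Definition past_part : 'M[R]_(n.-1 + n.-1, p) :=
  P1 *m h - invmx J *m (col_mx Lt S *m (Q1^T *m (eta *: (gF - gx)))).
Definition drift_part : 'M[R]_(n.-1 + n.-1, p) :=
  invmx J *m col_mx 0 (Sinv *m (Q1^T *m (eta *: (gx' - gx)))).

Lemma check_h_split :
  h' = (past_part - noise_mx eta *m (G - gF) + drift_part) + comp_mx *m er.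
Proof.
rewrite check_h_step /past_part /drift_part; move: (P1 *m h) => u.
have -> : invmx J *m col_mx (Lt *m de) (S *m de) =
    invmx J *m (col_mx Lt S *m (Q1^T *m (eta *: (gF - gx)))) + noise_mx eta *m (G - gF).
  rewrite /noise_mx -scalemxAl -!mulmxA scalemxAr -mulmxDr -mul_col_mx; congr (_ *m _).
  rewrite scalemxAr -mulmxDr; congr (_ *m _); rewrite scalemxAr -mulmxDr; congr (_ *m _).
  by apply/matrixP => i j; rewrite !mxE; ring.
have -> : invmx J *m col_mx (- (S *m (S *m e1))) (S *m e1) = comp_mx *m er.
  by rewrite /comp_mx -!mulmxA mul_col_mx mulNmx -!mulmxA.
move: (invmx J *m (col_mx Lt S *m _)) (noise_mx eta *m _) (comp_mx *m _) => a b c.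
move: (invmx J *m _) => d.
by apply/matrixP => i j; rewrite !mxE; ring.
Qed.

(** The contraction [1 - rho] of [P1] survives the gradient error: this error is
    Lipschitz in the disagreement, and [eta * L] is small compared with [rho]. *)
Lemma past_part_le (L : R) : 0 < eta -> 0 < L -> eta * L <= rho / 16 ->
  nrm2 (gF - gx) <= L ^+ 2 * nrm2 X ->
  nrm2 past_part <= (1 - 7 / 10 * rho) * nrm2 h.
Proof.
move=> eta0 L0 eL hL.
have r0 : 0 < rho := gap_gt0.
have r1 : rho <= 1 by have := gap_le; move: gamma_le2; lra.
have h0 := nrm2_ge0 h.
have Xh : nrm2 X <= 2 * nrm2 h.
  by have := check_h_bounds x (D + eta *: gx); have := nrm2_ge0 Rk; rewrite -/Rk; lra.
have eL2 : (eta * L) ^+ 2 <= rho * rho / 256.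
  have : (eta * L) ^+ 2 <= (rho / 16) ^+ 2.
    by rewrite ler_pXn2r// nnegrE; [rewrite mulr_ge0// ltW|rewrite divr_ge0// ltW].
  by move=> /le_trans; apply; rewrite le_eqVlt; apply/orP; left; apply/eqP; field.
rewrite /past_part; set a := invmx J *m _.
have ha : nrm2 a <= rho * rho / 128 * nrm2 h.
  rewrite /a mul_col_mx; apply: le_trans (nrm2_Ji _) _; apply: le_trans (nrm2_LtS _) _.
  apply: le_trans (nrm2_coisometry _ QQ) _; rewrite nrm2Z.
  apply: le_trans (ler_wpM2l (sqr_ge0 _) hL) _; rewrite mulrA -exprMn.
  apply: le_trans (ler_wpM2r (nrm2_ge0 _) eL2) _.
  have : 0 <= rho * rho / 256 := divr_ge0 (mulr_ge0 (ltW r0) (ltW r0)) (ler0n _ _).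
  by move=> /ler_wpM2l /(_ _ _ Xh); lra.
(* the parameter [rho / 4] spends a quarter of the contraction *)
have t0 : 0 < rho / 4 by rewrite divr_gt0.
apply: le_trans (nrm2D_le _ _ t0) _; rewrite nrm2N.
have c1 : 0 <= 1 + rho / 4 by lra.
have c2 : 0 <= 1 + (rho / 4)^-1 by rewrite addr_ge0// invr_ge0 ltW.
apply: le_trans (lerD (ler_wpM2l c1 (nrm2_P1 h)) (ler_wpM2l c2 ha)) _.
rewrite [X in X + _]mulrA [X in _ + X]mulrA -mulrDl ler_wpM2r//.
have -> : (1 + (rho / 4)^-1) * (rho * rho / 128) = rho * rho / 128 + rho / 32.
  by field; rewrite gt_eqF.
by nra.
Qed.

(** Here [Sinv] costs a factor [rho^-1]. *)
Lemma drift_part_le :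
  nrm2 drift_part <= rho^-1 * (eta ^+ 2 * nrm2 (gx' - gx)).
Proof.
rewrite /drift_part; apply: le_trans (nrm2_Ji _) _; rewrite nrm2_col nrm20 add0r.
apply: le_trans (nrm2_Si _) _; rewrite ler_wpM2l ?invr_ge0 ?(ltW gap_gt0)//.
by apply: le_trans (nrm2_coisometry _ QQ) _; rewrite nrm2Z.
Qed.

Lemma Q1y_le : nrm2 (Q1^T *m y) <= 3 * (2 * nrm2 h + nrm2 (eta *: (G - gx))).
Proof.
rewrite Q1y; have := nrm2_sum [:: X; - (S *m Rk); - de] id.
rewrite /= !big_cons !big_nil !addr0 !addrA !nrm2N => /le_trans; apply.
rewrite ler_wpM2l// lerD//; last exact: nrm2_coisometry.
apply: le_trans _ (check_h_bounds x (D + eta *: gx)); rewrite -/X -/Rk lerD2l.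
have := nrm2_S Rk; have := nrm2_ge0 Rk; move: gamma_le2; nra.
Qed.

Variables (G' y' : 'M[R]_(n, p)).
Hypothesis y'E : y' = x' - eta *: G' - D'.
Hypothesis D0 : Q1 *m (Q1^T *m D) = D.

(** Expanding [y' - y] cancels [x]: what remains are disagreements, errors and the
    gradient at the average, all of which are small or bounded. *)
Lemma y_step : y' - y =
  - (2 *: (Q1 *m (S *m (S *m (Q1^T *m y)))))
  - 2 *: (Q1 *m (S *m (S *m e1)))
  - Q1 *m (S *m Rk)
  - eta *: (G' - gx')
  - eta *: (gx' - gx)
  - eta *: consensus (mean_row gx).
Proof.
have VE (A : 'M[R]_(n, p)) : (gamma / 2) *: ((1%:M - W) *m A) =
    Q1 *m (S *m (S *m (Q1^T *m A))).
  by rewrite scalemxAl mixE !mulmxA.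
have -> : consensus (mean_row gx) = gx - Q1 *m (Q1^T *m gx).
  rewrite consensusE -{2}(mul1mx gx) mulmxA -mulmxBl -proj_consensus.
  by rewrite opprB addrCA subrr addr0.
have -> : y' = y - (D' - D) - eta *: G' - D'.
  rewrite y'E x'E yE; apply/matrixP => i j; rewrite !mxE; ring.
rewrite SRk D'E VE mulmxDr -/e1 !mulmxDr D0 -!scalemxAr.
move: (Q1 *m (S *m (S *m (Q1^T *m y)))) (Q1 *m (S *m (S *m e1))) => a b.
move: (Q1 *m (Q1^T *m gx)) => c.
by apply/matrixP => i j; rewrite !mxE; ring.
Qed.

Lemma y_step_le : nrm2 (y' - y) <= 6 * (
  gamma ^+ 2 * nrm2 (Q1^T *m y) + gamma ^+ 2 * nrm2 er + gamma * nrm2 h +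
  nrm2 (eta *: (G' - gx')) + eta ^+ 2 * nrm2 (gx' - gx) +
  eta ^+ 2 * (n%:R * nrm2 (mean_row gx))).
Proof.
have SS_le q (A : 'M[R]_(n.-1, q)) :
    nrm2 (2 *: (Q1 *m (S *m (S *m A)))) <= gamma ^+ 2 * nrm2 A.
  rewrite nrm2Z nrm2_isometry//.
  have := nrm2_S (S *m A); have := nrm2_S A => h1 h2.
  have g2 : 0 <= gamma / 2 by rewrite divr_ge0// ltW.
  have := ler_wpM2l g2 h1.
  have -> : (2 : R) ^+ 2 * nrm2 (S *m (S *m A)) = 4 * nrm2 (S *m (S *m A)) by ring.
  have -> : gamma / 2 * (gamma / 2 * nrm2 A) = gamma ^+ 2 * nrm2 A / 4 by field.
  by lra.
rewrite y_step.
have := nrm2_sum [:: - (2 *: (Q1 *m (S *m (S *m (Q1^T *m y)))));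
  - (2 *: (Q1 *m (S *m (S *m e1)))); - (Q1 *m (S *m Rk)); - (eta *: (G' - gx'));
  - (eta *: (gx' - gx)); - (eta *: consensus (mean_row gx))] id.
rewrite /= !big_cons !big_nil !addr0 !addrA !nrm2N => /le_trans; apply.
rewrite ler_wpM2l// !lerD//.
- apply: le_trans (SS_le _ _) _; rewrite ler_wpM2l ?sqr_ge0//.
  exact: nrm2_coisometry.
- rewrite nrm2_isometry//; apply: le_trans (nrm2_S _) _.
  have := check_h_bounds x (D + eta *: gx); rewrite -/Rk.
  have := nrm2_ge0 Rk; have := nrm2_ge0 (Q1^T *m x); move: gamma_gt0; nra.
- by rewrite nrm2Z.
- by rewrite nrm2Z nrm2_consensus.
Qed.

(** [D] stays in the range of [Q1], that is, its column sums stay zero; this is why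
    the averages follow a plain stochastic gradient step. *)
Lemma D_step : Q1 *m (Q1^T *m D') = D'.
Proof.
rewrite D'E mulmxDr mulmxDr D0; congr (_ + _).
by rewrite scalemxAl mixE !mulmxA -(mulmxA Q1) QQ mulmx1.
Qed.

Lemma mean_step : mean_row x' = mean_row x - eta *: mean_row G.
Proof.
rewrite !mean_rowE x'E !mulmxBr scalemxAr -[RHS]subr0; congr (_ - _).
rewrite -D_step; have [_ _ Q11] := W_eigenbasis.
have -> : (n%:R^-1 *: const_mx 1 : 'rV[R]_n) *m (Q1 *m (Q1^T *m D')) =
  n%:R^-1 *: (((Q1^T *m const_mx 1)^T : 'rV_n.-1) *m (Q1^T *m D')).
  by rewrite trmx_mul trmxK trmx_const -scalemxAl !mulmxA.
by rewrite Q11 trmx0 mul0mx scaler0.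
Qed.

End Step.
End Network.

(** * Descent for smooth functions *)

Section Gradient.
Context {R : realType}.

Lemma diff_grad p (f : 'rV[R]_p -> R) (x v : 'rV[R]_p) :
  differentiable f x -> 'd f x v = dotm (grad f x) v.
Proof.
move=> df; rewrite {1}(row_sum_delta v) linear_sum/= /dotm big_ord1.
apply: eq_bigr => j _.
by rewrite linearZ /= /grad mxE deriveE// mulrC.
Qed.

Lemma smooth_nrm2 p (L : R) (f : 'rV[R]_p -> R) : 0 <= L -> smooth L f -> forall x y,
  nrm2 (grad f x - grad f y) <= L ^+ 2 * nrm2 (x - y).
Proof.
move=> L0 sf x y; rewrite -!nrm2E -exprMn ler_pXn2r// ?nnegrE ?enorm_ge0//.
by rewrite mulr_ge0 ?enorm_ge0.
Qed.

Lemma nrm2_smooth p (L : R) (f : 'rV[R]_p -> R) : 0 <= L -> (forall x y,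
  nrm2 (grad f x - grad f y) <= L ^+ 2 * nrm2 (x - y)) -> smooth L f.
Proof.
move=> L0 h x y.
rewrite -(@ler_pXn2r _ 2)// ?nnegrE ?mulr_ge0 ?enorm_ge0//.
by rewrite exprMn !nrm2E.
Qed.

Lemma dotm_le m n (A B : 'M[R]_(m, n)) : dotm A B <= enorm A * enorm B.
Proof.
apply: le_trans (ler_norm _) _; rewrite -(@ler_pXn2r _ 2)// ?nnegrE ?mulr_ge0 ?enorm_ge0//.
by rewrite real_normK ?num_real// exprMn !nrm2E dotm_CS.
Qed.

(** Mean value theorem for the function minus its quadratic model along the
    segment from [x] to [x + v]; the derivative of the difference is nonpositive
    by the Lipschitz bound on the gradient. *)
Lemma smooth_descent p (L : R) (f : 'rV[R]_p -> R) : 0 <= L ->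
  (forall x, differentiable f x) -> smooth L f -> forall x v,
  f (x + v) <= f x + dotm (grad f x) v + L / 2 * nrm2 v.
Proof.
move=> L0 df sf x v.
pose psi (t : R) := f (x + t *: v) - (t * dotm (grad f x) v + t ^+ 2 * (L / 2 * nrm2 v)).
have dpsi t : is_derive t (1 : R) psi
    (dotm (grad f (x + t *: v)) v - (dotm (grad f x) v + 2 * t * (L / 2 * nrm2 v))).
  have dl : is_diff t (fun s : R => x + s *: v) (fun s => s *: v).
    have := is_diffD (is_diff_cst x t) (is_diff_scalel t v).
    have -> : cst x + *:%R ^~ v = (fun s : R => x + s *: v) by [].
    by rewrite add0r.
  have dfl : differentiable (fun s : R => f (x + s *: v)) t.
    by apply: (@differentiable_comp _ _ _ _ (fun s : R => x + s *: v) f).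
  have Dfl : is_derive t (1 : R) (fun s : R => f (x + s *: v))
      (dotm (grad f (x + t *: v)) v).
    apply: DeriveDef; first exact: diff_derivable.
    rewrite deriveE// -[fun s => _]/(f \o (fun s : R => x + s *: v)).
    rewrite diff_comp//= -diff_grad//; congr ('d f _ _).
    by rewrite diff_val scale1r.
  apply: is_deriveB; apply: is_derive_eq.
  rewrite /= -![_ *: _]/(_ * _); ring.
have cpsi : {within `[0, 1], continuous psi}.
  apply: derivable_within_continuous => t _.
  by have := dpsi t => /@ex_derive.
have [c] := @MVT_segment _ psi _ 0 1 ler01 (fun t _ => dpsi t) cpsi.
rewrite in_itv/= subr0 mulr1 => /andP[c0 c1].
rewrite /psi !scale1r !scale0r addr0 mul1r expr1n mul1r mul0r expr0n mul0r addr0 subr0.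
move=> h.
have h2 : dotm (grad f (x + c *: v) - grad f x) v <= L * c * nrm2 v.
  apply: le_trans (dotm_le _ _) _.
  apply: le_trans (ler_wpM2r (enorm_ge0 _) (sf _ _)) _.
  rewrite addrC addKr [X in L * X]enormE nrm2Z sqrtrM ?sqr_ge0// sqrtr_sqr ger0_norm//.
  by rewrite -enormE -nrm2E expr2 !mulrA.
move: h2; rewrite dotmDl dotmNl; lra.
Qed.

(** One gradient step along an inexact direction [u + s]. *)
Lemma inexact_descent p (L : R) (f : 'rV[R]_p -> R) (eta c : R) (x u s : 'rV[R]_p) :
  0 <= L -> (forall x, differentiable f x) -> smooth L f ->
  0 <= eta -> eta * L <= 1 -> nrm2 (grad f x - u) <= c ->
  f (x - eta *: (u + s)) <= f x - eta / 2 * nrm2 (grad f x) + eta / 2 * c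
    + L * eta ^+ 2 / 2 * nrm2 s + dotm ((L * eta ^+ 2) *: u - eta *: grad f x) s.
Proof.
move=> L0 df sf eta0 eL hc; apply: le_trans (smooth_descent L0 df sf _ _) _.
rewrite nrm2N nrm2Z nrm2D dotmNr dotmZr dotmDr dotmDl dotmNl !dotmZl.
move: hc; rewrite nrm2B; have := nrm2_ge0 u.
move: (nrm2 u) (nrm2 s) (nrm2 _) (f x) (dotm _ u) (dotm _ s) (dotm _ s).
move=> a1 a2 a3 a4 a5 a6 a7 a1_ge0 hc.
have h1 := ler_wpM2l (divr_ge0 eta0 (ler0n R 2)) hc.
have h2 := ler_wpM2r a1_ge0 (ler_wpM2l eta0 eL).
lra.
Qed.

Lemma grad_avg n p (f : 'I_n -> 'rV[R]_p -> R) x :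
  (forall i, differentiable (f i) x) ->
  grad (avg_fun f) x = mean_row (gradF f (consensus x)).
Proof.
move=> df; apply/matrixP => a j; rewrite mxE [RHS]mxE summxE.
have -> : avg_fun f = n%:R^-1 *: (\sum_i f i).
  by apply/funext => y; rewrite fct_sumE.
rewrite deriveZ; last by apply: derivable_sum => i; exact: diff_derivable.
rewrite derive_sum => [|i]; last exact: diff_derivable.
congr (_ * _); apply: eq_bigr => i _.
by rewrite rowK row_consensus mxE.
Qed.

Lemma diff_avg n p (f : 'I_n -> 'rV[R]_p -> R) x :
  (forall i, differentiable (f i) x) -> differentiable (avg_fun f) x.
Proof.
move=> df; have -> : avg_fun f = n%:R^-1 *: (\sum_i f i).
  by apply/funext => y; rewrite fct_sumE.
by apply: differentiableZ; apply: differentiable_sum.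
Qed.

Lemma nrm2_gradF n p (L : R) (f : 'I_n -> 'rV[R]_p -> R) : 0 <= L ->
  (forall i, smooth L (f i)) -> forall x y : 'M[R]_(n, p),
  nrm2 (gradF f x - gradF f y) <= L ^+ 2 * nrm2 (x - y).
Proof.
move=> L0 sf x y; rewrite (nrm2_rows (x - y)) mulr_sumr nrm2_rows.
apply: ler_sum => i _; rewrite !linearB/= !rowK.
exact: smooth_nrm2.
Qed.

(** Jensen's inequality for the average of the rows. *)
Lemma nrm2_mean n p (A : 'M[R]_(n, p)) : nrm2 (mean_row A) <= n%:R^-1 * nrm2 A.
Proof.
case: n A => [|n] A; first by rewrite invr0 mul0r /mean_row invr0 scale0r nrm20.
rewrite /mean_row nrm2Z.
have := nrm2_sum (enum 'I_n.+1) (fun i => row i A).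
rewrite !big_enum -nrm2_rows size_enum_ord => h.
apply: le_trans (ler_wpM2l (sqr_ge0 _) h) _.
by rewrite expr2 -!mulrA mulKf ?pnatr_eq0.
Qed.

Lemma mean_rowB n p (A B : 'M[R]_(n, p)) : mean_row (A - B) = mean_row A - mean_row B.
Proof.
by rewrite /mean_row -scalerBr -sumrB; congr (_ *: _); apply: eq_bigr => i _; rewrite linearB.
Qed.

(** Used with [A] the stochastic gradients, [B1] the gradients at the local
    iterates and [B0] the gradients at the average. *)
Lemma nrm2_mean_split n p (A B0 B1 : 'M[R]_(n, p)) : nrm2 (mean_row A) <=
  4 * nrm2 (mean_row B0) + 4 * (n%:R^-1 * nrm2 (B1 - B0)) + 2 * (n%:R^-1 * nrm2 (A - B1)).
Proof.
have -> : mean_row A = (mean_row B0 + mean_row (B1 - B0)) + mean_row (A - B1).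
  by rewrite !mean_rowB; apply/matrixP => i j; rewrite !mxE; ring.
have := nrm2D_le2 (mean_row B0 + mean_row (B1 - B0)) (mean_row (A - B1)).
have := nrm2D_le2 (mean_row B0) (mean_row (B1 - B0)).
have := nrm2_mean (A - B1); have := nrm2_mean (B1 - B0); lra.
Qed.

Lemma smooth_avg n p (L : R) (f : 'I_n -> 'rV[R]_p -> R) : (0 < n)%N -> 0 <= L ->
  (forall i x, differentiable (f i) x) -> (forall i, smooth L (f i)) ->
  smooth L (avg_fun f).
Proof.
move=> n0 L0 df sf; apply: nrm2_smooth => // x y; rewrite !grad_avg//.
have -> : mean_row (gradF f (consensus x)) - mean_row (gradF f (consensus y)) =
    mean_row (gradF f (consensus x) - gradF f (consensus y)).
  by rewrite mean_rowB.
apply: le_trans (nrm2_mean _) _.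
apply: le_trans (ler_wpM2l _ (nrm2_gradF L0 sf _ _)) _; first by rewrite invr_ge0.
have -> : consensus x - consensus y = consensus (x - y) :> 'M[R]_(n, p).
  by rewrite /consensus -mulmxBr.
by rewrite nrm2_consensus mulrCA mulKf ?pnatr_eq0// -lt0n.
Qed.

End Gradient.

(** * Square-integrable random matrices *)

Section BorelRow.
Context {R : realType} {p : nat} {d : measure_display} {T : measurableType d}.

(** Open sets of row vectors are countable unions of rational boxes. *)
Lemma measurable_preimage_open (X : T -> 'rV[R]_p) (U : set 'rV[R]_p) :
  (forall j, measurable_fun setT (fun w => X w 0 j)) -> open U ->
  measurable (X @^-1` U).
Proof.
move=> mX oU.
pose box (q : 'rV[rat]_p) (k : nat) : set 'rV[R]_p :=
  [set y | forall j, `|y 0 j - ratr (q 0 j)| < k.+1%:R^-1].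
have mbox q k : measurable (X @^-1` box q k).
  have -> : X @^-1` box q k = \big[setI/setT]_(j < p)
      ((fun w => X w 0 j) @^-1` ball (ratr (q 0 j) : R) k.+1%:R^-1).
    rewrite -bigcap_seq; apply/seteqP; split=> w /= h j.
      by move=> _ /=; rewrite /ball/= distrC; exact: h.
    by have := h j (mem_index_enum _); rewrite /ball/= distrC.
  apply: bigsetI_measurable => j _; rewrite -[X in measurable X]setTI.
  by apply: mX => //; exact: measurable_ball.
pose F (m : nat) : set T := if @choice.unpickle ('rV[rat]_p * nat)%type m is Some (q, k) then
    if `[< box q k `<=` U >] then X @^-1` box q k else set0 else set0.
have -> : X @^-1` U = \bigcup_m F m.
  apply/seteqP; split=> [w /= UX|w [m _]]; last first.
    rewrite /F; case: choice.unpickle => [[q k]|//].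
    by case: asboolP => // bU /bU.
  have /nbhs_ballP[e /= e0 eU] : nbhs (X w) U by exact: open_nbhs_nbhs.
  have [k ke] : exists k : nat, 2 * k.+1%:R^-1 < e :> R.
    have := near_infty_natSinv_lt (PosNum (divr_gt0 e0 (ltr0n R 2))).
    move=> [N _ /(_ N (leqnn N))] /= h; exists N.
    by rewrite -ltr_pdivlMl// mulrC.
  have /choice[q hq] : forall j, exists q : rat,
      `|X w 0 j - ratr q| < k.+1%:R^-1.
    move=> j.
    have itv_ne : X w 0 j - k.+1%:R^-1 < X w 0 j by rewrite gtrBl invr_gt0 ltr0n.
    have [q] := rat_in_itvoo itv_ne.
    rewrite in_itv/= => /andP[h1 h2]; exists q.
    by rewrite ger0_norm ?subr_ge0 ?ltW// ltrBlDr -ltrBlDl.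
  exists (choice.pickle (\row_j q j, k)) => //; rewrite /F choice.pickleK.
  case: asboolP => [_|[]]; first by move=> j /=; rewrite mxE.
  move=> y hy; apply: eU; rewrite /ball/=; split=> // i j; rewrite (ord1 i).
  have := hy j; have := hq j; rewrite mxE /ball/= => a b.
  apply: le_lt_trans (ler_distD (ratr (q j)) _ _) _.
  rewrite [X in _ + X]distrC.
  by move: a b ke; move: (k.+1%:R^-1) => c; lra.
apply: bigcupT_measurable => m; rewrite /F.
by case: choice.unpickle => [[q k]|//]; case: ifP.
Qed.

(** Random vectors are given by their coordinates, so measurability of a
    continuous image goes through open sets and rational boxes. *)
Lemma measurable_continuous_row (X : T -> 'rV[R]_p) (h : 'rV[R]_p -> R) :
  (forall j, measurable_fun setT (fun w => X w 0 j)) -> continuous h ->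
  measurable_fun setT (fun w => h (X w)).
Proof.
move=> mX ch; apply: (measurability _ (RGenOInfty.measurableE R)) => _ [_ [a ->] <-].
rewrite setTI -[X in measurable X]/(X @^-1` (h @^-1` `]a, +oo[)).
apply: measurable_preimage_open => //.
by apply: open_comp => [x _|]; [exact: ch|exact: interval_open].
Qed.

Lemma jointly_measurable_comp dZ (Z : measurableType dZ)
    (h : 'rV[R]_p -> Z -> 'rV[R]_p) (X : T -> 'rV[R]_p) (z : T -> Z) :
  jointly_measurable h -> (forall j, measurable_fun setT (fun w => X w 0 j)) ->
  measurable_fun setT z -> forall j, measurable_fun setT (fun w => h (X w) (z w) 0 j).
Proof.
move=> mh mX mz j.
pose u w : p.-tuple R * Z := ([tuple X w 0 l | l < p], z w).
have mu : measurable_fun setT u.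
  apply: measurable_fun_pair => //; apply/measurable_fun_tnthP => l.
  by rewrite (_ : _ \o _ = fun w => X w 0 l)//; apply/funext => w /=; rewrite tnth_mktuple.
rewrite (_ : (fun w => _) = (fun u => h (\row_l tnth u.1 l) u.2 0 j) \o u).
  exact: measurableT_comp.
apply/funext => w /=; congr (h _ _ 0 j); apply/matrixP => a l.
by rewrite mxE tnth_mktuple (ord1 a).
Qed.

End BorelRow.

Lemma continuous_smooth_grad {R : realType} p (L : R) (f : 'rV[R]_p -> R) j : 0 < L ->
  smooth L f -> continuous (fun x => grad f x 0 j).
Proof.
move=> L0 sf x; apply/(@cvgrPdist_lt _ _ _ (nbhs x)) => e e0.
pose del := e / (L * p.+1%:R).
have del0 : 0 < del by rewrite divr_gt0// mulr_gt0.
apply/nbhs_ballP; exists del => //= y xy.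
have h1 : (grad f x 0 j - grad f y 0 j) ^+ 2 <= nrm2 (grad f x - grad f y).
  rewrite /nrm2 /dotm big_ord1 (bigD1 j)//= !mxE expr2 lerDl.
  by apply: sumr_ge0 => k _; rewrite -expr2 sqr_ge0.
have h2 : nrm2 (x - y) <= p%:R * del ^+ 2.
  rewrite /nrm2 /dotm big_ord1.
  have -> : p%:R * del ^+ 2 = \sum_(l < p) del ^+ 2 by rewrite sumr_const card_ord mulr_natl.
  apply: ler_sum => l _; rewrite !mxE -expr2 -real_normK ?num_real//.
  rewrite ler_pXn2r// ?nnegrE// ?ltW//.
  by case: xy => _ /(_ 0 l).
have h3 := smooth_nrm2 (ltW L0) sf x y.
have h4 : (grad f x 0 j - grad f y 0 j) ^+ 2 < e ^+ 2.
  apply: le_lt_trans h1 _; apply: le_lt_trans h3 _.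
  apply: le_lt_trans (ler_wpM2l (sqr_ge0 _) h2) _.
  have -> : L ^+ 2 * (p%:R * del ^+ 2) = e ^+ 2 * (p%:R / p.+1%:R ^+ 2).
    by rewrite /del; field; rewrite gt_eqF ?andbT ?(gt_eqF L0)// addr_gt0 ?ltr01//.
  rewrite gtr_pMr ?exprn_gt0// ltr_pdivrMr ?exprn_gt0// mul1r.
  by rewrite -natrX ltr_nat expnS expn1 (leq_trans (ltnSn p))// leq_pmulr.
by move: h4; rewrite -real_normK ?num_real// ltr_pXn2r// nnegrE// ltW.
Qed.

Section SquareIntegrable.
Context {R : realType} {d : measure_display} {Omega : measurableType d}.
Variable P : probability Omega R.
Notation L1 := (is_L1 P).
Notation Ex := (expect P).
Notation centered := (is_centered P).

Definition is_L2 (X : Omega -> R) :=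
  measurable_fun setT X /\ L1 (fun w => X w ^+ 2).
Notation L2 := is_L2.

Implicit Types X Y : Omega -> R.

Lemma L2M X Y : L2 X -> L2 Y -> L1 (fun w => X w * Y w).
Proof.
move=> [mX hX] [mY hY].
apply: (L1_le (measurable_funM mX mY) (L1D hX hY)) => w.
rewrite /= ler_norml; apply/andP; split.
  have := sqr_ge0 (X w + Y w); have := sqr_ge0 (X w); have := sqr_ge0 (Y w); nra.
have := sqr_ge0 (X w - Y w); have := sqr_ge0 (X w); have := sqr_ge0 (Y w); nra.
Qed.

Lemma L2D X Y : L2 X -> L2 Y -> L2 (fun w => X w + Y w).
Proof.
move=> hX hY; have [mX X2] := hX; have [mY Y2] := hY.
split; first exact: measurable_funD.
rewrite (_ : (fun w => _) = fun w => (X w ^+ 2 + 2 * (X w * Y w)) + Y w ^+ 2).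
  by apply: L1D => //; apply: L1D => //; apply: L1Z; exact: L2M.
by apply/funext => w; ring.
Qed.

Lemma L2Z c X : L2 X -> L2 (fun w => c * X w).
Proof.
move=> [mX X2]; split; first exact: measurable_funM.
by under eq_fun do rewrite exprMn; exact: L1Z.
Qed.

Lemma L2_cst c : L2 (fun=> c).
Proof. by split; [exact: measurable_cst|exact: L1_cst]. Qed.

Lemma L2_sum (I : Type) (s : seq I) (F : I -> Omega -> R) :
  (forall i, L2 (F i)) -> L2 (fun w => \sum_(i <- s) F i w).
Proof.
move=> hF; elim: s => [|i s IH].
  by rewrite (_ : (fun=> _) = fun=> 0); [exact: L2_cst|apply/funext => w; rewrite big_nil].
rewrite (_ : (fun=> _) = fun w => F i w + \sum_(j <- s) F j w).
  exact: L2D.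
by apply/funext => w; rewrite big_cons.
Qed.

Definition mx_L2 {m n} (A : Omega -> 'M[R]_(m, n)) :=
  forall i j, L2 (fun w => A w i j).
Notation mL2 := mx_L2.

Section Closure.
Variables (m n : nat).
Implicit Types A B : Omega -> 'M[R]_(m, n).

Lemma mL2D A B : mL2 A -> mL2 B -> mL2 (fun w => A w + B w).
Proof. by move=> hA hB i j; under eq_fun do rewrite mxE; exact: L2D. Qed.

Lemma mL2Z c A : mL2 A -> mL2 (fun w => c *: A w).
Proof. by move=> hA i j; under eq_fun do rewrite mxE; exact: L2Z. Qed.

Lemma mL2N A : mL2 A -> mL2 (fun w => - A w).
Proof. by move=> hA; under eq_fun do rewrite -scaleN1r; exact: mL2Z. Qed.

Lemma mL2B A B : mL2 A -> mL2 B -> mL2 (fun w => A w - B w).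
Proof. by move=> hA hB; apply: mL2D => //; exact: mL2N. Qed.

Lemma mL2_cst (M : 'M[R]_(m, n)) : mL2 (fun=> M).
Proof. by move=> i j; exact: L2_cst. Qed.

Lemma mL2_mulmx l (M : 'M[R]_(l, m)) A : mL2 A -> mL2 (fun w => M *m A w).
Proof.
move=> hA i j; under eq_fun do rewrite mxE.
by apply: L2_sum => k; exact: L2Z.
Qed.

Lemma mL2_col l A (B : Omega -> 'M[R]_(l, n)) :
  mL2 A -> mL2 B -> mL2 (fun w => col_mx (A w) (B w)).
Proof.
move=> hA hB i j; under eq_fun do rewrite mxE.
by case: (fintype.split i) => k; [exact: hA|exact: hB].
Qed.

Lemma mL2_row i A : mL2 A -> mL2 (fun w => row i (A w)).
Proof. by move=> hA a j; under eq_fun do rewrite mxE; exact: hA. Qed.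

Lemma mL2_rows A : (forall i, mL2 (fun w => row i (A w))) -> mL2 A.
Proof. by move=> hA i j; have := hA i 0 j; under eq_fun do rewrite mxE. Qed.

Lemma mL2_dot A B : mL2 A -> mL2 B -> L1 (fun w => dotm (A w) (B w)).
Proof. by move=> hA hB; do 2 apply: L1_sum => ?; exact: L2M. Qed.

Lemma mL2_nrm2 A : mL2 A -> L1 (fun w => nrm2 (A w)).
Proof. by move=> hA; exact: mL2_dot. Qed.

Lemma mL2_dom A (Y : Omega -> R) :
  (forall i j, measurable_fun setT (fun w => A w i j)) -> L1 Y ->
  (forall w, nrm2 (A w) <= Y w) -> mL2 A.
Proof.
move=> mA hY AY i j; split=> //; apply: (L1_le _ hY) => [|w].
  exact: measurable_funX.
rewrite ger0_norm ?sqr_ge0//; apply: le_trans (AY w).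
rewrite /nrm2 /dotm (bigD1 i)//= (bigD1 j)//= expr2 -addrA lerDl.
rewrite addr_ge0//; last apply: sumr_ge0 => k _; apply: sumr_ge0 => l _;
  by rewrite -expr2 sqr_ge0.
Qed.

Lemma mL2_sum (I : Type) (s : seq I) (F : I -> Omega -> 'M[R]_(m, n)) :
  (forall i, mL2 (F i)) -> mL2 (fun w => \sum_(i <- s) F i w).
Proof.
move=> hF i j; under eq_fun do rewrite summxE.
by apply: L2_sum => k; exact: hF.
Qed.

End Closure.

Lemma mL2_mean n p (A : Omega -> 'M[R]_(n, p)) : mL2 A -> mL2 (fun w => mean_row (A w)).
Proof. by move=> hA; apply: mL2Z; apply: mL2_sum => i; exact: mL2_row. Qed.

Lemma mL2_consensus n p (A : Omega -> 'rV[R]_p) :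
  mL2 A -> mL2 (fun w => consensus (A w) : 'M[R]_(n, p)).
Proof. exact: mL2_mulmx. Qed.

Lemma mL2_meas m n (A : Omega -> 'M[R]_(m, n)) i j : mL2 A ->
  measurable_fun setT (fun w => A w i j).
Proof. by move=> /(_ i j)[]. Qed.

Definition mmeas (F : set_system Omega) {m n} (A : Omega -> 'M[R]_(m, n)) :=
  forall i j, measurable_wrt F (fun w => A w i j).

Definition mx_centered (F : set_system Omega) {m n} (A : Omega -> 'M[R]_(m, n)) :=
  forall i j, centered F (fun w => A w i j).
Notation mcentered := mx_centered.

Section MeasClosure.
Variables (F : set_system Omega) (subF : sub_sigma_algebra_of F) (m n : nat).
Implicit Types A B : Omega -> 'M[R]_(m, n).

Lemma mmeas_cst (M : 'M[R]_(m, n)) : mmeas F (fun=> M).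
Proof. by move=> i j; apply/(measurable_wrtP subF); exact: measurable_cst. Qed.

Lemma mmeasD A B : mmeas F A -> mmeas F B -> mmeas F (fun w => A w + B w).
Proof.
move=> hA hB i j; under eq_fun do rewrite mxE; apply/(measurable_wrtP subF).
by apply: measurable_funD; exact/(measurable_wrtP subF).
Qed.

Lemma mmeas_mulmx l (M : 'M[R]_(l, m)) A : mmeas F A -> mmeas F (fun w => M *m A w).
Proof.
move=> hA i j; under eq_fun do rewrite mxE; apply/(measurable_wrtP subF).
apply: measurable_sum => k; apply: measurable_funM => //.
exact/(measurable_wrtP subF).
Qed.

Lemma mmeasZ c A : mmeas F A -> mmeas F (fun w => c *: A w).
Proof.
move=> hA i j; under eq_fun do rewrite mxE; apply/(measurable_wrtP subF).
by apply: measurable_funM => //; exact/(measurable_wrtP subF).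
Qed.

Lemma mmeasB A B : mmeas F A -> mmeas F B -> mmeas F (fun w => A w - B w).
Proof.
move=> hA hB; apply: mmeasD => //.
by under eq_fun do rewrite -scaleN1r; exact: mmeasZ.
Qed.

Lemma mmeas_col l A (B : Omega -> 'M[R]_(l, n)) :
  mmeas F A -> mmeas F B -> mmeas F (fun w => col_mx (A w) (B w)).
Proof.
move=> hA hB i j; under eq_fun do rewrite mxE.
by case: (fintype.split i) => k; [exact: hA|exact: hB].
Qed.

Lemma mmeas_row i A : mmeas F A -> mmeas F (fun w => row i (A w)).
Proof. by move=> hA a j; under eq_fun do rewrite mxE; exact: hA. Qed.

Lemma mmeas_rows A : (forall i, mmeas F (fun w => row i (A w))) -> mmeas F A.
Proof. by move=> hA i j; have := hA i 0 j; under eq_fun do rewrite mxE. Qed.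

Lemma mmeas_sub (F' : set_system Omega) A : F `<=` F' -> mmeas F A -> mmeas F' A.
Proof. by move=> FF' hA i j B mB; apply: FF'; exact: hA. Qed.

(** A centred matrix is orthogonal to everything known beforehand. *)
Lemma mcentered_dot A B : mmeas F A -> mL2 A -> mL2 B -> mcentered F B ->
  Ex (fun w => dotm (A w) (B w)) = 0.
Proof.
move=> mA hA hB cB; rewrite Ex_sum => [|i]; last by apply: L1_sum => j; exact: L2M.
rewrite big1// => i _; rewrite Ex_sum => [|j]; last exact: L2M.
rewrite big1// => j _; apply: (centered_mul subF) => //; exact: L2M.
Qed.

(** Pythagoras: a centred perturbation adds its own second moment. *)
Lemma Ex_nrm2D A B : mL2 A -> mL2 B -> Ex (fun w => dotm (A w) (B w)) = 0 ->
  Ex (fun w => nrm2 (A w + B w)) = Ex (fun w => nrm2 (A w)) + Ex (fun w => nrm2 (B w)).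
Proof.
move=> hA hB AB0; under [X in Ex X]eq_fun do rewrite nrm2D.
rewrite ExD; [|by apply: L1D; [exact: mL2_nrm2|apply: L1Z; exact: mL2_dot]|exact: mL2_nrm2].
rewrite ExD; [|exact: mL2_nrm2|by apply: L1Z; exact: mL2_dot].
by rewrite ExZ ?AB0 ?mulr0 ?addr0//; exact: mL2_dot.
Qed.

End MeasClosure.

Lemma mmeas_mean F (subF : sub_sigma_algebra_of F) n p (A : Omega -> 'M[R]_(n, p)) :
  mmeas F A -> mmeas F (fun w => mean_row (A w)).
Proof. move=> hA; by under eq_fun do rewrite mean_rowE; exact: mmeas_mulmx.
Qed.

End SquareIntegrable.

(** * Second moments of row-wise noise *)

Section Moments.
Context {R : realType} {d : measure_display} {Omega : measurableType d}.
Variable P : probability Omega R.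
Notation L1 := (is_L1 P).
Notation Ex := (expect P).
Notation L2 := (is_L2 P).
Notation mL2 := (mx_L2 P).
Notation centered := (is_centered P).
Notation mcentered := (mx_centered P).

(** Lets the lemmas on sub-sigma-algebras serve for plain measurability too. *)
Lemma sub_measurable : sub_sigma_algebra_of (@measurable _ Omega).
Proof. by split=> //; exact: sigma_algebra_measurable. Qed.

Lemma mL2_mmeas m n (A : Omega -> 'M[R]_(m, n)) : mL2 A -> mmeas measurable A.
Proof.
move=> hA i j; apply/(measurable_wrtP sub_measurable) => _ B mB.
rewrite setTI sub_measE; last exact: sub_measurable.
by rewrite -[X in measurable X]setTI; exact: (mL2_meas i j hA).
Qed.

Lemma sub_FT (F : set_system Omega) : sub_sigma_algebra_of F -> F setT.
Proof. by move=> sF; rewrite -(sub_measE sF); exact: measurableT. Qed.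

(** Integrate the almost sure bound on the conditional expectation over the whole
    space. *)
Lemma condexp_le_Ex (F : set_system Omega) X Z : sub_sigma_algebra_of F ->
  condexp_le P F X Z -> L1 Z -> L1 X /\ Ex X <= Ex Z.
Proof.
move=> sF [Y [hX hY _ XY] YZ] hZ; split=> //.
have <- : Ex Y = Ex X by rewrite /expect /Rintegral XY//; exact: sub_FT.
have mm : measurable_fun setT (fun w => Num.min (Y w) (Z w)).
  by apply: measurable_minr; [exact: L1_meas hY|exact: L1_meas hZ].
have hm : L1 (fun w => Num.min (Y w) (Z w)).
  apply: (L1_le mm (L1D (L1_abs hY) (L1_abs hZ))) => w /=.
  case: (leP (Y w) (Z w)) => _; first by rewrite lerDl normr_ge0.
  by rewrite lerDr normr_ge0.
have -> : Ex Y = Ex (fun w => Num.min (Y w) (Z w)).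
  apply: Ex_ae => //; first exact: L1_meas hY.
  by apply: filterS YZ => w h; rewrite (min_idPl h).
by apply: Ex_le => // w; rewrite ge_min lexx orbT.
Qed.

Lemma mcentered_mulmx (F : set_system Omega) (sF : sub_sigma_algebra_of F) m n l (M : 'M[R]_(l, m))
  (A : Omega -> 'M[R]_(m, n)) : mcentered F A -> mcentered F (fun w => M *m A w).
Proof.
move=> cA i j; split.
  under eq_fun do rewrite mxE.
  by apply: L1_sum => k; apply: L1Z; case: (cA k j).
move=> S FS; have mS : measurable S by case: sF => _; apply.
under [X in Ex X]eq_fun do rewrite mxE mulr_suml.
rewrite Ex_sum => [|k]; last first.
  by under eq_fun do rewrite -mulrA; apply: L1Z; apply: L1_indic => //; case: (cA k j).
rewrite big1// => k _; under [X in Ex X]eq_fun do rewrite -mulrA.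
rewrite ExZ; last by apply: L1_indic => //; case: (cA k j).
by case: (cA k j) => _ ->; rewrite ?mulr0.
Qed.

Lemma dotm_suml (I : Type) (r : seq I) m n (A : I -> 'M[R]_(m, n)) (B : 'M[R]_(m, n)) :
  dotm (\sum_(i <- r) A i) B = \sum_(i <- r) dotm (A i) B.
Proof.
elim: r => [|i r IH]; last by rewrite !big_cons dotmDl IH.
by rewrite !big_nil -(scale0r 0) dotmZl mul0r.
Qed.

Section Rows.
(** [A] is sampled row by row with conditional mean [B] and conditional variance
    at most [Z i] in row [i]. This covers both stochastic gradients and compression. *)
Variables (F : set_system Omega) (sF : sub_sigma_algebra_of F).
Variables (n p : nat) (A B : Omega -> 'M[R]_(n, p)) (Z : 'I_n -> Omega -> R).
Hypothesis AB : forall i, is_condexp_vec P F (fun w => row i (A w)) (fun w => row i (B w)).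
Hypothesis ABle : forall i, condexp_le P F (fun w => enorm (row i (A w) - row i (B w)) ^+ 2) (Z i).
Hypothesis hZ : forall i, L1 (Z i).

Let s w := A w - B w.

Lemma rows_L2 : mL2 s.
Proof.
apply: mL2_rows => i.
have [h _] := condexp_le_Ex sF (ABle i) (hZ i).
apply: (mL2_dom _ h) => [a j|w]; last by rewrite nrm2E /s linearB.
under eq_fun do rewrite !mxE.
have [h1 h2 _ _] := AB i j.
by have := L1_meas (L1B h1 h2); under eq_fun do rewrite !mxE.
Qed.

Lemma rows_centered : mcentered F s.
Proof.
move=> i j; under eq_fun do rewrite !mxE.
by have := condexp_centered sF (AB i j); under eq_fun do rewrite !mxE.
Qed.

Lemma rows_moment i : Ex (fun w => nrm2 (row i (s w))) <= Ex (Z i).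
Proof.
have [_] := condexp_le_Ex sF (ABle i) (hZ i).
by under [X in Ex X]eq_fun do rewrite nrm2E -linearB.
Qed.

Lemma rows_total : Ex (fun w => nrm2 (s w)) <= \sum_i Ex (Z i).
Proof.
under [X in Ex X]eq_fun do rewrite nrm2_rows.
rewrite Ex_sum => [|i]; last by apply: mL2_nrm2; apply: mL2_row; exact: rows_L2.
by apply: ler_sum => i _; exact: rows_moment.
Qed.

(** Orthogonal rows: the variance of the average of [n] rows is [n] times smaller
    than that of one row. *)
Lemma rows_mean c : (0 < n)%N -> (forall i, Ex (Z i) <= c) ->
  (forall i j, i != j -> Ex (fun w => dotm (row i (s w)) (row j (s w))) = 0) ->
  Ex (fun w => nrm2 (mean_row (s w))) <= c / n%:R.
Proof.
move=> n0 Zc orth.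
have hr i : mL2 (fun w => row i (s w)) by apply: mL2_row; exact: rows_L2.
have E w : nrm2 (mean_row (s w)) = n%:R^-1 ^+ 2 *
    \sum_i \sum_j dotm (row i (s w)) (row j (s w)).
  rewrite /mean_row nrm2Z; congr (_ * _); rewrite /nrm2 dotm_suml.
  by apply: eq_bigr => i _; rewrite dotmC dotm_suml; apply: eq_bigr => j _; rewrite dotmC.
under [X in Ex X]eq_fun do rewrite E.
rewrite ExZ; last by do 2 apply: L1_sum => ?; exact: mL2_dot.
rewrite Ex_sum => [|i]; last by apply: L1_sum => ?; exact: mL2_dot.
have : \sum_i Ex (fun w => \sum_j dotm (row i (s w)) (row j (s w))) <= n%:R * c.
  have -> : n%:R * c = \sum_(i < n) c by rewrite sumr_const card_ord mulr_natl.
  apply: ler_sum => i _; rewrite Ex_sum => [|j]; last exact: mL2_dot.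
  rewrite (bigD1 i)//= [X in _ + X]big1 ?addr0; last by move=> j ji; rewrite orth// eq_sym.
  exact: le_trans (rows_moment i) (Zc i).
move=> /(ler_wpM2l (sqr_ge0 n%:R^-1)) /le_trans; apply.
rewrite expr2 mulrA mulfVK ?pnatr_eq0 -?lt0n// mulrC//.
Qed.

End Rows.

Section Functions.
Variables (n p : nat) (f : 'I_n -> 'rV[R]_p -> R) (L : R).
Hypotheses (L0 : 0 < L) (df : forall i x, differentiable (f i) x).
Hypothesis sf : forall i, smooth L (f i).

Lemma mmeas_gradF (F : set_system Omega) (X : Omega -> 'M[R]_(n, p)) :
  sub_sigma_algebra_of F -> mmeas F X -> mmeas F (fun w => gradF f (X w)).
Proof.
move=> sF mX i j; under eq_fun do rewrite mxE.
apply/(measurable_wrtP sF).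
apply: (measurable_continuous_row (X := fun w : g_sigma_algebraType F => row i (X w))
  (h := fun x => grad (f i) x 0 j)); last exact: continuous_smooth_grad (sf i).
by move=> l; under eq_fun do rewrite mxE; exact/(measurable_wrtP sF).
Qed.

Lemma mL2_gradF (X : Omega -> 'M[R]_(n, p)) : mL2 X -> mL2 (fun w => gradF f (X w)).
Proof.
move=> hX.
have -> : (fun w => gradF f (X w)) = fun w => (gradF f (X w) - gradF f 0) + gradF f 0.
  by apply/funext => w; rewrite subrK.
apply: mL2D; last exact: mL2_cst.
have hm := mmeasB sub_measurable (mmeas_gradF sub_measurable (mL2_mmeas hX))
  (mmeas_cst sub_measurable (gradF f 0)).
apply: (mL2_dom (Y := fun w => L ^+ 2 * nrm2 (X w))).
- by move=> i j; apply: measurable_wrt_meas (hm i j); exact: sub_measurable.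
- by apply: L1Z; exact: mL2_nrm2.
- by move=> w; have := nrm2_gradF (ltW L0) sf (X w) 0; rewrite subr0.
Qed.

(** The function is bounded below by assumption and above by a quadratic, by the
    descent lemma at the origin. *)
Lemma L1_avg (X : Omega -> 'rV[R]_p) : (0 < n)%N -> has_lbound (range (avg_fun f)) ->
  mL2 X -> L1 (fun w => avg_fun f (X w)).
Proof.
move=> n0 [b lb] hX.
have dF x : differentiable (avg_fun f) x by exact: diff_avg.
have sF := smooth_avg n0 (ltW L0) df sf.
apply: (@L1_le _ _ _ P _ (fun w => `|b| + (`|avg_fun f 0| +
  (nrm2 (grad (avg_fun f) 0) + (1 + L / 2) * nrm2 (X w))))).
- apply: measurable_continuous_row; last by move=> x; exact: differentiable_continuous.
  by move=> j; exact: (mL2_meas 0 j hX).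
- apply: L1D; first exact: (L1_cst P).
  apply: L1D; first exact: (L1_cst P).
  apply: L1D; first exact: (L1_cst P).
  by apply: L1Z; exact: mL2_nrm2.
- move=> w; have := smooth_descent (ltW L0) dF sF 0 (X w).
  rewrite add0r => up.
  have low : b <= avg_fun f (X w) by apply: lb; exists (X w).
  have := nrm2_ge0 (grad (avg_fun f) 0 - X w); rewrite nrm2B.
  have := nrm2_ge0 (X w); have := nrm2_ge0 (grad (avg_fun f) 0).
  have := ler_norm (- b); have := ler_norm (avg_fun f 0); rewrite normrN.
  have := normr_ge0 b; have := normr_ge0 (avg_fun f 0).
  move: (dotm _ _) (nrm2 _) (nrm2 _) up => dd q1 q2 up b0 a0 a1 b1 q10 q20 dot.
  have Lq : 0 <= L / 2 * q2 by rewrite mulr_ge0// divr_ge0// ltW.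
  by rewrite ler_norml; apply/andP; split; lra.
Qed.

End Functions.

(** Independence of the samples makes the gradient noises of different agents
    orthogonal. *)
Lemma noise_orth (F : set_system Omega) n p dX (Xi : 'I_n -> measurableType dX)
    (g : forall i, 'rV[R]_p -> Xi i -> 'rV[R]_p) (xi : forall i, Omega -> Xi i)
    (X B : Omega -> 'M[R]_(n, p)) (i j : 'I_n) :
  sub_sigma_algebra_of F -> (forall i, jointly_measurable (g i)) ->
  (forall i, measurable_fun setT (xi i)) -> cond_independent P F xi ->
  mmeas F X -> mmeas F B ->
  let s := fun w => (\matrix_(i < n) g i (row i (X w)) (xi i w)) - B w in
  mL2 s -> mcentered F s -> i != j ->
  Ex (fun w => dotm (row i (s w)) (row j (s w))) = 0.
Proof.
move=> sF mg mxi ind mX mB s hs cs ij.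
have ms k : mmeas (with_sample F xi k) (fun w => row k (s w)).
  have sW := with_sample_sub sF mxi k.
  have FW : F `<=` with_sample F xi k by exact: sub_with_sample.
  under eq_fun do rewrite /s linearB/= rowK.
  apply: (mmeasB sW); last by apply: mmeas_row; exact: mmeas_sub FW mB.
  move=> a l; rewrite (ord1 a); apply/(measurable_wrtP sW).
  apply: (jointly_measurable_comp (T := g_sigma_algebraType (with_sample F xi k))) => //.
    move=> l'; apply/(measurable_wrtP sW).
    by apply: mmeas_row; exact: mmeas_sub FW mX.
  by apply/(measurable_wrtP sW); exact: with_sample_meas.
have hr k : mL2 (fun w => row k (s w)) by exact: mL2_row.
rewrite Ex_sum => [|a]; last by apply: L1_sum => ?; apply: L2M; exact: hr.
rewrite big1// => a _; rewrite Ex_sum => [|l]; last by apply: L2M; exact: hr.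
rewrite big1// => l _; apply: (centered_mul_indep sF mxi ind ij).
- exact: ms.
- exact: ms.
- by under eq_fun do rewrite mxE; exact: cs.
- by apply: L2M; exact: hr.
Qed.

End Moments.

(** * The scalar recursion *)

Section Arithmetic.
Context {R : realType}.
Variables (rho gamma eta L alpha C n sig2 : R).
Hypotheses (rho_gt0 : 0 < rho) (gamma_gt0 : 0 < gamma) (eta_gt0 : 0 < eta) (L_gt0 : 0 < L)
  (alpha_gt0 : 0 < alpha) (C_gt0 : 0 < C) (n_gt0 : 0 < n) (sig2_ge0 : 0 <= sig2).
Hypotheses (rho_le : rho <= gamma / 2) (gamma_le : gamma <= 1 / 8)
  (etaL : eta * L <= rho / 16) (alphaC : alpha * (C + 1) <= 1 / 4)
  (gC : (128 * 124) * (gamma * C) <= alpha ^+ 2)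
  (gC2 : (128 * 124) * (gamma * (gamma * C)) <= alpha ^+ 2 * (2 * rho)).

Let q : R := (eta * L) ^+ 2.
Let N : R := n * eta ^+ 2 * sig2.

Lemma q_ge0 : 0 <= q. Proof. exact: sqr_ge0. Qed.

Lemma q_le : q <= rho ^+ 2 / 256.
Proof.
have h : q <= (rho / 16) ^+ 2.
  by rewrite ler_pXn2r// nnegrE; [rewrite mulr_ge0// ltW|rewrite divr_ge0// ltW].
by apply: le_trans h _; rewrite le_eqVlt; apply/orP; left; apply/eqP; field.
Qed.

Lemma N_ge0 : 0 <= N.
Proof. by rewrite /N !mulr_ge0// ?sqr_ge0 ?ltW. Qed.

Lemma rho_lt : rho <= 1 / 16. Proof. by have := rho_le; have := gamma_le; lra. Qed.

Lemma rho2_le : rho ^+ 2 <= rho / 16.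
Proof. by rewrite expr2; have := rho_lt; move: rho_gt0; nra. Qed.

(* second moments at one time: [h] of the transformed state, [z] of the residual
   [y - H], [m] of the gradient at the average *)
Variables (h z m : R) (h_ge0 : 0 <= h) (z_ge0 : 0 <= z) (m_ge0 : 0 <= m).
Let M : R := n * eta ^+ 2 * m.

Lemma M_ge0 : 0 <= M.
Proof. by rewrite /M !mulr_ge0// ?sqr_ge0 ?ltW. Qed.

(** [G] stands for the second moment of the averaged stochastic gradient. *)
Lemma drift_le G : G <= 4 * m + 8 * (L ^+ 2 / n * h) + 2 * sig2 ->
  n * eta ^+ 2 * G <= 4 * M + 8 * (q * h) + 2 * N.
Proof.
move=> hG; have k0 : 0 <= n * eta ^+ 2 by rewrite mulr_ge0 ?sqr_ge0 ?ltW.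
apply: le_trans (ler_wpM2l k0 hG) _.
rewrite le_eqVlt; apply/orP; left; apply/eqP; rewrite /M /N /q; field.
by rewrite gt_eqF.
Qed.

(** Young's inequality with parameter [rho / 4] still leaves a contraction, since
    [q] is at most [rho ^+ 2 / 256] and absorbs the two factors [rho^-1] in front of
    the drift of the average. *)
Lemma state_recursion (u b nn c h' G : R) : 0 <= G ->
  u <= (1 - 7 / 10 * rho) * h -> b <= rho^-1 * (q * (n * eta ^+ 2 * G)) ->
  nn <= N -> c <= gamma * (C * z) ->
  G <= 4 * m + 8 * (L ^+ 2 / n * h) + 2 * sig2 ->
  h' <= (1 + rho / 4) * u + (2 + 4 / rho) * b + 2 * nn + c ->
  h' <= (1 - rho / 3) * h + gamma * (C * z) + 3 * N + M / 8.
Proof.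
have rho0 := rho_gt0; have gamma0 := gamma_gt0; have alpha0 := alpha_gt0.
have rho_g := rho_le; have gamma8 := gamma_le.
have h0 := h_ge0; have z0 := z_ge0.
move=> G0 hu hb hn hc /drift_le; set g := n * eta ^+ 2 * G => hG hh.
have g0 : 0 <= g by rewrite !mulr_ge0 ?sqr_ge0 // ltW.
have rV : 0 < rho^-1 by rewrite invr_gt0.
have rVr : rho^-1 * rho = 1 by rewrite mulVf// gt_eqF.
have hu' : (1 + rho / 4) * u <= (1 + rho / 4) * ((1 - 7 / 10 * rho) * h).
  by rewrite ler_wpM2l//; move: rho_gt0; lra.
have hb' : (2 + 4 / rho) * b <= 6 / 256 * g.
  have c0 : 0 <= 2 + 4 / rho by rewrite addr_ge0// divr_ge0// ltW.
  apply: le_trans (ler_wpM2l c0 hb) _.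
  have : (2 + 4 / rho) <= 6 / rho.
    rewrite -subr_ge0; have -> : 6 / rho - (2 + 4 / rho) = 2 * (rho^-1 - 1).
      by field; rewrite gt_eqF.
    rewrite mulr_ge0// subr_ge0 -invr1 lef_pV2 ?posrE//; have := rho_lt; lra.
  have p0 : 0 <= rho^-1 * (q * g) by rewrite !mulr_ge0 ?q_ge0 // ltW.
  move=> /(ler_wpM2r p0) /le_trans; apply.
  have qg : q * g <= rho ^+ 2 / 256 * g by rewrite ler_wpM2r// q_le.
  have r2 : 0 <= 6 / rho * rho^-1 by rewrite mulr_ge0 ?divr_ge0 ?ltW// ltW.
  rewrite [leLHS]mulrA; apply: le_trans (ler_wpM2l r2 qg) _.
  by rewrite le_eqVlt; apply/orP; left; apply/eqP; field; rewrite gt_eqF.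
have qh : q * h <= rho / 256 * h.
  by rewrite ler_wpM2r//; have := q_le; have := rho2_le; move: rho_gt0; lra.
have rh : 0 <= rho * h by rewrite mulr_ge0// ltW.
have r2h : 0 <= rho ^+ 2 * h by rewrite mulr_ge0// sqr_ge0.
have := N_ge0; have := M_ge0.
move: hu'; rewrite expr2 in r2h.
have -> : (1 + rho / 4) * ((1 - 7 / 10 * rho) * h) =
  h - 9 / 20 * (rho * h) - 7 / 40 * (rho * rho * h) by field.
have -> : (1 - rho / 3) * h = h - (rho * h) / 3 by field.
lra.
Qed.

Lemma q_small : q <= rho / 128.
Proof. by have := q_le; have := rho2_le; have := rho_gt0; lra. Qed.

Lemma q_small1 : q <= 1 / 256.
Proof. by have := q_small; have := rho_lt; lra. Qed.

Lemma gh_ge0 : 0 <= gamma * h.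
Proof. by rewrite mulr_ge0// ltW. Qed.

Lemma gCz_ge0 : 0 <= gamma * (C * z).
Proof. by rewrite !mulr_ge0// ltW. Qed.

Lemma ggCz_ge0 : 0 <= gamma * (gamma * (C * z)).
Proof. by rewrite mulr_ge0 ?gCz_ge0// ltW. Qed.

Lemma qh_ge0 : 0 <= q * h. Proof. by rewrite mulr_ge0 ?q_ge0. Qed.

Lemma qh_le : q * h <= gamma * h / 256.
Proof.
have := ler_wpM2r h_ge0 q_small; have := ler_wpM2r h_ge0 rho_le; lra.
Qed.

Lemma gamma2_le : gamma ^+ 2 <= gamma / 8.
Proof. by rewrite expr2; have := ler_wpM2l (ltW gamma_gt0) gamma_le; lra. Qed.

Lemma state_term_le t1 : t1 <= 3 * (2 * h + (2 * N + 4 * (q * h))) ->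
  gamma ^+ 2 * t1 <= gamma * h + N / 2.
Proof.
move=> /(ler_wpM2l (sqr_ge0 gamma)) /le_trans; apply.
have b0 : 0 <= 3 * (2 * h + (2 * N + 4 * (q * h))).
  by have := N_ge0; have := qh_ge0; have := h_ge0; lra.
apply: le_trans (ler_wpM2r b0 gamma2_le) _.
have gN := ler_wpM2r N_ge0 gamma_le.
have gqh := ler_wpM2r qh_ge0 gamma_le.
have qh := qh_le; have g0 := gh_ge0; have n0 := N_ge0.
have -> : gamma / 8 * (3 * (2 * h + (2 * N + 4 * (q * h)))) =
  3 / 4 * (gamma * h) + 3 / 4 * (gamma * N) + 3 / 2 * (gamma * (q * h)) by field.
lra.
Qed.

Lemma next_state_term_le h' :
  h' <= (1 - rho / 3) * h + gamma * (C * z) + 3 * N + M / 8 ->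
  q * h' <= gamma * h / 256 + gamma * (gamma * (C * z)) / 256 + N / 64 + M / 256.
Proof.
move=> /(ler_wpM2l q_ge0) /le_trans; apply.
have e2 : q * (gamma * (C * z)) <= gamma / 256 * (gamma * (C * z)).
  by rewrite ler_wpM2r ?gCz_ge0//; have := q_small; have := rho_le; lra.
have e3 := ler_wpM2r N_ge0 q_small1; have e4 := ler_wpM2r M_ge0 q_small1.
have e5 : 0 <= q * h * rho by rewrite mulr_ge0 ?qh_ge0// ltW.
have e6 := qh_le; have e7 := N_ge0; have e8 := M_ge0.
have -> : q * ((1 - rho / 3) * h + gamma * (C * z) + 3 * N + M / 8) =
  q * h - q * h * rho / 3 + q * (gamma * (C * z)) + 3 * (q * N) + q * M / 8 by field.
have {}e2 : q * (gamma * (C * z)) <= gamma * (gamma * (C * z)) / 256.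
  by rewrite (le_trans e2)// mulrAC.
lra.
Qed.

Lemma drift_term_le G : 0 <= G -> G <= 4 * m + 8 * (L ^+ 2 / n * h) + 2 * sig2 ->
  q * (n * eta ^+ 2 * G) <= gamma * h / 256 + N / 64 + M / 32.
Proof.
move=> G0 /drift_le; set g := n * eta ^+ 2 * G => hG.
have g0 : 0 <= g by rewrite !mulr_ge0 ?sqr_ge0 // ltW.
have e1 := ler_wpM2r g0 q_small1; have e2 := qh_le.
have e3 := N_ge0; have e4 := M_ge0; have e5 := gh_ge0; lra.
Qed.

(** [dy] stands for the second moment of the displacement of [y]. *)
Lemma displacement_le (dy ec h' G t1 : R) : 0 <= G -> ec <= C * z ->
  t1 <= 3 * (2 * h + (2 * N + 4 * (q * h))) ->
  h' <= (1 - rho / 3) * h + gamma * (C * z) + 3 * N + M / 8 ->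
  G <= 4 * m + 8 * (L ^+ 2 / n * h) + 2 * sig2 ->
  dy <= 6 * (gamma ^+ 2 * t1 + gamma ^+ 2 * ec + gamma * h +
             (2 * N + 4 * (q * h')) + q * (n * eta ^+ 2 * G) + M) ->
  dy <= 13 * (gamma * h) + 7 * (gamma * (gamma * (C * z))) + 16 * N + 7 * M.
Proof.
move=> G0 hec /state_term_le ht /next_state_term_le hh' /(drift_term_le G0) hG.
have g2e : gamma ^+ 2 * ec <= gamma * (gamma * (C * z)).
  by rewrite mulrA -expr2 ler_wpM2l// sqr_ge0.
have := N_ge0; have := M_ge0; have := gh_ge0; have := ggCz_ge0; move: ht hh' hG g2e.
move: (gamma ^+ 2 * t1) (gamma ^+ 2 * ec) (q * h') (q * (n * eta ^+ 2 * G)).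
move: (gamma * h) (gamma * (gamma * (C * z))) => a b c1 c2 c3 c4.
lra.
Qed.

(** The condition [alpha * (C + 1) <= 1 / 4] lets the shift [alpha] towards the
    target dominate the variance [alpha ^+ 2 * C] of the compressed update. *)
Lemma contraction_le (zz ec : R) :
  zz <= (1 - alpha) ^+ 2 * z + alpha ^+ 2 * ec -> ec <= C * z ->
  (1 + alpha / 2) * zz <= (1 - 5 / 4 * alpha) * z.
Proof.
move=> hzz hec; have a0 := alpha_gt0.
have c2 : zz <= (1 - 7 / 4 * alpha) * z.
  apply: le_trans hzz _.
  have := ler_wpM2l (sqr_ge0 alpha) hec.
  have := ler_wpM2r z_ge0 (ler_wpM2l (ltW alpha_gt0) alphaC).
  have -> : alpha * (alpha * (C + 1)) * z = alpha ^+ 2 * (C * z) + alpha ^+ 2 * z by ring.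
  have -> : (1 - alpha) ^+ 2 * z = z - 2 * (alpha * z) + alpha ^+ 2 * z by ring.
  have -> : (1 - 7 / 4 * alpha) * z = z - 7 / 4 * (alpha * z) by field.
  lra.
have a1 : 0 <= 1 + alpha / 2 by lra.
apply: le_trans (ler_wpM2l a1 c2) _; rewrite mulrA ler_wpM2r//.
have -> : (1 + alpha / 2) * (1 - 7 / 4 * alpha) =
  1 - 5 / 4 * alpha - 7 / 8 * alpha ^+ 2 by field.
by have := sqr_ge0 alpha; lra.
Qed.

Lemma weighted_error_le :
  alpha^-1 * (gamma * (gamma * (C * z))) <= alpha * z / (128 * 124).
Proof.
have aV : 0 <= alpha^-1 by rewrite invr_ge0 ltW.
have h1 : (128 * 124) * (gamma * C) * (gamma * z) <= alpha ^+ 2 * z.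
  have gz : gamma * z <= z by rewrite ler_piMl//; have := gamma_le; lra.
  have g0 : 0 <= (128 * 124) * (gamma * C).
    by apply: mulr_ge0; [exact: mulr_ge0|rewrite mulr_ge0// ltW].
  exact: le_trans (ler_wpM2l g0 gz) (ler_wpM2r z_ge0 gC).
rewrite ler_pdivlMr ?mulr_gt0//.
have -> : alpha * z = alpha^-1 * (alpha ^+ 2 * z) by field; rewrite gt_eqF.
apply: le_trans (ler_wpM2l aV h1).
by rewrite le_eqVlt; apply/orP; left; apply/eqP; ring.
Qed.

(** One contraction of the residual [y - H] by the compressed update, followed by
    the displacement of [y], which Young's inequality multiplies by about
    [alpha^-1]. *)
Lemma residual_recursion (zz dy z' ec h' G t1 : R) : 0 <= G ->
  zz <= (1 - alpha) ^+ 2 * z + alpha ^+ 2 * ec ->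
  ec <= C * z ->
  z' <= (1 + alpha / 2) * zz + (1 + 2 / alpha) * dy ->
  t1 <= 3 * (2 * h + (2 * N + 4 * (q * h))) ->
  h' <= (1 - rho / 3) * h + gamma * (C * z) + 3 * N + M / 8 ->
  G <= 4 * m + 8 * (L ^+ 2 / n * h) + 2 * sig2 ->
  dy <= 6 * (gamma ^+ 2 * t1 + gamma ^+ 2 * ec + gamma * h +
             (2 * N + 4 * (q * h')) + q * (n * eta ^+ 2 * G) + M) ->
  z' <= (1 - alpha) * z + 30 * (gamma / alpha * h) + 41 / alpha * (N + M).
Proof.
move=> G0 hzz hec /le_trans + ht hh' hG /(displacement_le G0 hec ht hh' hG) hdy; apply.
clear G0 ht hh' hG.
set B := 13 * (gamma * h) + _ + _ + _ in hdy.
have B0 : 0 <= B.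
  have := N_ge0; have := M_ge0; have := gh_ge0; have := ggCz_ge0.
  by rewrite /B; lra.
have aV : 0 < alpha^-1 by rewrite invr_gt0.
have a4 : alpha <= 1 / 4.
  by apply: le_trans alphaC; rewrite ler_peMr ?(ltW alpha_gt0)// lerDr ltW.
have c0 : 0 <= 1 + 2 / alpha by rewrite addr_ge0// divr_ge0// ltW.
have c1 : 1 + 2 / alpha <= 9 / 4 / alpha.
  have : 4 <= alpha^-1 by rewrite -[leLHS]invrK lef_pV2 ?posrE ?invr_gt0// -div1r.
  by lra.
apply: le_trans (lerD (contraction_le hzz hec)
  (le_trans (ler_wpM2l c0 hdy) (ler_wpM2r B0 c1))) _.
clear hzz hec hdy.
have w := weighted_error_le.
have az0 : 0 <= alpha * z by rewrite mulr_ge0// ltW.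
have gah0 : 0 <= gamma / alpha * h by rewrite mulr_ge0// divr_ge0// ltW.
have aN : 0 <= alpha^-1 * N by rewrite mulr_ge0 ?N_ge0// ltW.
have aM : 0 <= alpha^-1 * M by rewrite mulr_ge0 ?M_ge0// ltW.
have -> : 9 / 4 / alpha * B = 117 / 4 * (gamma / alpha * h)
   + 63 / 4 * (alpha^-1 * (gamma * (gamma * (C * z))))
   + 36 * (alpha^-1 * N) + 63 / 4 * (alpha^-1 * M) by rewrite /B; field; rewrite gt_eqF.
have -> : (1 - 5 / 4 * alpha) * z = z - 5 / 4 * (alpha * z) by field.
have -> : (1 - alpha) * z = z - alpha * z by ring.
have -> : 41 / alpha * (N + M) = 41 * (alpha^-1 * N) + 41 * (alpha^-1 * M) by ring.
move: w az0 gah0 aN aM; move: (alpha^-1 * (gamma * (gamma * (C * z)))) (alpha * z).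
move: (gamma / alpha * h) (alpha^-1 * N) (alpha^-1 * M) => t1' t2 t3 t4 t5.
lra.
Qed.

(** The compression error enters [h] with weight [gamma C] and decays at rate
    [alpha], so weight [2 gamma C / alpha] makes the sum decrease. *)
Lemma lyapunov_step (h' z' : R) :
  h' <= (1 - rho / 3) * h + gamma * (C * z) + 3 * N + M / 8 ->
  z' <= (1 - alpha) * z + 30 * (gamma / alpha * h) + 41 / alpha * (N + M) ->
  h' + 2 * gamma * C / alpha * z' <=
  h + 2 * gamma * C / alpha * z - 3 / 10 * (rho * h) + 31 / 10 * N + 14 / 100 * M.
Proof.
have h0 := h_ge0; have z0 := z_ge0; have rho0 := rho_gt0.
move=> hh' hz'; have N0 := N_ge0; have M0 := M_ge0.
have beta0 : 0 <= 2 * gamma * C / alpha by rewrite divr_ge0 ?mulr_ge0 ?ltW.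
have gCz0 : 0 <= gamma * (C * z) by rewrite !mulr_ge0// ltW.
have e1 := ler_wpM2l beta0 hz'.
have a2V : 0 < alpha ^- 2 by rewrite invr_gt0 exprn_gt0.
have k1 : (128 * 124) * (gamma * C / alpha ^+ 2) <= 1.
  by rewrite mulrA ler_pdivrMr ?exprn_gt0// mul1r; exact: gC.
have k2 : (128 * 124) * (gamma * (gamma * C) / alpha ^+ 2) <= 2 * rho.
  by rewrite mulrA ler_pdivrMr ?exprn_gt0// [leRHS]mulrC; exact: gC2.
have k3 := ler_wpM2r h_ge0 k2.
have NM0 : 0 <= N + M by rewrite addr_ge0.
have k4 := ler_wpM2r NM0 k1.
have rh : 0 <= rho * h by rewrite mulr_ge0// ltW.
move: e1.
have -> : 2 * gamma * C / alpha * ((1 - alpha) * z + 30 * (gamma / alpha * h) + 41 / alpha * (N + M))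
  = 2 * gamma * C / alpha * z - 2 * (gamma * (C * z))
    + 60 * (gamma * (gamma * C) / alpha ^+ 2 * h)
    + 82 * (gamma * C / alpha ^+ 2 * (N + M)) by field; rewrite ?gt_eqF.
have E3 : (1 - rho / 3) * h = h - rho * h / 3 by field.
move: hh' k3 k4; rewrite E3.
lra.
Qed.

End Arithmetic.

Section Summation.
Context {R : realType}.
Variables (rho eta L n sig2 beta : R).
Hypotheses (rho_gt0 : 0 < rho) (eta_gt0 : 0 < eta) (L_gt0 : 0 < L)
  (n_gt0 : 0 < n) (sig2_ge0 : 0 <= sig2) (beta_ge0 : 0 <= beta).
Hypotheses (rho_le1 : rho <= 1 / 16) (etaL : eta * L <= rho / 16).
Variables (phi m c h z : nat -> R) (finf : R).
Hypotheses (m_ge0 : forall k, 0 <= m k) (h_ge0 : forall k, 0 <= h k)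
  (z_ge0 : forall k, 0 <= z k) (phi_ge : forall k, finf <= phi k)
  (c0_ge0 : 0 <= c 0%N).
Hypothesis descent : forall k, phi k.+1 <= phi k - eta / 2 * m k
  + eta * L ^+ 2 / (2 * n) * c k + L * eta ^+ 2 * sig2 / (2 * n).
Hypothesis ch : forall k, c k.+1 <= 2 * h k.
Hypothesis lyap : forall k, h k.+1 + beta * z k.+1 <= h k + beta * z k
  - 3 / 10 * (rho * h k) + 31 / 10 * (n * eta ^+ 2 * sig2) + 14 / 100 * (n * eta ^+ 2 * m k.+1).

Lemma sum_lyap K : 3 / 10 * rho * \sum_(k < K) h k <= h 0%N + beta * z 0%N
  + 31 / 10 * (n * eta ^+ 2 * sig2) * K%:R + 14 / 100 * (n * eta ^+ 2) * \sum_(k < K) m k.+1.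
Proof.
suff : h K + beta * z K + 3 / 10 * rho * \sum_(k < K) h k <= h 0%N + beta * z 0%N
  + 31 / 10 * (n * eta ^+ 2 * sig2) * K%:R + 14 / 100 * (n * eta ^+ 2) * \sum_(k < K) m k.+1.
  have := h_ge0 K; have := mulr_ge0 beta_ge0 (z_ge0 K); lra.
elim: K => [|K IH]; first by rewrite !big_ord0; lra.
rewrite !big_ord_recr/= -natr1; have := lyap K; lra.
Qed.

Lemma sum_descent K : eta / 2 * \sum_(k < K) m k <= phi 0%N - finf +
  eta * L ^+ 2 / (2 * n) * \sum_(k < K) c k + L * eta ^+ 2 * sig2 / (2 * n) * K%:R.
Proof.
move: descent; move: (eta / 2) (eta * L ^+ 2 / (2 * n)) (L * eta ^+ 2 * sig2 / (2 * n)).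
move=> e2 a b desc.
suff : phi K + e2 * \sum_(k < K) m k <= phi 0%N +
  a * \sum_(k < K) c k + b * K%:R.
  have := phi_ge K; lra.
elim: K => [|K IH]; first by rewrite !big_ord0; lra.
rewrite !big_ord_recr/= -natr1; have := desc K; lra.
Qed.

(** The sum of the [h k] controls the consensus error in the descent inequality; in
    return it depends on the sum of the [m k] with the small coefficient
    [(eta * L) ^+ 2 / rho], which is absorbed into the left-hand side. *)
Lemma sum_bound K : (0 < K)%N ->
  \sum_(k < K) m k <= 4 / eta * (phi 0%N - finf) + 2 * L ^+ 2 / n * c 0%N
  + 40 / 3 * (L ^+ 2 / (n * rho)) * (h 0%N + beta * z 0%N + 31 / 10 * (n * eta ^+ 2 * sig2) * K%:R)
  + 2 * L * eta * sig2 / n * K%:R.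
Proof.
case: K => // K _; have rho0 := rho_gt0; have rho1 := rho_le1.
have S0 : 0 <= \sum_(k < K.+1) m k by apply: sumr_ge0.
have hc : \sum_(k < K.+1) c k <= c 0%N + 2 * \sum_(k < K) h k.
  rewrite big_ord_recl lerD2l mulr_sumr; apply: ler_sum => k _; exact: ch.
have hm : \sum_(k < K) m k.+1 <= \sum_(k < K.+1) m k.
  by rewrite [leRHS]big_ord_recl lerDr.
have d := sum_descent K.+1.
have l := sum_lyap K.
have rV : 0 < rho^-1 by rewrite invr_gt0.
have nV : 0 < n^-1 by rewrite invr_gt0.
set Sm := \sum_(k < K.+1) m k in S0 hm d *.
set V := h 0%N + beta * z 0%N in l *.
set T := 31 / 10 * (n * eta ^+ 2 * sig2).
have T0 : 0 <= T by rewrite /T !mulr_ge0 ?sqr_ge0 ?invr_ge0 // ltW.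
have l2 : 3 / 10 * rho * \sum_(k < K) h k <= V + T * K.+1%:R + 14 / 100 * (n * eta ^+ 2) * Sm.
  apply: le_trans l _; rewrite lerD//.
    by rewrite lerD2l -/T ler_wpM2l// ler_nat.
  by rewrite ler_wpM2l// !mulr_ge0 ?sqr_ge0 ?invr_ge0 // ltW.
have w0 : 0 <= 10 / 3 * rho^-1 by rewrite mulr_ge0 ?ltW.
have l3 : \sum_(k < K) h k <= 10 / 3 * rho^-1 * (V + T * K.+1%:R + 14 / 100 * (n * eta ^+ 2) * Sm).
  apply: le_trans (ler_wpM2l w0 l2).
  by rewrite le_eqVlt; apply/orP; left; apply/eqP; field; rewrite gt_eqF.
have w1 : 0 <= eta * L ^+ 2 / (2 * n) by rewrite divr_ge0 ?mulr_ge0 ?sqr_ge0 ?ltW.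
have d2 := ler_wpM2l w1 hc.
have w2 : 0 <= eta * L ^+ 2 / (2 * n) * 2 by rewrite mulr_ge0.
have d3 := ler_wpM2l w2 l3.
have q_le : (eta * L) ^+ 2 * rho^-1 <= 1 / 4.
  have : (eta * L) ^+ 2 <= (rho / 16) ^+ 2.
    by rewrite ler_pXn2r// nnegrE; [rewrite mulr_ge0// ltW|rewrite divr_ge0// ltW].
  move=> /(ler_wpM2r (ltW rV)) /le_trans; apply.
  have -> : (rho / 16) ^+ 2 / rho = rho / 256 by field; rewrite ?gt_eqF.
  lra.
have d4 : eta / 4 * Sm <= phi 0%N - finf + eta * L ^+ 2 / (2 * n) * c 0%N
   + eta * L ^+ 2 / n * (10 / 3 * rho^-1) * (V + T * K.+1%:R)
   + L * eta ^+ 2 * sig2 / (2 * n) * K.+1%:R.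
  have e1 : eta * L ^+ 2 / (2 * n) * 2 * (10 / 3 * rho^-1 * (V + T * K.+1%:R + 14 / 100 * (n * eta ^+ 2) * Sm))
    = eta * L ^+ 2 / n * (10 / 3 * rho^-1) * (V + T * K.+1%:R) +
      14 / 30 * (((eta * L) ^+ 2 * rho^-1) * (eta * Sm)).
    by field; rewrite !gt_eqF.
  have e2 : (eta * L) ^+ 2 * rho^-1 * (eta * Sm) <= 1 / 4 * (eta * Sm).
    by rewrite ler_wpM2r// mulr_ge0// ltW.
  have e3 : 0 <= eta * Sm by rewrite mulr_ge0// ltW.
  move: d3; rewrite e1; move: d d2; rewrite mulrDr [_ * (2 * _)]mulrA; lra.
have eV : 0 <= 4 / eta by rewrite divr_ge0// ltW.
have := ler_wpM2l eV d4.
have -> : 4 / eta * (eta / 4 * Sm) = Sm by field; rewrite ?gt_eqF.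
move=> /le_trans; apply; rewrite le_eqVlt; apply/orP; left; apply/eqP.
by rewrite /T; field; rewrite !gt_eqF.
Qed.

End Summation.

(** * Moments along a run *)

Section Run.
Variables (R : realType) (n p : nat) (hn : (2 <= n)%N).
Variables (f : 'I_n -> 'rV[R]_p -> R) (L : R)
  (f_diff : forall i x, differentiable (f i) x)
  (f_inf_finite : has_lbound (range (avg_fun f)))
  (L_gt0 : 0 < L) (f_smooth : forall i, smooth L (f i)).
Variables (e : rel 'I_n) (W : 'M[R]_n) (W_network : network e W)
  (lam : n.-tuple R) (W_spectrum : spectrum W lam)
  (Q1 : 'M[R]_(n, n.-1)) (W_eigenbasis : eigenbasis W lam Q1).
Variables (eta alpha gamma C sigma : R)
  (eta_gt0 : 0 < eta) (alpha_gt0 : 0 < alpha) (gamma_gt0 : 0 < gamma)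
  (C_gt0 : 0 < C).
Variables (J P1 : 'M[R]_(n.-1 + n.-1)) (B_decomp : decomposition gamma lam J P1).
Variables (d : measure_display) (Omega : measurableType d) (P : probability Omega R)
  (dX : measure_display) (Xi : 'I_n -> measurableType dX)
  (g : forall i : 'I_n, 'rV[R]_p -> Xi i -> 'rV[R]_p).
Arguments g : clear implicits.
Variables (g_meas : forall i, jointly_measurable (g i))
  (xi : int -> forall i : 'I_n, Omega -> Xi i)
  (dZ : measure_display) (Z : measurableType dZ)
  (Cop : 'rV[R]_p -> Z -> 'rV[R]_p) (Cop_meas : jointly_measurable Cop)
  (zeta : nat -> 'I_n -> Omega -> Z)
  (FS : int -> set_system Omega) (FC : nat -> set_system Omega)
  (F_history : history xi zeta FS FC).
Variables (x_m1 H_0 : 'M[R]_(n, p)) (x : int -> Omega -> 'M[R]_(n, p))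
  (y D H Q : nat -> Omega -> 'M[R]_(n, p))
  (run : cedas g Cop xi zeta W (fun=> eta) alpha gamma x_m1 H_0 x y D H Q)
  (g_unbiased : stoch_grad_assumption g xi P f sigma FS x)
  (Cop_unbiased : compressor_assumption Cop zeta P C FC y H).
Hypotheses (gamma_le2 : gamma <= 1 / 2) (lam2_lt1 : lam`_1 < 1).

Notation L1 := (is_L1 P).
Notation Ex := (expect P).
Notation L2 := (is_L2 P).
Notation mL2 := (mx_L2 P).
Notation mcentered := (mx_centered P).
Notation rho := (spectral_gap lam gamma).

(** [gbar] is the gradient matrix at the average iterate, [cerr] the error made by
    the compressor. *)
Definition noise k w := stoch_grad g xi x k w - gradF f (x k w).
Definition gbar k w : 'M[R]_(n, p) := gradF f (consensus (mean_row (x k w))).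
Definition cerr k w := Q k w - (y k w - H k w).
(** The transformed pair of disagreement and tracking variable, on which one step
    of the algorithm is a contraction up to perturbations. *)
Definition hstate (k : nat) w := check_h gamma lam Q1 J (x k w) (D k w + eta *: gbar k w).

Let n_gt0 : (0 < n)%N. Proof. exact: ltnW. Qed.

Let sFS k : -1 <= k -> sub_sigma_algebra_of (FS k).
Proof. exact: (FS_sub F_history). Qed.
Let sFC k : sub_sigma_algebra_of (FC k).
Proof. exact: (FC_sub F_history). Qed.
Let natm1 (k : nat) : (-1 : int) <= k. Proof. by []. Qed.

Section OneSample.
Variables (k : int) (k_ge : -1 <= k).

Let AB i : is_condexp_vec P (FS k) (fun w => row i (stoch_grad g xi x k w))
  (fun w => row i (gradF f (x k w))).
Proof.
under [X in is_condexp_vec _ _ _ X]eq_fun do rewrite rowK.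
by case: (g_unbiased k_ge) => _ /(_ i)[].
Qed.

Let ABle i : condexp_le P (FS k)
  (fun w => enorm (row i (stoch_grad g xi x k w) - row i (gradF f (x k w))) ^+ 2)
  (fun=> sigma ^+ 2).
Proof.
under [X in condexp_le _ _ X _]eq_fun do rewrite [row i (gradF _ _)]rowK.
by case: (g_unbiased k_ge) => _ /(_ i)[].
Qed.

Let hs (i : 'I_n) : L1 (fun=> sigma ^+ 2). Proof. exact: L1_cst. Qed.

Lemma noise_L2 : mL2 (noise k).
Proof. exact: (rows_L2 (sFS k_ge) AB ABle hs). Qed.

Lemma noise_centered : mcentered (FS k) (noise k).
Proof. exact: (rows_centered (sFS k_ge) AB). Qed.

Lemma noise_total : Ex (fun w => nrm2 (noise k w)) <= n%:R * sigma ^+ 2.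
Proof.
apply: le_trans (rows_total (sFS k_ge) AB ABle hs) _.
by rewrite Ex_cst sumr_const card_ord mulr_natl.
Qed.

(** Independence across agents turns the variance of the average into
    [sigma ^+ 2 / n]; the recursions need only the cruder [noise_total]. *)
Lemma noise_mean (xi_meas' : forall i, measurable_fun setT (xi k i)) : mmeas (FS k) (x k) ->
  Ex (fun w => nrm2 (mean_row (noise k w))) <= sigma ^+ 2 / n%:R.
Proof.
move=> mx; apply: (rows_mean (sFS k_ge) AB ABle hs n_gt0) => [i|i j ij].
  by rewrite Ex_cst.
have [ind _] := g_unbiased k_ge.
apply: (noise_orth (sFS k_ge) g_meas xi_meas' ind mx _ noise_L2 noise_centered ij).
exact: (mmeas_gradF L_gt0 f_smooth (sFS k_ge) mx).
Qed.

Lemma grad_meas F' : sub_sigma_algebra_of F' -> FS k `<=` F' ->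
  (forall i, measurable_wrt F' (xi k i)) -> mmeas (FS k) (x k) ->
  mmeas F' (stoch_grad g xi x k).
Proof.
move=> sF FF mxi mx; apply: mmeas_rows => i a l; rewrite (ord1 a).
under eq_fun do rewrite rowK.
apply/(measurable_wrtP sF).
apply: (jointly_measurable_comp (T := g_sigma_algebraType F')) => //.
  move=> l'; apply/(measurable_wrtP sF).
  by apply: mmeas_row; exact: mmeas_sub FF mx.
exact/(measurable_wrtP sF).
Qed.

Lemma grad_L2 : mL2 (x k) -> mL2 (stoch_grad g xi x k).
Proof.
move=> hx; have -> : stoch_grad g xi x k = fun w => noise k w + gradF f (x k w).
  by apply/funext => w; rewrite subrK.
by apply: mL2D; [exact: noise_L2|exact: (mL2_gradF L_gt0 f_smooth hx)].
Qed.

End OneSample.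

Section OneCompression.
Variables (k : nat) (hyH : mL2 (fun w => y k w - H k w)).

Let AB i : is_condexp_vec P (FC k) (fun w => row i (Q k w))
  (fun w => row i (y k w - H k w)).
Proof.
under [X in is_condexp_vec _ _ X _]eq_fun do rewrite (cedas_Q run) rowK.
by case: (Cop_unbiased k i) => _ [].
Qed.

Let ABle i : condexp_le P (FC k)
  (fun w => enorm (row i (Q k w) - row i (y k w - H k w)) ^+ 2)
  (fun w => C * enorm (row i (y k w - H k w)) ^+ 2).
Proof.
under [X in condexp_le _ _ X _]eq_fun do rewrite (cedas_Q run) rowK.
by case: (Cop_unbiased k i) => _ [].
Qed.

Let hZ (i : 'I_n) : L1 (fun w => C * enorm (row i (y k w - H k w)) ^+ 2).
Proof.
by apply: L1Z; under eq_fun do rewrite nrm2E; apply: mL2_nrm2; exact: mL2_row.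
Qed.

Lemma cerr_L2 : mL2 (cerr k).
Proof. exact: (rows_L2 (sFC k) AB ABle hZ). Qed.

Lemma cerr_centered : mcentered (FC k) (cerr k).
Proof. exact: (rows_centered (sFC k) AB). Qed.

Lemma cerr_total :
  Ex (fun w => nrm2 (cerr k w)) <= C * Ex (fun w => nrm2 (y k w - H k w)).
Proof.
apply: le_trans (rows_total (sFC k) AB ABle hZ) _.
have hr i : L1 (fun w => nrm2 (row i (y k w - H k w))) by apply: mL2_nrm2; exact: mL2_row.
under [X in _ <= _ * Ex X]eq_fun do rewrite nrm2_rows.
rewrite Ex_sum// mulr_sumr; apply: ler_sum => i _.
by under [X in Ex X <= _]eq_fun do rewrite nrm2E; rewrite ExZ.
Qed.

Lemma Q_L2 : mL2 (Q k).
Proof.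
have -> : Q k = fun w => cerr k w + (y k w - H k w).
  by apply/funext => w; rewrite subrK.
by apply: mL2D => //; exact: cerr_L2.
Qed.

Lemma Q_meas : mmeas (FC k) (fun w => y k w - H k w) -> mmeas (FS k.+1) (Q k).
Proof.
move=> myH; apply: mmeas_rows => i a l; rewrite (ord1 a).
have sF := sFS (natm1 k.+1).
under eq_fun do rewrite (cedas_Q run) rowK.
apply/(measurable_wrtP sF).
apply: (jointly_measurable_comp (T := g_sigma_algebraType (FS k.+1))) => //.
  move=> l'; apply/(measurable_wrtP sF).
  by apply: mmeas_row; apply: mmeas_sub myH; exact: (FC_FS F_history).
by apply/(measurable_wrtP sF); exact: (zeta_meas F_history).
Qed.

End OneCompression.

Lemma xi_measurable (k : int) : -1 <= k -> forall i, measurable_fun setT (xi k i).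
Proof.
move=> k1 i; case: k k1 => [k|[|k]] //= _.
  by apply: (measurable_wrt_meas (sFC k)); exact: (xi_meas F_history).
apply: (measurable_wrt_meas (sFS (natm1 0))); exact: (xi_m1_meas F_history).
Qed.

(** The invariant that makes every expectation below finite and every
    orthogonality applicable; the last clause keeps [D] free of consensus part. *)
Record good_state (k : nat) : Prop := GoodState {
  x_meas : mmeas (FS k) (x k); D_meas : mmeas (FS k) (D k); H_meas : mmeas (FS k) (H k);
  x_L2 : mL2 (x k); D_L2 : mL2 (D k); H_L2 : mL2 (H k);
  D_range : forall w, Q1 *m (Q1^T *m D k w) = D k w }.

Section AfterState.
Variables (k : nat) (gk : good_state k).

Lemma G_meas : mmeas (FC k) (stoch_grad g xi x k).
Proof.
apply: (grad_meas (sFC k)); last exact: x_meas gk.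
  exact: (FS_FC F_history).
exact: (xi_meas F_history).
Qed.

Lemma G_L2 : mL2 (stoch_grad g xi x k).
Proof. by apply: grad_L2 => //; exact: x_L2. Qed.

Lemma y_meas : mmeas (FC k) (y k).
Proof.
have -> : y k = fun w => x k w - eta *: stoch_grad g xi x k w - D k w.
  by apply/funext => w; rewrite (cedas_y run).
have FF := FS_FC F_history (k := k).
apply: (mmeasB (sFC k)); last exact: mmeas_sub FF (D_meas gk).
apply: (mmeasB (sFC k)); first exact: mmeas_sub FF (x_meas gk).
exact: (mmeasZ (sFC k) eta G_meas).
Qed.

Lemma y_L2 : mL2 (y k).
Proof.
have -> : y k = fun w => x k w - eta *: stoch_grad g xi x k w - D k w.
  by apply/funext => w; rewrite (cedas_y run).
apply: mL2B; last exact: D_L2 gk.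
by apply: mL2B; [exact: x_L2 gk|apply: mL2Z; exact: G_L2].
Qed.

Lemma yH_L2 : mL2 (fun w => y k w - H k w).
Proof. by apply: mL2B; [exact: y_L2|exact: H_L2 gk]. Qed.

Lemma yH_meas : mmeas (FC k) (fun w => y k w - H k w).
Proof.
apply: (mmeasB (sFC k) y_meas); apply: mmeas_sub (H_meas gk).
exact: (FS_FC F_history).
Qed.

(* the three updates in the form used for the analysis of one step *)
Lemma DE w : D k.+1 w = D k w + (gamma / 2) *: ((1%:M - W) *m (y k w + cerr k w)).
Proof.
rewrite (cedas_D run); congr (_ + _ *: (_ *m _)); rewrite /cerr.
by apply/matrixP => i j; rewrite !mxE; ring.
Qed.

Lemma yE w : y k w = x k w - eta *: stoch_grad g xi x k w - D k w.
Proof. by rewrite (cedas_y run). Qed.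

Lemma xE w : x k.+1 w = x k w - eta *: stoch_grad g xi x k w - D k.+1 w.
Proof. by rewrite (cedas_x run). Qed.

Lemma good_next : good_state k.+1.
Proof.
have sF := sFS (natm1 k.+1).
have FF : FC k `<=` FS k.+1 := FC_FS F_history (k := k).
have FSS : FS k `<=` FS k.+1 by move=> S /(FS_FC F_history) /FF.
have mQ := Q_meas yH_meas; have hQ := Q_L2 yH_L2.
have mH' := mmeas_sub FSS (H_meas gk).
have mD : mmeas (FS k.+1) (D k.+1).
  have -> : D k.+1 = fun w => D k w + (gamma / 2) *: ((1%:M - W) *m (H k w + Q k w)).
    by apply/funext => w; rewrite (cedas_D run).
  apply: (mmeasD sF (mmeas_sub FSS (D_meas gk))); apply: (mmeasZ sF).
  by apply: (mmeas_mulmx sF); exact: (mmeasD sF mH' mQ).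
have hD : mL2 (D k.+1).
  have -> : D k.+1 = fun w => D k w + (gamma / 2) *: ((1%:M - W) *m (H k w + Q k w)).
    by apply/funext => w; rewrite (cedas_D run).
  apply: mL2D; first exact: D_L2 gk.
  by apply: mL2Z; apply: mL2_mulmx; apply: mL2D; [exact: H_L2 gk|].
split=> //.
- have -> : x k.+1 = fun w => x k w - eta *: stoch_grad g xi x k w - D k.+1 w.
    by apply/funext => w; rewrite xE.
  apply: (mmeasB sF) mD; apply: (mmeasB sF); first exact: mmeas_sub FSS (x_meas gk).
  by apply: (mmeasZ sF); exact: mmeas_sub FF G_meas.
- have -> : H k.+1 = fun w => H k w + alpha *: Q k w.
    by apply/funext => w; rewrite (cedas_H run).
  by apply: (mmeasD sF) => //; exact: (mmeasZ sF).
- have -> : x k.+1 = fun w => x k w - eta *: stoch_grad g xi x k w - D k.+1 w.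
    by apply/funext => w; rewrite xE.
  apply: mL2B => //; apply: mL2B; first exact: x_L2 gk.
  by apply: mL2Z; exact: G_L2.
- have -> : H k.+1 = fun w => H k w + alpha *: Q k w.
    by apply/funext => w; rewrite (cedas_H run).
  by apply: mL2D; [exact: H_L2 gk|exact: mL2Z].
- move=> w; exact: (D_step hn W_network W_spectrum W_eigenbasis gamma_gt0 gamma_le2 lam2_lt1
    (DE w) (D_range gk w)).
Qed.

Lemma mean_next w :
  mean_row (x k.+1 w) = mean_row (x k w) - eta *: mean_row (stoch_grad g xi x k w).
Proof.
exact: (mean_step hn W_network W_spectrum W_eigenbasis gamma_gt0 gamma_le2 lam2_lt1
  (DE w) (xE w) (D_range gk w)).
Qed.

Lemma gbar_L2 : mL2 (gbar k).
Proof.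
apply: (mL2_gradF L_gt0 f_smooth).
by apply: mL2_consensus; apply: mL2_mean; exact: x_L2 gk.
Qed.

Lemma gF_L2 : mL2 (fun w => gradF f (x k w)).
Proof. exact: (mL2_gradF L_gt0 f_smooth (x_L2 gk)). Qed.

Lemma gbar_meas : mmeas (FS k) (gbar k).
Proof.
have sF := sFS (natm1 k).
apply: (mmeas_gradF L_gt0 f_smooth sF).
by apply: (mmeas_mulmx sF); apply: (mmeas_mean sF); exact: x_meas gk.
Qed.

Lemma hstateE : hstate k = fun w => invmx J *m col_mx (Q1^T *m x k w)
  (Sinv lam gamma *m (Q1^T *m (D k w + eta *: gbar k w))).
Proof.
apply/funext => w.
exact: (check_hE hn W_network W_spectrum W_eigenbasis gamma_gt0 gamma_le2 lam2_lt1).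
Qed.

Lemma hstate_L2 : mL2 (hstate k).
Proof.
rewrite hstateE; apply: mL2_mulmx; apply: mL2_col; apply: mL2_mulmx; first exact: x_L2 gk.
by apply: mL2_mulmx; apply: mL2D; [exact: D_L2 gk|apply: mL2Z; exact: gbar_L2].
Qed.

Lemma hstate_meas : mmeas (FS k) (hstate k).
Proof.
have sF := sFS (natm1 k).
rewrite hstateE; apply: (mmeas_mulmx sF); apply: mmeas_col.
  by apply: (mmeas_mulmx sF); exact: x_meas gk.
do 2 apply: (mmeas_mulmx sF); apply: (mmeasD sF); first exact: D_meas gk.
by apply: (mmeasZ sF); exact: gbar_meas.
Qed.

Lemma mean_gbar w : mean_row (gbar k w) = grad (avg_fun f) (mean_row (x k w)).
Proof. by rewrite grad_avg. Qed.

Lemma consensus_le w : nrm2 (Q1^T *m x k w) <= 2 * nrm2 (hstate k w).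
Proof.
apply: le_trans _ (check_h_bounds hn W_network W_spectrum W_eigenbasis gamma_gt0
  gamma_le2 lam2_lt1 B_decomp _ _).
by rewrite lerDl nrm2_ge0.
Qed.

Lemma gF_gbar w : nrm2 (gradF f (x k w) - gbar k w) <= L ^+ 2 * nrm2 (Q1^T *m x k w).
Proof.
rewrite -(nrm2_consensus_error hn W_eigenbasis).
exact: (nrm2_gradF (ltW L_gt0) f_smooth).
Qed.

(** The average moves by the averaged stochastic gradient, whatever the
    compression does. *)
Lemma gbar_drift w : nrm2 (gbar k.+1 w - gbar k w) <=
  L ^+ 2 * (n%:R * (eta ^+ 2 * nrm2 (mean_row (stoch_grad g xi x k w)))).
Proof.
apply: le_trans (nrm2_gradF (ltW L_gt0) f_smooth _ _) _.
rewrite ler_wpM2l ?sqr_ge0// mean_next /consensus -mulmxBr -/(consensus _).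
by rewrite nrm2_consensus addrC addKr nrm2N nrm2Z.
Qed.

Lemma noise_gap w : nrm2 (eta *: (stoch_grad g xi x k w - gbar k w)) <=
  2 * (eta ^+ 2 * nrm2 (noise k w)) + 4 * ((eta * L) ^+ 2 * nrm2 (hstate k w)).
Proof.
apply: le_trans (nrm2Z_split _ _ _ (gradF f (x k w))) _; rewrite lerD2l.
have h1 : nrm2 (gradF f (x k w) - gbar k w) <= L ^+ 2 * (2 * nrm2 (hstate k w)).
  by apply: le_trans (gF_gbar w) _; rewrite ler_wpM2l ?sqr_ge0// consensus_le.
apply: le_trans (ler_wpM2l _ (ler_wpM2l (sqr_ge0 eta) h1)) _ => //.
by rewrite exprMn le_eqVlt; apply/orP; left; apply/eqP; ring.
Qed.

Definition hstate_moment := Ex (fun w => nrm2 (hstate k w)).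
Definition residual_moment := Ex (fun w => nrm2 (y k w - H k w)).
Definition grad_moment := Ex (fun w => nrm2 (grad (avg_fun f) (mean_row (x k w)))).
Definition step_moment := Ex (fun w => nrm2 (mean_row (stoch_grad g xi x k w))).

Lemma grad_L1 : L1 (fun w => nrm2 (grad (avg_fun f) (mean_row (x k w)))).
Proof.
under eq_fun do rewrite -mean_gbar.
by apply: mL2_nrm2; apply: mL2_mean; exact: gbar_L2.
Qed.

Lemma meanG_L1 : L1 (fun w => nrm2 (mean_row (stoch_grad g xi x k w))).
Proof. by apply: mL2_nrm2; apply: mL2_mean; exact: G_L2. Qed.

Lemma hstate_L1 : L1 (fun w => nrm2 (hstate k w)).
Proof. by apply: mL2_nrm2; exact: hstate_L2. Qed.

Lemma noise_L1 : L1 (fun w => nrm2 (noise k w)).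
Proof. by apply: mL2_nrm2; apply: noise_L2. Qed.

Lemma step_moment_le : step_moment <=
  4 * grad_moment + 8 * (L ^+ 2 / n%:R * hstate_moment) + 2 * sigma ^+ 2.
Proof.
have nV : 0 <= (n%:R : R)^-1 by rewrite invr_ge0.
have pw w : nrm2 (mean_row (stoch_grad g xi x k w)) <=
    4 * nrm2 (grad (avg_fun f) (mean_row (x k w))) +
    (8 * (L ^+ 2 / n%:R)) * nrm2 (hstate k w) + 2 * (n%:R^-1 * nrm2 (noise k w)).
  apply: le_trans (nrm2_mean_split _ (gbar k w) (gradF f (x k w))) _.
  rewrite mean_gbar lerD2r lerD2l.
  have h1 : nrm2 (gradF f (x k w) - gbar k w) <= L ^+ 2 * (2 * nrm2 (hstate k w)).
    by apply: le_trans (gF_gbar w) _; rewrite ler_wpM2l ?sqr_ge0// consensus_le.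
  apply: le_trans (ler_wpM2l _ (ler_wpM2l nV h1)) _ => //.
  by rewrite le_eqVlt; apply/orP; left; apply/eqP; ring.
have i1 := L1Z 4 grad_L1; have i2 := L1Z (8 * (L ^+ 2 / n%:R)) hstate_L1.
have i3 := L1Z 2 (L1Z n%:R^-1 noise_L1).
apply: le_trans (Ex_le meanG_L1 (L1D (L1D i1 i2) i3) pw) _.
rewrite (ExD (L1D i1 i2) i3) (ExD i1 i2) (ExZ _ grad_L1) (ExZ _ hstate_L1).
rewrite (ExZ _ (L1Z _ noise_L1)) (ExZ _ noise_L1) -/grad_moment -/hstate_moment.
rewrite -!mulrA lerD2l ler_wpM2l//.
have := noise_total (natm1 k) => h.
apply: le_trans (ler_wpM2l nV h) _.
by rewrite mulKf// pnatr_eq0 -lt0n.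
Qed.

End AfterState.

Section Recursion.
Variables (k : nat) (gk : good_state k).
Let gk1 := good_next gk.
Hypothesis etaL : eta * L <= rho / 16.
Let rho0 : 0 < rho. Proof. exact: gap_gt0. Qed.

(** The next state is the past part, minus the gradient noise, plus the drift of
    the average, plus the compression error. The last term is orthogonal to the
    others. The noise is orthogonal to the past part but not to the drift, which
    is therefore split off by Young's inequality. *)
Lemma hstate_moment_step : exists u b nn c,
  [/\ u <= (1 - 7 / 10 * rho) * hstate_moment k,
   b <= rho^-1 * ((eta * L) ^+ 2 * (n%:R * eta ^+ 2 * step_moment k)),
   nn <= n%:R * eta ^+ 2 * sigma ^+ 2, c <= gamma * (C * residual_moment k) &
   hstate_moment k.+1 <= (1 + rho / 4) * u + (2 + 4 / rho) * b + 2 * nn + c].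
Proof.
pose U w := past_part lam Q1 gamma J P1 eta (x k w) (D k w) (gbar k w) (gradF f (x k w)).
pose Nz w := noise_mx lam Q1 gamma J eta *m noise k w.
pose Dr w := drift_part lam Q1 gamma J eta (gbar k w) (gbar k.+1 w).
pose Cm w := comp_mx lam Q1 gamma J *m cerr k w.
have sF := sFS (natm1 k); have sC := sFC k.
have FF : FS k `<=` FC k := FS_FC F_history (k := k).
have hU : mL2 U.
  apply: mL2B; apply: mL2_mulmx; first exact: hstate_L2.
  by do 2 apply: mL2_mulmx; apply: mL2Z; apply: mL2B; [exact: gF_L2|exact: gbar_L2].
have mU : mmeas (FS k) U.
  apply: (mmeasB sF); apply: (mmeas_mulmx sF); first exact: hstate_meas.
  do 2 apply: (mmeas_mulmx sF); apply: (mmeasZ sF); apply: (mmeasB sF).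
    exact: (mmeas_gradF L_gt0 f_smooth sF (x_meas gk)).
  exact: gbar_meas.
have hN : mL2 Nz by apply: mL2_mulmx; exact: noise_L2.
have cN : mcentered (FS k) Nz by apply: (mcentered_mulmx sF); exact: noise_centered.
have hDr : mL2 Dr.
  apply: mL2_mulmx; apply: mL2_col; first exact: mL2_cst.
  by do 2 apply: mL2_mulmx; apply: mL2Z; apply: mL2B; apply: gbar_L2.
have hC : mL2 Cm by apply: mL2_mulmx; apply: cerr_L2; exact: yH_L2.
have cC : mcentered (FC k) Cm by apply: (mcentered_mulmx sC); exact: cerr_centered.
have xk1_meas : mmeas (FC k) (fun w => mean_row (x k.+1 w)).
  under eq_fun do rewrite mean_next//.
  apply: (mmeasB sC); first by apply: (mmeas_mean sC); exact: mmeas_sub FF (x_meas gk).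
  by apply: (mmeasZ sC); apply: (mmeas_mean sC); exact: G_meas.
have mDr : mmeas (FC k) Dr.
  apply: (mmeas_mulmx sC); apply: mmeas_col; first exact: (mmeas_cst sC).
  do 2 apply: (mmeas_mulmx sC); apply: (mmeasZ sC); apply: (mmeasB sC).
    by apply: (mmeas_gradF L_gt0 f_smooth sC); exact: (mmeas_mulmx sC).
  exact: mmeas_sub FF (gbar_meas gk).
have mN : mmeas (FC k) Nz.
  apply: (mmeas_mulmx sC); apply: (mmeasB sC); first exact: G_meas.
  apply: (mmeas_gradF L_gt0 f_smooth sC); exact: mmeas_sub FF (x_meas gk).
have hUND : mL2 (fun w => U w - Nz w + Dr w) by apply: mL2D => //; exact: mL2B.
have mUND : mmeas (FC k) (fun w => U w - Nz w + Dr w).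
  by apply: (mmeasD sC) => //; apply: (mmeasB sC) => //; exact: mmeas_sub FF mU.
have E1 : hstate_moment k.+1 = Ex (fun w => nrm2 (U w - Nz w + Dr w)) + Ex (fun w => nrm2 (Cm w)).
  rewrite -Ex_nrm2D//; last exact: (mcentered_dot sC).
  congr expect; apply/funext => w; congr nrm2.
  exact: (check_h_split hn W_network W_spectrum W_eigenbasis gamma_gt0 gamma_le2 lam2_lt1
    B_decomp (gbar k w) (gbar k.+1 w) (yE k w) (DE k w) (xE k w) (gradF f (x k w))).
have t0 : 0 < rho / 4 by rewrite divr_gt0.
have UN0 : Ex (fun w => dotm (U w) (Nz w)) = 0 by exact: (mcentered_dot sF).
exists (Ex (fun w => nrm2 (U w))), (Ex (fun w => nrm2 (Dr w))),
  (Ex (fun w => nrm2 (Nz w))), (Ex (fun w => nrm2 (Cm w))); split.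
- rewrite -ExZ; last exact: hstate_L1.
  apply: Ex_le; [exact: mL2_nrm2|by apply: L1Z; exact: hstate_L1|move=> w].
  apply: (past_part_le hn W_network W_spectrum W_eigenbasis gamma_gt0 gamma_le2 lam2_lt1
    B_decomp _ eta_gt0 L_gt0 etaL); exact: gF_gbar.
- have -> : rho^-1 * ((eta * L) ^+ 2 * (n%:R * eta ^+ 2 * step_moment k)) =
    (rho^-1 * ((eta * L) ^+ 2 * (n%:R * eta ^+ 2))) * step_moment k by ring.
  rewrite -ExZ; last exact: meanG_L1.
  apply: Ex_le; [exact: mL2_nrm2|by apply: L1Z; exact: meanG_L1|move=> w].
  apply: le_trans (drift_part_le hn W_network W_spectrum W_eigenbasis gamma_gt0 gamma_le2
    lam2_lt1 B_decomp _ _ _) _.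
  rewrite -[leRHS]mulrA ler_wpM2l ?invr_ge0 ?(ltW rho0)//.
  apply: le_trans (ler_wpM2l (sqr_ge0 _) (gbar_drift gk w)) _.
  by rewrite exprMn le_eqVlt; apply/orP; left; apply/eqP; ring.
- have -> : n%:R * eta ^+ 2 * sigma ^+ 2 = eta ^+ 2 * (n%:R * sigma ^+ 2) by ring.
  apply: le_trans _ (ler_wpM2l (sqr_ge0 eta) (noise_total (natm1 k))).
  rewrite -ExZ; last exact: noise_L1.
  apply: Ex_le; [exact: mL2_nrm2|by apply: L1Z; exact: noise_L1|move=> w].
  exact: (noise_mx_le hn W_network W_spectrum W_eigenbasis gamma_gt0 gamma_le2 lam2_lt1 B_decomp).
- apply: le_trans _ (ler_wpM2l (ltW gamma_gt0) (cerr_total (yH_L2 gk))).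
  have hc : L1 (fun w => nrm2 (cerr k w)) by apply: mL2_nrm2; apply: cerr_L2; exact: yH_L2.
  rewrite -ExZ//.
  apply: Ex_le; [exact: mL2_nrm2|exact: L1Z|move=> w].
  exact: (comp_mx_le hn W_network W_spectrum W_eigenbasis gamma_gt0 gamma_le2 lam2_lt1 B_decomp).
- rewrite E1 lerD2r.
  have hNU : L1 (fun w => nrm2 (U w)) by exact: mL2_nrm2.
  have hND : L1 (fun w => nrm2 (Dr w)) by exact: mL2_nrm2.
  have hNN : L1 (fun w => nrm2 (Nz w)) by exact: mL2_nrm2.
  have hUN : L1 (fun w => dotm (U w) (Nz w)) by exact: mL2_dot.
  have tE : 4 / rho = (rho / 4)^-1 by field; rewrite gt_eqF.
  have r1 := L1Z (1 + rho / 4) hNU; have r2 := L1Z (2 + 4 / rho) hND.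
  have r3 := L1Z 2 hNN; have r4 := L1Z 2 hUN.
  rewrite -[X in _ <= X]subr0 -[X in _ - X](mulr0 2) -UN0.
  rewrite -(ExZ _ hNU) -(ExZ _ hND) -(ExZ _ hNN) -(ExZ _ hUN).
  rewrite -(ExD r1 r2) -(ExD (L1D r1 r2) r3) -(ExB (L1D (L1D r1 r2) r3) r4).
  apply: Ex_le; [exact: mL2_nrm2|exact: (L1B (L1D (L1D r1 r2) r3) r4)|move=> w].
  by rewrite tE; exact: nrm2_three.
Qed.

Lemma Ex_noise_gap (j : nat) (gj : good_state j) :
  L1 (fun w => nrm2 (eta *: (stoch_grad g xi x j w - gbar j w))) /\
  Ex (fun w => nrm2 (eta *: (stoch_grad g xi x j w - gbar j w))) <=
  2 * (n%:R * eta ^+ 2 * sigma ^+ 2) + 4 * ((eta * L) ^+ 2 * hstate_moment j).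
Proof.
have i0 : L1 (fun w => nrm2 (eta *: (stoch_grad g xi x j w - gbar j w))).
  by apply: mL2_nrm2; apply: mL2Z; apply: mL2B; [exact: G_L2|exact: gbar_L2].
split=> //.
have i1 := L1Z (eta ^+ 2) (noise_L1 j); have i2 := L1Z ((eta * L) ^+ 2) (hstate_L1 gj).
apply: le_trans (Ex_le i0 (L1D (L1Z 2 i1) (L1Z 4 i2)) (noise_gap j)) _.
rewrite (ExD (L1Z 2 i1) (L1Z 4 i2)) (ExZ _ i1) (ExZ _ i2) (ExZ _ (noise_L1 j)).
rewrite (ExZ _ (hstate_L1 gj)) lerD2r ler_wpM2l//.
have -> : n%:R * eta ^+ 2 * sigma ^+ 2 = eta ^+ 2 * (n%:R * sigma ^+ 2) by ring.
by rewrite ler_wpM2l ?sqr_ge0// noise_total.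
Qed.

(** The compression error is orthogonal to the residual it comes from, so the
    shift [alpha] contracts the residual before [y] moves. *)
Lemma residual_moment_step : exists z1 dy ec t1,
  [/\ z1 <= (1 - alpha) ^+ 2 * residual_moment k + alpha ^+ 2 * ec,
   ec <= C * residual_moment k, residual_moment k.+1 <= (1 + alpha / 2) * z1 + (1 + 2 / alpha) * dy,
   t1 <= 3 * (2 * hstate_moment k +
     (2 * (n%:R * eta ^+ 2 * sigma ^+ 2) + 4 * ((eta * L) ^+ 2 * hstate_moment k))) &
   dy <= 6 * (gamma ^+ 2 * t1 + gamma ^+ 2 * ec + gamma * hstate_moment k +
     (2 * (n%:R * eta ^+ 2 * sigma ^+ 2) + 4 * ((eta * L) ^+ 2 * hstate_moment k.+1)) +
     (eta * L) ^+ 2 * (n%:R * eta ^+ 2 * step_moment k) + n%:R * eta ^+ 2 * grad_moment k)].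
Proof.
have sC := sFC k.
have hyH := yH_L2 gk; have he := cerr_L2 hyH.
have hz := mL2_nrm2 hyH; have hz' := mL2_nrm2 (yH_L2 gk1); have hec := mL2_nrm2 he.
pose A w := (1 - alpha) *: (y k w - H k w) + (- alpha) *: cerr k w.
have hA : mL2 A by apply: mL2D; exact: mL2Z.
have hdy : mL2 (fun w => y k.+1 w - y k w) by apply: mL2B; apply: y_L2.
have hy1 : mL2 (fun w => Q1^T *m y k w) by apply: mL2_mulmx; exact: y_L2.
exists (Ex (fun w => nrm2 (A w))), (Ex (fun w => nrm2 (y k.+1 w - y k w))),
  (Ex (fun w => nrm2 (cerr k w))), (Ex (fun w => nrm2 (Q1^T *m y k w))); split.
- rewrite Ex_nrm2D; [|exact: mL2Z..|].
    under [X in Ex X + _]eq_fun do rewrite nrm2Z.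
    under [X in _ + Ex X]eq_fun do rewrite nrm2Z sqrrN.
    by rewrite (ExZ _ hz) (ExZ _ hec).
  apply: (mcentered_dot sC); [|exact: mL2Z..|].
    by apply: (mmeasZ sC); exact: yH_meas.
  under eq_fun do rewrite -mul_scalar_mx.
  by apply: (mcentered_mulmx sC); exact: cerr_centered.
- exact: cerr_total.
- have t0 : 0 < alpha / 2 by rewrite divr_gt0.
  have hA1 := mL2_nrm2 hA; have hd1 := mL2_nrm2 hdy.
  have tE : 2 / alpha = (alpha / 2)^-1 by field; rewrite gt_eqF.
  rewrite tE -(ExZ _ hA1) -(ExZ _ hd1) -(ExD (L1Z _ hA1) (L1Z _ hd1)).
  apply: Ex_le => //; first exact: (L1D (L1Z _ hA1) (L1Z _ hd1)).
  move=> w; apply: le_trans _ (nrm2D_le (A w) (y k.+1 w - y k w) t0).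
  rewrite le_eqVlt; apply/orP; left; apply/eqP; congr nrm2.
  rewrite (cedas_H run) /A /cerr; apply/matrixP => i j; rewrite !mxE; ring.
- have [i0 hgap] := Ex_noise_gap gk.
  have i1 := L1Z 2 (hstate_L1 gk).
  apply: le_trans (Ex_le (mL2_nrm2 hy1) (L1Z 3 (L1D i1 i0)) _) _.
    move=> w; exact: (Q1y_le hn W_network W_spectrum W_eigenbasis gamma_gt0 gamma_le2
      lam2_lt1 B_decomp (gbar k w) (yE k w)).
  by rewrite (ExZ _ (L1D i1 i0)) (ExD i1 i0) (ExZ _ (hstate_L1 gk)) ler_wpM2l// lerD2l.
- have [i0 hgap] := Ex_noise_gap gk1.
  have j1 := L1Z (gamma ^+ 2) (mL2_nrm2 hy1); have j2 := L1Z (gamma ^+ 2) hec.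
  have j3 := L1Z gamma (hstate_L1 gk).
  have j5 := L1Z ((eta * L) ^+ 2 * (n%:R * eta ^+ 2)) (meanG_L1 gk).
  have j6 := L1Z (n%:R * eta ^+ 2) (grad_L1 gk).
  have j123 := L1D (L1D j1 j2) j3; have j1234 := L1D j123 i0.
  have jj := L1D (L1D j1234 j5) j6.
  have pw w : nrm2 (y k.+1 w - y k w) <= 6 * (gamma ^+ 2 * nrm2 (Q1^T *m y k w) +
      gamma ^+ 2 * nrm2 (cerr k w) + gamma * nrm2 (hstate k w) +
      nrm2 (eta *: (stoch_grad g xi x k.+1 w - gbar k.+1 w)) +
      (eta * L) ^+ 2 * (n%:R * eta ^+ 2) * nrm2 (mean_row (stoch_grad g xi x k w)) +
      n%:R * eta ^+ 2 * nrm2 (grad (avg_fun f) (mean_row (x k w)))).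
    apply: le_trans (y_step_le hn W_network W_spectrum W_eigenbasis gamma_gt0 gamma_le2
      lam2_lt1 B_decomp (gbar k w) (gbar k.+1 w) (yE k w) (DE k w) (xE k w)
      (yE k.+1 w) (D_range gk w)) _.
    rewrite ler_wpM2l// lerD//; last by rewrite mean_gbar mulrCA mulrA.
    rewrite lerD2l; apply: le_trans (ler_wpM2l (sqr_ge0 _) (gbar_drift gk w)) _.
    by rewrite exprMn le_eqVlt; apply/orP; left; apply/eqP; ring.
  apply: le_trans (Ex_le (mL2_nrm2 hdy) (L1Z 6 jj) pw) _.
  rewrite (ExZ _ jj) (ExD (L1D j1234 j5) j6) (ExD j1234 j5) (ExD j123 i0).
  rewrite (ExD (L1D j1 j2) j3) (ExD j1 j2) (ExZ _ (mL2_nrm2 hy1)) (ExZ _ hec).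
  rewrite (ExZ _ (hstate_L1 gk)) (ExZ _ (meanG_L1 gk)) (ExZ _ (grad_L1 gk)).
  rewrite ler_wpM2l// -/(hstate_moment k) -/(step_moment k) -/(grad_moment k).
  by rewrite lerD2r [_ * (_ * step_moment k)]mulrA lerD2r lerD2l.
Qed.

End Recursion.

(** The first step, from index [-1], has no compression and a deterministic
    starting point. *)
Lemma good_state0 : good_state 0.
Proof.
have sm1 := sFS (lexx (-1)); have s0 := sFS (natm1 0).
have xm1E : x (-1) = fun=> x_m1 by apply/funext => w; rewrite (cedas_xm1 run).
have mxm1 : mmeas (FS (-1)) (x (-1)) by rewrite xm1E; exact: (mmeas_cst sm1).
have hxm1 : mL2 (x (-1)) by rewrite xm1E; exact: mL2_cst.
have x0E : x 0 = fun w => x (-1) w - eta *: stoch_grad g xi x (-1) w.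
  by apply/funext => w; rewrite (cedas_x0 run).
have D0E : D 0 = fun=> 0 by apply/funext => w; rewrite (cedas_D0 run).
have H0E : H 0 = fun=> H_0 by apply/funext => w; rewrite (cedas_H0 run).
split.
- rewrite x0E; apply: (mmeasB s0); first exact: mmeas_sub (FS_m1 F_history) mxm1.
  apply: (mmeasZ s0); apply: (grad_meas s0 (FS_m1 F_history)) mxm1.
  exact: (xi_m1_meas F_history).
- by rewrite D0E; exact: (mmeas_cst s0).
- by rewrite H0E; exact: (mmeas_cst s0).
- by rewrite x0E; apply: mL2B => //; apply: mL2Z; exact: grad_L2.
- by rewrite D0E; exact: mL2_cst.
- by rewrite H0E; exact: mL2_cst.
- by move=> w; rewrite D0E !mulmx0.
Qed.

Lemma good_states k : good_state k.
Proof. by elim: k => [|k IH]; [exact: good_state0|exact: good_next]. Qed.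

(** Descent in expectation: the noise is centred, so it only contributes its
    variance, which averaging over the agents divides by [n]. *)
Lemma descent_step (k : int) (V : Omega -> 'rV[R]_p) : -1 <= k ->
  mmeas (FS k) (x k) -> mL2 (x k) -> eta * L <= 1 ->
  (forall w, V w = mean_row (x k w) - eta *: mean_row (stoch_grad g xi x k w)) ->
  Ex (fun w => avg_fun f (V w)) <= Ex (fun w => avg_fun f (mean_row (x k w)))
   - eta / 2 * Ex (fun w => nrm2 (grad (avg_fun f) (mean_row (x k w))))
   + eta * L ^+ 2 / (2 * n%:R) * Ex (fun w => nrm2 (x k w - consensus (mean_row (x k w))))
   + L * eta ^+ 2 * sigma ^+ 2 / (2 * n%:R).
Proof.
move=> k1 mx hx eL VE.
have sF := sFS k1.
pose mF w := mean_row (gradF f (x k w)).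
pose mS w := mean_row (noise k w).
pose gr w := mean_row (gradF f (consensus (mean_row (x k w)) : 'M[R]_(n, p))).
have grE w : gr w = grad (avg_fun f) (mean_row (x k w)) by rewrite grad_avg.
have hS : mL2 mS by apply: mL2_mean; exact: noise_L2.
have hF : mL2 mF by apply: mL2_mean; exact: (mL2_gradF L_gt0 f_smooth hx).
have hb : mL2 (fun w => consensus (mean_row (x k w)) : 'M[R]_(n, p)).
  by apply: mL2_consensus; exact: mL2_mean.
have hg : mL2 gr by apply: mL2_mean; exact: (mL2_gradF L_gt0 f_smooth hb).
have mgF : mmeas (FS k) mF.
  by apply: (mmeas_mean sF); exact: (mmeas_gradF L_gt0 f_smooth sF mx).
have mg : mmeas (FS k) gr.
  apply: (mmeas_mean sF); apply: (mmeas_gradF L_gt0 f_smooth sF).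
  by apply: (mmeas_mulmx sF); exact: (mmeas_mean sF).
have cS : mcentered (FS k) mS.
  have -> : mS = fun w => (n%:R^-1 *: const_mx 1 : 'rV[R]_n) *m noise k w.
    by apply/funext => w; exact: mean_rowE.
  by apply: (mcentered_mulmx sF); exact: noise_centered.
pose A w := (L * eta ^+ 2) *: mF w - eta *: gr w.
have hA : mL2 A by apply: mL2B; exact: mL2Z.
have mA : mmeas (FS k) A by apply: (mmeasB sF); exact: (mmeasZ sF).
have AS0 : Ex (fun w => dotm (A w) (mS w)) = 0 by exact: (mcentered_dot sF).
have hc : mL2 (fun w => x k w - consensus (mean_row (x k w))) by exact: mL2B.
have hV : mL2 V.
  have -> : V = fun w => mean_row (x k w) - eta *: mean_row (stoch_grad g xi x k w).
    by apply/funext.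
  by apply: mL2B; [exact: mL2_mean|apply: mL2Z; apply: mL2_mean; exact: grad_L2].
have dF z : differentiable (avg_fun f) z by exact: diff_avg.
have sA := smooth_avg n_gt0 (ltW L_gt0) f_diff f_smooth.
have pw w : avg_fun f (V w) <= avg_fun f (mean_row (x k w)) - eta / 2 * nrm2 (gr w)
    + eta * L ^+ 2 / (2 * n%:R) * nrm2 (x k w - consensus (mean_row (x k w)))
    + L * eta ^+ 2 / 2 * nrm2 (mS w) + dotm (A w) (mS w).
  have GE : mean_row (stoch_grad g xi x k w) = mF w + mS w.
    by rewrite /mS /noise mean_rowB addrC subrK.
  have hm : nrm2 (grad (avg_fun f) (mean_row (x k w)) - mF w) <=
      n%:R^-1 * (L ^+ 2 * nrm2 (x k w - consensus (mean_row (x k w)))).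
    rewrite -grE -nrm2N opprB /gr /mF -mean_rowB; apply: le_trans (nrm2_mean _) _.
    by rewrite ler_wpM2l ?invr_ge0// (nrm2_gradF (ltW L_gt0) f_smooth).
  have := inexact_descent (mS w) (ltW L_gt0) dF sA (ltW eta_gt0) eL hm.
  rewrite -GE -VE /A grE => /le_trans; apply.
  rewrite !lerD2r lerD2l le_eqVlt; apply/orP; left; apply/eqP; field.
  by rewrite pnatr_eq0 -lt0n.
have j0 : L1 (fun w => avg_fun f (mean_row (x k w))).
  by apply: (L1_avg L_gt0 f_diff f_smooth n_gt0 f_inf_finite); exact: mL2_mean.
have jV : L1 (fun w => avg_fun f (V w)) by exact: (L1_avg L_gt0 f_diff f_smooth n_gt0 f_inf_finite).
have j1 := L1Z (eta / 2) (mL2_nrm2 hg).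
have j2 := L1Z (eta * L ^+ 2 / (2 * n%:R)) (mL2_nrm2 hc).
have j3 := L1Z (L * eta ^+ 2 / 2) (mL2_nrm2 hS).
have j4 := mL2_dot hA hS.
apply: le_trans (Ex_le jV (L1D (L1D (L1D (L1B j0 j1) j2) j3) j4) pw) _.
rewrite (ExD (L1D (L1D (L1B j0 j1) j2) j3) j4) (ExD (L1D (L1B j0 j1) j2) j3).
rewrite (ExD (L1B j0 j1) j2) (ExB j0 j1) (ExZ _ (mL2_nrm2 hg)) (ExZ _ (mL2_nrm2 hc)).
rewrite (ExZ _ (mL2_nrm2 hS)) AS0 addr0.
have -> : Ex (fun w => nrm2 (gr w)) =
    Ex (fun w => nrm2 (grad (avg_fun f) (mean_row (x k w)))).
  by congr expect; apply/funext => w; rewrite grE.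
rewrite lerD2l.
have := noise_mean k1 (xi_measurable k1) mx; rewrite -/mS => hn2.
have c0 : 0 <= L * eta ^+ 2 / 2 by rewrite divr_ge0// mulr_ge0 ?sqr_ge0// ltW.
apply: le_trans (ler_wpM2l c0 hn2) _.
by rewrite le_eqVlt; apply/orP; left; apply/eqP; field; rewrite pnatr_eq0 -lt0n.
Qed.

Hypotheses (gamma_le8 : gamma <= 1 / 8) (etaL : eta * L <= rho / 16)
  (alphaC : alpha * (C + 1) <= 1 / 4)
  (gC : (128 * 124) * (gamma * C) <= alpha ^+ 2)
  (gC2 : (128 * 124) * (gamma * (gamma * C)) <= alpha ^+ 2 * (2 * rho)).

(** The sequences are indexed from 0, so index [j] stands for time [j - 1]. *)
Lemma run_bound (K : nat) : (0 < K)%N ->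
  \sum_(j < K) Ex (fun w => nrm2 (grad (avg_fun f) (mean_row (x (j%:Z - 1) w)))) <=
  4 / eta * (avg_fun f (mean_row x_m1) - inf (range (avg_fun f)))
  + 2 * L ^+ 2 / n%:R * nrm2 (x_m1 - consensus (mean_row x_m1))
  + 40 / 3 * (L ^+ 2 / (n%:R * rho)) * (hstate_moment 0 + 2 * gamma * C / alpha * residual_moment 0
      + 31 / 10 * (n%:R * eta ^+ 2 * sigma ^+ 2) * K%:R)
  + 2 * L * eta * sigma ^+ 2 / n%:R * K%:R.
Proof.
move=> K0.
have r0 : 0 < rho := gap_gt0 gamma_gt0 lam2_lt1.
have rg : rho <= gamma / 2 := gap_le hn W_network W_spectrum W_eigenbasis gamma_gt0.
have r16 : rho <= 1 / 16 by have := gamma_le8; lra.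
have nR : 0 < n%:R :> R by rewrite ltr0n.
have s0 : 0 <= sigma ^+ 2 := sqr_ge0 _.
have eL1 : eta * L <= 1 by have := etaL; lra.
have beta0 : 0 <= 2 * gamma * C / alpha.
  by rewrite divr_ge0 ?mulr_ge0 ?ltW.
pose X j := x (j%:Z - 1).
have jE (j : nat) : j.+1%:Z - 1 = j :> int by rewrite -addn1 PoszD addrK.
have XS j : X j.+1 = x j by rewrite /X jE.
pose phi j := Ex (fun w => avg_fun f (mean_row (X j w))).
pose m j := Ex (fun w => nrm2 (grad (avg_fun f) (mean_row (X j w)))).
pose c j := Ex (fun w => nrm2 (X j w - consensus (mean_row (X j w)))).
have nrm2Ex_ge0 a b (A : Omega -> 'M[R]_(a, b)) : 0 <= Ex (fun w => nrm2 (A w)).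
  by apply: Ex_ge0 => w; exact: nrm2_ge0.
have xm1E : x (-1) = fun=> x_m1 by apply/funext => w; rewrite (cedas_xm1 run).
have hX j : mL2 (X j).
  case: j => [|j]; last by rewrite XS; exact: x_L2 (good_states j).
  by rewrite /X /= xm1E; exact: mL2_cst.
have mX j : mmeas (FS (j%:Z - 1)) (X j).
  case: j => [|j].
    by rewrite /X xm1E; exact: (mmeas_cst (sFS (lexx (-1)))).
  by rewrite jE XS; exact: x_meas (good_states j).
have fL1 j : L1 (fun w => avg_fun f (mean_row (X j w))).
  by apply: (L1_avg L_gt0 f_diff f_smooth n_gt0 f_inf_finite); exact: mL2_mean.
have step j w : mean_row (X j.+1 w) =
    mean_row (X j w) - eta *: mean_row (stoch_grad g xi x (j%:Z - 1) w).
  rewrite XS; case: j => [|j].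
    by rewrite (cedas_x0 run) !mean_rowE mulmxBr -scalemxAr.
  by rewrite XS (mean_next (good_states j)) jE.
have := @sum_bound R rho eta L n%:R (sigma ^+ 2) (2 * gamma * C / alpha)
  r0 eta_gt0 L_gt0 nR s0 beta0 r16 etaL phi m c hstate_moment residual_moment (inf (range (avg_fun f))).
have m0 j : 0 <= m j by exact: nrm2Ex_ge0.
have h0 j : 0 <= hstate_moment j by exact: nrm2Ex_ge0.
have z0 j : 0 <= residual_moment j by exact: nrm2Ex_ge0.
move=> /(_ m0 h0 z0) main.
have phi0 : phi 0 = avg_fun f (mean_row x_m1).
  by rewrite /phi /X -[RHS](Ex_cst P); congr expect; apply/funext => w; rewrite (cedas_xm1 run).
have c0 : c 0 = nrm2 (x_m1 - consensus (mean_row x_m1)).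
  by rewrite /c /X -[RHS](Ex_cst P); congr expect; apply/funext => w; rewrite (cedas_xm1 run).
rewrite -phi0 -c0; apply: main => //.
- move=> j; rewrite -[leLHS](Ex_cst P); apply: Ex_le => //; first exact: L1_cst.
  by move=> w; apply: ge_inf => //; exists (mean_row (X j w)).
- move=> j; have jm : -1 <= j%:Z - 1 :> int by rewrite lerBrDr addNr.
  exact: (descent_step jm (mX j) (hX j) eL1 (step j)).
- move=> j; rewrite /c XS -ExZ; last exact: hstate_L1 (good_states j).
  apply: Ex_le.
  + by apply: mL2_nrm2; rewrite -XS; apply: mL2B => //; apply: mL2_consensus; exact: mL2_mean.
  + by apply: L1Z; exact: hstate_L1 (good_states j).
  + move=> w; rewrite (nrm2_consensus_error hn W_eigenbasis).
    exact: consensus_le.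
- move=> j; have gj := good_states j.
  have G0 : 0 <= step_moment j by exact: nrm2Ex_ge0.
  have mE : m j.+1 = grad_moment j by rewrite /m XS.
  have Gle := step_moment_le gj.
  have [u [b [nn [cc [h1 h2 h3 h4 h5]]]]] := hstate_moment_step gj etaL.
  have hs := state_recursion r0 gamma_gt0 eta_gt0 L_gt0 alpha_gt0 nR s0 rg gamma_le8 etaL
    (h0 j) (z0 j) (m0 j.+1) G0 h1 h2 h3 h4.
  rewrite mE in hs *; have {}hs := hs _ Gle h5.
  have [z1 [dy [ec [t1 [q1 q2 q3 q4 q5]]]]] := residual_moment_step gj.
  have mj : 0 <= grad_moment j by exact: nrm2Ex_ge0.
  have zs := residual_recursion r0 gamma_gt0 eta_gt0 L_gt0 alpha_gt0 C_gt0 nR s0 rg gamma_le8 etaL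
    alphaC gC (h0 j) (z0 j) mj G0 q1 q2 q3 q4 hs Gle q5.
  exact: (lyapunov_step r0 gamma_gt0 eta_gt0 alpha_gt0 C_gt0 nR s0 gC gC2
    (h0 j) (z0 j) mj hs zs).
Qed.

End Run.

(** * The rate *)

Section Final.
Context {R : realType}.

Lemma EFin_expectation d (Omega : measurableType d) (P : probability Omega R)
  (X : Omega -> R) : is_L1 P X -> 'E_P[X]%E = (expect P X)%:E.
Proof. by move=> hX; rewrite unlock EFin_Ex. Qed.

(** Since [gamma <= alpha / 2 <= 1 / 8], all linear parts are close to the identity;
    [128 * 124] is [15872]. *)
Lemma stepsizes (eta alpha gamma C L l : R) :
  0 < eta -> 0 < alpha -> 0 < gamma -> 0 < C -> 0 < L ->
  eta <= gamma * (1 - l) / (32 * L) ->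
  gamma <= Num.min (1 / 2) (Num.min (alpha ^+ 2 * (1 - l) / (15872 * C)) (alpha / 2)) ->
  alpha <= 1 / (4 * (C + 1)) ->
  [/\ l < 1, gamma <= 1 / 2 /\ gamma <= 1 / 8, eta * L <= gamma / 2 * (1 - l) / 16,
   alpha * (C + 1) <= 1 / 4 & (128 * 124) * (gamma * C) <= alpha ^+ 2 * (1 - l)].
Proof.
rewrite (_ : 15872 = 128 * 124); last by rewrite -natrM.
move=> eta0 alpha0 gamma0 C0 L0 eta_le; rewrite !le_min => /andP[g2 /andP[gA ga]] alpha_le.
have L32 : 0 < 32 * L by rewrite mulr_gt0.
have C4 : 0 < 4 * (C + 1) by rewrite mulr_gt0// addr_gt0.
have alphaC : alpha * (C + 1) <= 1 / 4.
  by move: alpha_le; rewrite ler_pdivlMr// mulrCA; lra.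
have a4 : alpha <= 1 / 4.
  by apply: le_trans alphaC; rewrite ler_peMr ?(ltW alpha0)// lerDr ltW.
split=> //.
- have : 0 < gamma * (1 - l) / (32 * L) by exact: lt_le_trans eta_le.
  by rewrite pmulr_lgt0 ?invr_gt0// pmulr_rgt0// subr_gt0.
- by split=> //; move: ga a4; lra.
- by move: eta_le; rewrite ler_pdivlMr//; lra.
- by move: gA; rewrite ler_pdivlMr ?mulr_gt0// mulrCA.
Qed.

(** Dividing the bound on the sum by [K] and rounding the constants up. *)
Lemma average_bound (S De eta K L n rho h0 gamma C alpha z0 c0 s : R) :
  0 < eta -> 0 < K -> 0 < L -> 0 < n -> 0 < rho -> 0 < gamma -> 0 < C -> 0 < alpha ->
  0 <= h0 -> 0 <= z0 -> 0 <= c0 -> 0 <= s ->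
  S <= 4 / eta * De + 2 * L ^+ 2 / n * c0
    + 40 / 3 * (L ^+ 2 / (n * rho)) * (h0 + 2 * gamma * C / alpha * z0
      + 31 / 10 * (n * eta ^+ 2 * s) * K) + 2 * L * eta * s / n * K ->
  K^-1 * S <= 4 * De / (eta * K)
    + 256 * gamma * C * L ^+ 2 / (n * alpha * rho * K) * z0
    + 6 * L * eta * s / n + 168 * eta ^+ 2 * L ^+ 2 * s / rho
    + 4 * L ^+ 2 * c0 / (n * K) + 32 * L ^+ 2 / (n * rho * K) * h0.
Proof.
move=> e0 K0 L0 n0 r0 g0 C0 a0 hh zz cc ss hS.
have KV : 0 <= K^-1 by rewrite invr_ge0 ltW.
apply: le_trans (ler_wpM2l KV hS) _.
pose t1 := L ^+ 2 * c0 / (n * K).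
pose t2 := L ^+ 2 / (n * rho * K) * h0.
pose t3 := gamma * C * L ^+ 2 / (n * alpha * rho * K) * z0.
pose t4 := eta ^+ 2 * L ^+ 2 * s / rho.
pose t5 := L * eta * s / n.
have t1_ge0 : 0 <= t1 by rewrite /t1 !(mulr_ge0, invr_ge0, exprn_ge0)// ltW.
have t2_ge0 : 0 <= t2 by rewrite /t2 !(mulr_ge0, invr_ge0, exprn_ge0)// ltW.
have t3_ge0 : 0 <= t3 by rewrite /t3 !(mulr_ge0, invr_ge0, exprn_ge0)// ltW.
have t4_ge0 : 0 <= t4 by rewrite /t4 !(mulr_ge0, invr_ge0, exprn_ge0)// ltW.
have t5_ge0 : 0 <= t5 by rewrite /t5 !(mulr_ge0, invr_ge0, exprn_ge0)// ltW.
have -> : K^-1 * (4 / eta * De + 2 * L ^+ 2 / n * c0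
    + 40 / 3 * (L ^+ 2 / (n * rho)) * (h0 + 2 * gamma * C / alpha * z0
      + 31 / 10 * (n * eta ^+ 2 * s) * K) + 2 * L * eta * s / n * K) =
  4 * De / (eta * K) + 2 * t1 + 40 / 3 * t2 + 80 / 3 * t3 + 124 / 3 * t4 + 2 * t5.
  by rewrite /t1 /t2 /t3 /t4 /t5; field; rewrite !gt_eqF.
have -> : 4 * De / (eta * K)
    + 256 * gamma * C * L ^+ 2 / (n * alpha * rho * K) * z0
    + 6 * L * eta * s / n + 168 * eta ^+ 2 * L ^+ 2 * s / rho
    + 4 * L ^+ 2 * c0 / (n * K) + 32 * L ^+ 2 / (n * rho * K) * h0 =
  4 * De / (eta * K) + 4 * t1 + 32 * t2 + 256 * t3 + 168 * t4 + 6 * t5.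
  by rewrite /t1 /t2 /t3 /t4 /t5; field; rewrite !gt_eqF.
lra.
Qed.

End Final.

Theorem theorem1 (R : realType) (n p : nat) (hn : (2 <= n)%N)
  (* objective functions *)
  (f : 'I_n -> 'rV[R]_p -> R) (L : R)
  (f_diff : forall i x, differentiable (f i) x)
  (f_inf_finite : has_lbound (range (avg_fun f)))
  (L_gt0 : 0 < L)
  (f_smooth : forall i, smooth L (f i))
  (* network *)
  (e : rel 'I_n) (W : 'M[R]_n) (W_network : network e W)
  (lam : n.-tuple R) (W_spectrum : spectrum W lam)
  (Q1 : 'M[R]_(n, n.-1)) (W_eigenbasis : eigenbasis W lam Q1)
  (* parameters *)
  (eta alpha gamma C sigma : R)
  (eta_gt0 : 0 < eta) (alpha_gt0 : 0 < alpha) (gamma_gt0 : 0 < gamma)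
  (C_gt0 : 0 < C) (sigma_gt0 : 0 < sigma)
  (J P1 : 'M[R]_(n.-1 + n.-1)) (B_decomp : decomposition gamma lam J P1)
  (* probability space, samples, compressor *)
  (d : measure_display) (Omega : measurableType d) (P : probability Omega R)
  (dX : measure_display) (Xi : 'I_n -> measurableType dX)
  (g : forall i : 'I_n, 'rV[R]_p -> Xi i -> 'rV[R]_p)
  (g_meas : forall i, jointly_measurable (g i))
  (xi : int -> forall i : 'I_n, Omega -> Xi i)
  (dZ : measure_display) (Z : measurableType dZ)
  (Cop : 'rV[R]_p -> Z -> 'rV[R]_p) (Cop_meas : jointly_measurable Cop)
  (zeta : nat -> 'I_n -> Omega -> Z)
  (FS : int -> set_system Omega) (FC : nat -> set_system Omega)
  (F_history : history xi zeta FS FC)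
  (* the run of CEDAS *)
  (x_m1 H_0 : 'M[R]_(n, p)) (x : int -> Omega -> 'M[R]_(n, p))
  (y D H Q : nat -> Omega -> 'M[R]_(n, p))
  (run : cedas g Cop xi zeta W (fun=> eta) alpha gamma x_m1 H_0 x y D H Q)
  (g_unbiased : stoch_grad_assumption g xi P f sigma FS x)
  (Cop_unbiased : compressor_assumption Cop zeta P C FC y H)
  (* stepsize conditions *)
  (eta_le : eta <= gamma * (1 - lam`_1) / (32 * L))
  (gamma_le : gamma <=
    Num.min (1 / 2)
      (Num.min (alpha ^+ 2 * (1 - lam`_1) / (15872 * C)) (alpha / 2)))
  (alpha_le : alpha <= 1 / (4 * (C + 1)))
  (K : nat) (K_ge1 : (1 <= K)%N) :
  let xbar (k : int) (w : Omega) := mean_row (x k w) in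
  let f_inf := inf (range (avg_fun f)) in
  let lamt2 := lam_tilde gamma lam`_1 in
  let r0 (w : Omega) := D 0%N w + eta *: gradF f (consensus (xbar 0 w)) in
  let h0 (w : Omega) := check_h gamma lam Q1 J (x 0 w) (r0 w) in
  let grad_sq (k : int) (w : Omega) :=
    enorm (grad (avg_fun f) (xbar k w)) ^+ 2 in
  let y0H0_sq (w : Omega) := enorm (y 0%N w - H 0%N w) ^+ 2 in
  let h0_sq (w : Omega) := enorm (h0 w) ^+ 2 in
  ((K%:R^-1)%:E * \sum_(j < K) 'E_P[grad_sq (j%:Z - 1)%R]
   <= (4 * (avg_fun f (mean_row x_m1) - f_inf) / (eta * K%:R))%:E
      + (256 * gamma * C * L ^+ 2 / (n%:R * alpha * (1 - lamt2) * K%:R))%:E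
        * 'E_P[y0H0_sq]
      + (6 * L * eta * sigma ^+ 2 / n%:R)%:E
      + (168 * eta ^+ 2 * L ^+ 2 * sigma ^+ 2 / (1 - lamt2))%:E
      + (4 * L ^+ 2 * enorm (x_m1 - consensus (mean_row x_m1)) ^+ 2
          / (n%:R * K%:R))%:E
      + (32 * L ^+ 2 / (n%:R * (1 - lamt2) * K%:R))%:E * 'E_P[h0_sq])%E.
Proof.
cbv beta zeta.
pose grad_sq k w := enorm (grad (avg_fun f) (mean_row (x k w))) ^+ 2.
pose y0H0_sq w := enorm (y 0%N w - H 0%N w) ^+ 2.
pose h0_sq w := enorm (hstate f lam Q1 eta gamma J x D 0 w) ^+ 2.
have [lam2_lt1 [g2 g8] etaL' alphaC gA] := stepsizes eta_gt0 alpha_gt0 gamma_gt0 C_gt0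
  L_gt0 eta_le gamma_le alpha_le.
have rho0 : 0 < spectral_gap lam gamma := gap_gt0 gamma_gt0 lam2_lt1.
have rhoV : spectral_gap lam gamma = gamma / 2 * (1 - lam`_1) := gapE lam gamma.
have etaL : eta * L <= spectral_gap lam gamma / 16 by rewrite rhoV.
have lam0 : 0 <= lam`_1.
  have j : 'I_n.-1 by apply: (@Ordinal n.-1 0); rewrite -ltnS prednK// ltnW.
  exact: le_trans (lam_ge0 W_network W_eigenbasis j) (lam_le hn W_spectrum j).
have gC : (128 * 124) * (gamma * C) <= alpha ^+ 2.
  by apply: le_trans gA _; rewrite ler_piMr ?sqr_ge0// gerBl.
have gC2 : (128 * 124) * (gamma * (gamma * C)) <= alpha ^+ 2 * (2 * spectral_gap lam gamma).
  have := ler_wpM2l (ltW gamma_gt0) gA; rewrite rhoV.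
  have -> : gamma * (128 * 124 * (gamma * C)) = 128 * 124 * (gamma * (gamma * C)) by ring.
  by have -> : gamma * (alpha ^+ 2 * (1 - lam`_1)) =
    alpha ^+ 2 * (2 * (gamma / 2 * (1 - lam`_1))) by field.
have K0 : 0 < K%:R :> R by rewrite ltr0n.
have n0 : 0 < n%:R :> R by rewrite ltr0n ltnW.
have gs := good_states hn L_gt0 f_smooth W_network W_spectrum W_eigenbasis gamma_gt0
  g_meas Cop_meas F_history run g_unbiased Cop_unbiased g2 lam2_lt1.
have g0 := gs 0%N.
have main := run_bound hn f_diff f_inf_finite L_gt0 f_smooth W_network W_spectrum
  W_eigenbasis eta_gt0 alpha_gt0 gamma_gt0 C_gt0 B_decomp g_meas Cop_meas F_history run
  g_unbiased Cop_unbiased g2 lam2_lt1 g8 etaL alphaC gC gC2 K_ge1.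
have hL1 : is_L1 P h0_sq.
  rewrite /h0_sq; under eq_fun do rewrite nrm2E.
  exact: (hstate_L1 hn L_gt0 f_smooth W_network W_spectrum W_eigenbasis eta gamma_gt0 J
    g2 lam2_lt1 g0).
have zL1 : is_L1 P y0H0_sq.
  rewrite /y0H0_sq; under eq_fun do rewrite nrm2E.
  by apply: mL2_nrm2; exact: (yH_L2 L_gt0 f_smooth F_history run g_unbiased g0).
have gL1 j : is_L1 P (grad_sq (j%:Z - 1)).
  rewrite /grad_sq; under eq_fun do rewrite nrm2E.
  case: j => [|j].
    by under eq_fun do rewrite (cedas_xm1 run); exact: L1_cst.
  have -> : j.+1%:Z - 1 = j :> int by rewrite -addn1 PoszD addrK.
  exact: (grad_L1 f_diff L_gt0 f_smooth (gs j)).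
rewrite (EFin_expectation hL1) (EFin_expectation zL1).
under eq_bigr do rewrite (EFin_expectation (gL1 _)).
rewrite sumEFin -!EFinM -!EFinD lee_fin.
have gE k : grad_sq k = fun w => nrm2 (grad (avg_fun f) (mean_row (x k w))).
  by apply/funext => w; rewrite /grad_sq nrm2E.
have hE : h0_sq = fun w => nrm2 (hstate f lam Q1 eta gamma J x D 0 w).
  by apply/funext => w; rewrite /h0_sq nrm2E.
have zE : y0H0_sq = fun w => nrm2 (y 0%N w - H 0%N w).
  by apply/funext => w; rewrite /y0H0_sq nrm2E.
rewrite hE zE nrm2E -/(spectral_gap lam gamma).
under eq_bigr do rewrite gE.
apply: average_bound main => //; try exact: sqr_ge0; try exact: nrm2_ge0.
- by apply: Ex_ge0 => w; exact: nrm2_ge0.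
- by apply: Ex_ge0 => w; exact: nrm2_ge0.
Qed.
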